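(* Let $D\subset\mathbb{C}^d$ be a bounded complete hyperbolic domain with Kobayashi distance $K_D$, and let $\zeta\in\partial_H D$ be a point of the horofunction boundary of $(D,K_D)$. Suppose that $q_D(z)\to 1$ as $z\to\zeta$, $z\in D$ (convergence in the horofunction compactification $\overline{D}^H$). Then $D$ has the approaching geodesic property at $\zeta$: for any two asymptotic geodesic rays $\gamma,\sigma:[0,\infty)\to D$ of $(D,K_D)$ with $\gamma(\infty)=\sigma(\infty)=\zeta$, there exists $T\in\mathbb{R}$ such that $\lim_{t\to\infty}K_D(\gamma(t),\sigma(t+T))=0$.
   Context: Kobayashi distance. Let $\mathbb{D}\subset\mathbb{C}$ be the unit disc, $\mathbb{B}^d\subset\mathbb{C}^d$ the Euclidean unit ball, and $\mathcal{O}(A,B)$ the set of holomorphic maps $A\to B$. For a domain $D\subset\mathbb{C}^d$, $\kappa_D(z;X)=\inf\{|\alpha|:\exists\,\varphi\in\mathcal{O}(\mathbb{D},D),\ \varphi(0)=z,\ \alpha\varphi'(0)=X\}$, and $K_D(x,y)=\inf_\gamma\int_0^1\kappa_D(\gamma(t);\gamma'(t))\,dt$ over piecewise $C^1$ curves $\gamma:[0,1]\to D$ from $x$ to $y$. $D$ is complete hyperbolic if $K_D$ is a genuine distance and is complete (equivalently, $K_D$-balls are relatively compact in $D$). Geodesics. A geodesic of a metric space $(X,d)$ is a map $\sigma:I\to X$, $I\subset\mathbb{R}$ an interval, with $d(\sigma(s),\sigma(t))=|s-t|$ for all $s,t\in I$; it is a geodesic ray if $I=[0,\infty)$. Two geodesic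 rays $\gamma,\sigma$ are asymptotic if $\sup_{t\ge 0}d(\gamma(t),\sigma(t))<\infty$. Quotient invariant. For $p\in D$, $c_D(p)=\sup\{|\det\psi'(p)|^2:\psi\in\mathcal{O}(D,\mathbb{B}^d),\ \psi(p)=0\}$, $k_D(p)=\inf\{|\det\phi'(0)|^{-2}:\phi\in\mathcal{O}(\mathbb{B}^d,D),\ \phi(0)=p\}$, and $q_D(p)=c_D(p)/k_D(p)$. Horofunction compactification. Let $(X,d)$ be a proper metric space and fix a base point $p\in X$. Let $C(X)$ be the space of real-valued continuous functions on $X$ with the topology of uniform convergence on compact sets. The map $x\mapsto d_x$, $d_x(z)=d(z,x)-d(p,x)$, embeds $X$ homeomorphically in $C(X)$; $\overline{X}^H$ is the closure of its image and $\partial_H X=\overline{X}^H\setminus X$. For a geodesic ray $\gamma$ and $\zeta\in\partial_H X$, $\gamma(\infty)=\zeta$ means that $\gamma(t)\to\zeta$ in $\overline{X}^H$ as $t\to\infty$, i.e. $\zeta(z)=\lim_{t\to\infty}[d(z,\gamma(t))-d(p,\gamma(t))]$ for all $z\in X$; equivalently, $\zeta$ agrees up to an additive constant with $z\mapsto\lim_{t\to\infty}[d(z,\gamma(t))-t]$. Here $(X,d)=(D,K_D)$. *)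

(* Defs.v *)
From HB Require Import structures.
From mathcomp Require Import all_boot all_order all_algebra.
From mathcomp Require Import complex.
From mathcomp Require Import lra.
From mathcomp Require Import all_classical all_reals all_analysis.
Set Implicit Arguments.
Unset Strict Implicit.
Unset Printing Implicit Defensive.
Import Order.TTheory GRing.Theory Num.Theory.
Import numFieldNormedType.Exports.
Local Open Scope classical_set_scope.
Local Open Scope ring_scope.

(* As a [numClosedFieldType] (rather than the bare type [R[i]]), [C R] receives
   the topology and the normed module structure that the library attaches to
   every numeric field. *)
Definition C (R : realType) : numClosedFieldType := R[i].

Definition cabs (R : realType) (z : C R) : R := complex.Re `|z|.

Definition holo (R : realType) (V W : normedModType (C R))
    (A : set V) (B : set W) : set (V -> W) :=
  [set f | (forall z, A z -> differentiable f z) /\ (forall z, A z -> B (f z))].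

Definition unit_disc (R : realType) : set (C R) := [set z | cabs z < 1].

(* Euclidean unit ball; the library norm on row vectors is the sup norm. *)
Definition unit_ball (R : realType) (d : nat) : set 'rV[C R]_d :=
  [set z | \sum_(j < d) cabs (z 0 j) ^+ 2 < 1].

Definition domain (R : realType) (d : nat) (D : set 'rV[C R]_d) : Prop :=
  [/\ open D, connected D & D !=set0].

Section kobayashi.
Context {R : realType} {d : nat}.
Implicit Types (D : set 'rV[C R]_d) (z X x y : 'rV[C R]_d) (g : R -> 'rV[C R]_d).

Definition kobayashi_royden D z X : \bar R :=
  ereal_inf [set (cabs a)%:E | a in
    [set a : C R | exists phi : C R -> 'rV[C R]_d,
      [/\ holo (@unit_disc R) D phi, phi 0 = z & a *: derive1 phi 0 = X]]].

Definition re_coord g (j : 'I_d) (t : R) : R := complex.Re (g t 0 j).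
Definition im_coord g (j : 'I_d) (t : R) : R := complex.Im (g t 0 j).

Definition velocity g (t : R) : 'rV[C R]_d :=
  \row_j (derive1 (re_coord g j) t +i* derive1 (im_coord g j) t)%C.

Definition C1_real (f : R -> R) : Prop :=
  (forall t, derivable f t 1) /\ continuous (derive1 f).

Definition C1_curve g : Prop :=
  forall j, C1_real (re_coord g j) /\ C1_real (im_coord g j).

(* [g] is C^1 on a closed interval iff it agrees there with a C^1 curve defined
   on the whole line. Continuity of [g] on [0, 1] follows. *)
Definition piecewise_C1 g : Prop :=
  exists n (s : nat -> R), [/\ s 0%N = 0, s n = 1 &
    forall i, (i < n)%N -> s i < s i.+1 /\
      exists2 h, C1_curve h & {in `[s i, s i.+1], g =1 h}].

Definition joins D x y : set (R -> 'rV[C R]_d) :=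
  [set g | [/\ piecewise_C1 g, forall t, t \in `[0, 1] -> D (g t),
               g 0 = x & g 1 = y]].

Definition kobayashi D x y : \bar R :=
  ereal_inf [set (\int[@lebesgue_measure R]_(t in `[0%R, 1%R])
                    kobayashi_royden D (g t) (velocity g t))%E
            | g in joins D x y].

Record hyperbolic D : Prop := Hyperbolic {
  kobayashi_fin : forall x y, D x -> D y -> kobayashi D x y \is a fin_num ;
  kobayashixx : forall x, D x -> kobayashi D x x = 0%E ;
  kobayashi_sep : forall x y, D x -> D y -> kobayashi D x y = 0%E -> x = y ;
  kobayashi_sym : forall x y, D x -> D y -> kobayashi D x y = kobayashi D y x ;
  kobayashi_triangle : forall y x z, D x -> D y -> D z ->
    (kobayashi D x z <= kobayashi D x y + kobayashi D y z)%E }.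

Definition caratheodory_volume D z : \bar R :=
  ereal_sup [set (cabs (\det ('J psi z)) ^+ 2)%:E | psi in
    [set psi : 'rV[C R]_d -> 'rV[C R]_d |
      holo D (@unit_ball R d) psi /\ psi z = 0]].

(* The inverse is taken in [\bar R], where 0^-1 = +oo: maps with degenerate
   differential do not affect the infimum. *)
Definition kobayashi_volume D z : \bar R :=
  ereal_inf [set ((cabs (\det ('J phi 0)) ^+ 2)%:E^-1)%E | phi in
    [set phi : 'rV[C R]_d -> 'rV[C R]_d |
      holo (@unit_ball R d) D phi /\ phi 0 = z]].

Definition quotient_invariant D z : \bar R :=
  (caratheodory_volume D z / kobayashi_volume D z)%E.

End kobayashi.

Definition kobayashi_space (R : realType) (d : nat) (D : set 'rV[C R]_d)
  (hD : hyperbolic D) : Type := set_type D.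

Section kobayashi_space.
Context {R : realType} {d : nat} (D : set 'rV[C R]_d) (hD : hyperbolic D).

Definition kobayashi_point (x : kobayashi_space hD) : 'rV[C R]_d := val x.

HB.instance Definition _ := Choice.copy (kobayashi_space hD) (set_type D).

Let dist (x y : kobayashi_space hD) : R :=
  fine (kobayashi D (kobayashi_point x) (kobayashi_point y)).

Let inD (x : kobayashi_space hD) : D (kobayashi_point x).
Proof. exact: set_valP x. Qed.

Let distxx x : dist x x = 0.
Proof. by rewrite /dist (kobayashixx hD). Qed.

Let dist_positivity x y : dist x y = 0 -> x = y.
Proof.
move=> xy; apply: val_inj; apply: (kobayashi_sep hD) => //.
by rewrite -[LHS]fineK ?(kobayashi_fin hD)// -/(dist x y) xy.
Qed.

Let dist_sym x y : dist x y = dist y x.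
Proof. by rewrite /dist (kobayashi_sym hD). Qed.

Let dist_triangle y x z : dist x z <= dist x y + dist y z.
Proof.
rewrite -fineD ?(kobayashi_fin hD)// fine_le ?fin_numD ?(kobayashi_fin hD)//.
exact: (kobayashi_triangle hD).
Qed.

HB.instance Definition _ := @isMetric.Build R (kobayashi_space hD)
  dist distxx dist_positivity dist_sym dist_triangle.

End kobayashi_space.

Definition complete_metric (R : realType) (X : metricType R) : Prop :=
  forall F : set_system X, ProperFilter F -> cauchy F -> exists x : X, F --> x.

Section geodesics.
Context {R : realType} {X : metricType R}.
Implicit Types gamma sigma : R -> X.

Definition geodesic (I : interval R) gamma : Prop :=
  {in I &, forall s t, mdist (gamma s) (gamma t) = `|s - t|}.

Definition geodesic_ray gamma : Prop := geodesic `[0, +oo[ gamma.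

Definition asymptotic gamma sigma : Prop :=
  (ereal_sup [set (mdist (gamma t) (sigma t))%:E | t in `[0%R, +oo[] < +oo)%E.

End geodesics.

(* C(X) with the topology of uniform convergence on compact sets. *)
Definition cts_space (R : realType) (X : metricType R) : topologicalType :=
  initial_topology
    ((fun f => f) : continuousType X R -> {family compact, X -> R}).

Section horofunctions.
Context {R : realType} {X : metricType R}.
Implicit Types (p x z : X).

Definition horo_fun p x z : R := mdist z x - mdist p x.

Lemma horo_fun_continuous p x : continuous (horo_fun p x).
Proof.
move=> z; apply/cvgrPdist_lt => e e0; near=> w.
have zw : mdist z w < e.
  near: w; apply/nbhs_ballP; exists e => //= w; by rewrite ballEmdist.
apply: le_lt_trans zw; rewrite /horo_fun /= ler_norml; apply/andP.
have zxw := metric_triangle z w x; have wxz := metric_triangle w z x.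
by rewrite (metric_sym w z) in wxz; split; lra.
Unshelve. all: by end_near. Qed.

Definition horo_embed p x : cts_space X := mkcts (@horo_fun_continuous p x).

Definition horo_compactification p : set (cts_space X) :=
  closure (range (horo_embed p)).

Definition horo_boundary p : set (cts_space X) :=
  horo_compactification p `\` range (horo_embed p).

(* The filter on [X] of the traces of the neighbourhoods of [zeta]. *)
Definition horo_nbhs p (zeta : cts_space X) : set_system X :=
  filter_from (nbhs zeta) (fun U => horo_embed p @^-1` U).

Definition ends_at p (gamma : R -> X) (zeta : cts_space X) : Prop :=
  horo_embed p (gamma t) @[t --> +oo] --> zeta.

Definition approaching_geodesics p (zeta : cts_space X) : Prop :=
  forall gamma sigma : R -> X, geodesic_ray gamma -> geodesic_ray sigma ->
    asymptotic gamma sigma -> ends_at p gamma zeta -> ends_at p sigma zeta ->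
    exists T : R, mdist (gamma t) (sigma (t + T)) @[t --> +oo] --> (0 : R).

End horofunctions.

(* Main.v *)
(* At a point [a] where the quotient invariant is close to 1 there are maps
   [phi] from the ball to [D] with [phi 0 = a] and [psi] from [D] to the ball with
   [psi a = 0] such that [psi \o phi] has Jacobian determinant of modulus close to 1
   at 0. By the Schwarz lemma its differential is then nearly unitary and, on compact
   subsets of the ball, [psi \o phi] is uniformly close to it. Hence large Kobayashi
   balls around [a] lift through [phi], and on them [K_D] is compared from both sides
   with the Bergman-Kobayashi distance of the ball: maps into [D] bound [K_D] from
   above, maps out of [D] bound it from below.

   Shift the time of [sigma] so that [zeta] takes the same value at [a = gamma t] and
   [b = sigma (t + T)], and consider also the points at time distance [S] before and
   after them. In the chart at [a] the points [gamma (t + S)], [gamma (t - S)] are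
   nearly antipodal near the sphere and, the rays being asymptotic,
   [sigma (t + T + S)], [sigma (t + T - S)] are close to them. So the image of [b] lies
   nearly on the diameter joining them. As [zeta] is 1-Lipschitz, [b] is at distance at
   least [S] from both [gamma (t + S)] and [gamma (t - S)], which forces it near the
   centre of the diameter; thus [b] is close to [a]. *)
Require Import Defs.
From HB Require Import structures.
From mathcomp Require Import all_boot all_order all_algebra complex lra ring.
From mathcomp Require Import all_classical all_reals all_analysis.
Set Implicit Arguments.
Unset Strict Implicit.
Unset Printing Implicit Defensive.
Import Order.TTheory GRing.Theory Num.Theory.
Import numFieldNormedType.Exports.
Local Open Scope classical_set_scope.
Local Open Scope ring_scope.

(** * Goursat's theorem on rectangles *)

(** Holomorphic means complex differentiable at each point, with no continuity of the derivative
    assumed, so the Schwarz lemma is reached from Goursat's bisection: in the coordinate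
    [z0 + exp(s + i t)] it makes circle means independent of the radius. The resulting maximum
    principle tolerates isolated points where only continuity is known, and this replaces Cauchy's
    formula in removing singularities. The infinitesimal metric is not known to be measurable along
    a curve, so lengths are lower integrals and are estimated by monotonicity and superadditivity
    alone. Nothing makes [phi] injective or proper. A point is lifted by following a curve of
    bounded length, which cannot leave the image of a closed ball because [psi \o phi] keeps the
    bounding sphere away from where [psi] sends the curve. The distance of the ball enters only
    through its squared hyperbolic cosine [|1 - <u,v>|^2 / ((1 - |u|^2) (1 - |v|^2))], so that all
    comparisons are polynomial inequalities. The time span [S] depends only on the accuracy and on a
    bound for the distance between the rays; it is fixed before the tolerance on the invariant. *)

Section segment_integral.
Context {R : realType}.
Local Notation mu := (@lebesgue_measure R).

Definition segint (f : R -> R) (a b : R) : R := \int[mu]_(x in `[a, b]) f x.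

Definition ctson (f : R -> R) (a b : R) := forall x, a <= x <= b -> {for x, continuous f}.

Lemma ctsonB f g a b : ctson f a b -> ctson g a b -> ctson (fun x => f x - g x) a b.
Proof. by move=> cf cg x xab; apply: cvgB; [exact: cf|exact: cg]. Qed.

Lemma ctson_within f a b : ctson f a b -> {within `[a, b], continuous f}.
Proof.
move=> cf; apply: continuous_in_subspaceT => x; rewrite inE /= in_itv /= => xab.
exact: cf.
Qed.

Lemma ctson_integrable f a b : ctson f a b -> mu.-integrable `[a, b] (EFin \o f).
Proof.
move=> cf; apply: continuous_compact_integrable; first exact: segment_compact.
exact: ctson_within.
Qed.

Lemma segint_split f a m b : a <= m -> m <= b -> ctson f a b ->
  segint f a b = segint f a m + segint f m b.
Proof.
move=> am mb cf; have := @Rintegral_itvB R f (BLeft a) (BRight b) m (ctson_integrable cf).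
rewrite !bnd_simp => /(_ am mb) h.
rewrite /segint -(Rintegral_itv_obnd_cbnd (b := BRight b) (r := m)); first by rewrite -h; ring.
apply: integrableS (ctson_integrable cf) => //.
by apply: subset_itvr; rewrite bnd_simp.
Qed.

Lemma segintB f g a b : ctson f a b -> ctson g a b ->
  segint (fun x => f x - g x) a b = segint f a b - segint g a b.
Proof. by move=> cf cg; rewrite /segint RintegralB//; exact: ctson_integrable. Qed.

Lemma segint_cst k a b : a <= b -> segint (fun=> k) a b = k * (b - a).
Proof.
move=> ab; rewrite /segint Rintegral_cst//; congr (_ * _).
have /= -> := @lebesgue_measure_itv R `[a, b].
by rewrite lte_fin; case: ltgtP ab => //= -> _; rewrite subrr.
Qed.

Lemma ctson_cst k a b : ctson (fun=> k) a b.
Proof. by move=> x _; exact: cst_continuous. Qed.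

Lemma segint_le f g a b : ctson f a b -> ctson g a b ->
  (forall x, a <= x <= b -> f x <= g x) -> segint f a b <= segint g a b.
Proof.
move=> cf cg fg; apply: le_Rintegral => //; try exact: ctson_integrable.
Qed.

Lemma segint_approx f k e a b : a <= b -> ctson f a b ->
  (forall x, a <= x <= b -> `|f x - k| <= e) ->
  `|segint f a b - k * (b - a)| <= e * (b - a).
Proof.
move=> ab cf fk.
have h1 : segint f a b <= segint (fun=> k + e) a b.
  apply: segint_le => //; first exact: ctson_cst.
  by move=> x /fk; rewrite ler_norml => /andP[]; lra.
have h2 : segint (fun=> k - e) a b <= segint f a b.
  apply: segint_le => //; first exact: ctson_cst.
  by move=> x /fk; rewrite ler_norml => /andP[]; lra.
rewrite !segint_cst// in h1 h2; rewrite ler_norml; apply/andP; split; lra.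
Qed.

End segment_integral.

Section goursat.
Context {R : realType}.
Implicit Types (u v : R -> R -> R).

(* u + i v is complex differentiable at x + i y, with derivative p + i q *)
Definition crdiff u v (x y : R) := exists p q : R, forall e : R, 0 < e ->
  exists2 d : R, 0 < d & forall x' y', `|x' - x| < d -> `|y' - y| < d ->
    `|u x' y' - u x y - (p * (x' - x) - q * (y' - y))| <= e * (`|x' - x| + `|y' - y|) /\
    `|v x' y' - v x y - (q * (x' - x) + p * (y' - y))| <= e * (`|x' - x| + `|y' - y|).

Lemma first_order_continuous (f : R -> R) (x p : R) :
  (forall e : R, 0 < e -> exists2 d : R, 0 < d & forall x', `|x' - x| < d ->
     `|f x' - f x - p * (x' - x)| <= e * `|x' - x|) -> {for x, continuous f}.
Proof.
move=> h; apply/cvgrPdist_lt => e e0; have [d d0 hd] := h 1 ltr01.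
apply/nbhs_ballP; exists (Num.min d (e / (2 * (1 + `|p|)))) => /=.
  by rewrite lt_min d0 /= divr_gt0// mulr_gt0// ltr_pwDl.
move=> y; rewrite /ball /= distrC lt_min => /andP[yd ye].
have := hd _ yd; rewrite mul1r => h1.
have h2 : `|f y - f x| <= (1 + `|p|) * `|y - x|.
  rewrite (_ : f y - f x = (f y - f x - p * (y - x)) + p * (y - x)); last by ring.
  by rewrite (le_trans (ler_normD _ _))// mulrDl mul1r normrM lerD.
rewrite distrC (le_lt_trans h2)//.
have p1 : 0 < 1 + `|p| by rewrite ltr_pwDl.
rewrite ltr_pdivlMr in ye; last by lra.
have := normr_ge0 (y - x); nra.
Qed.

Lemma crdiff_ctsx u v x y : crdiff u v x y ->
  {for x, continuous (u ^~ y)} /\ {for x, continuous (v ^~ y)}.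
Proof.
move=> [p [q h]]; split; [apply: (@first_order_continuous _ _ p)|
  apply: (@first_order_continuous _ _ q)] => e e0; have [d d0 hd] := h _ e0;
exists d => // x' xd; have := hd x' y xd; rewrite subrr normr0 => /(_ d0) [h1 h2].
- by move: h1; rewrite mulr0 subr0 addr0.
- by move: h2; rewrite mulr0 !addr0.
Qed.

Lemma crdiff_ctsy u v x y : crdiff u v x y ->
  {for y, continuous (u x)} /\ {for y, continuous (v x)}.
Proof.
move=> [p [q h]]; split; [apply: (@first_order_continuous _ _ (- q))|
  apply: (@first_order_continuous _ _ p)] => e e0; have [d d0 hd] := h _ e0;
exists d => // y' yd; have := hd x y'; rewrite subrr normr0 => /(_ d0 yd) [h1 h2].
- by move: h1; rewrite mulr0 sub0r add0r mulNr.
- by move: h2; rewrite mulr0 !add0r.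
Qed.

(** The real part of the counterclockwise integral of [(u + i v) dz] around the rectangle with sides
    [[a, b]] and [[c, d]]. *)
Definition boundary_integral u v a b c d : R :=
  segint (fun x => u x c - u x d) a b + segint (fun y => v a y - v b y) c d.

Variables (u v : R -> R -> R) (s0 : R).
Hypothesis uv : forall x y, x < s0 -> crdiff u v x y.
Local Notation W := (boundary_integral u v).

Let ctsx (y a b : R) : b < s0 -> ctson (u ^~ y) a b.
Proof. by move=> bs x /andP[_ xb]; apply: (crdiff_ctsx (uv _ (le_lt_trans xb bs))).1. Qed.

Let ctsy (x c d : R) : x < s0 -> ctson (v x) c d.
Proof. by move=> bs y _; apply: (crdiff_ctsy (uv _ bs)).2. Qed.

Let W_splitx a m b c d : a <= m -> m <= b -> b < s0 -> c <= d ->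
  W a b c d = W a m c d + W m b c d.
Proof.
move=> am mb bs cd; rewrite /boundary_integral.
rewrite (@segint_split _ _ a m b)//; last by apply: ctsonB; exact: ctsx.
have ms : m < s0 by lra.
have as_ : a < s0 by lra.
rewrite !segintB; try (exact: ctsx || exact: ctsy); ring.
Qed.

Let W_splity a b c m d : a <= b -> b < s0 -> c <= m -> m <= d ->
  W a b c d = W a b c m + W a b m d.
Proof.
move=> ab bs cm md; rewrite /boundary_integral.
have as_ : a < s0 by lra.
rewrite (@segint_split _ _ c m d)//; last by apply: ctsonB; exact: ctsy.
rewrite !segintB; try (exact: ctsx || exact: ctsy); ring.
Qed.

(** The boundary integral of an affine holomorphic function vanishes: opposite sides differ by the
    constants [q (d - c)] and [- q (b - a)], whose integrals cancel. Each difference of two sides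
    carries an error of twice [e] times the half perimeter. *)
Let W_local x y (e : R) : 0 < e -> x < s0 -> exists2 r : R, 0 < r &
  forall a b c d, a <= x <= b -> b < s0 -> c <= y <= d -> b - a < r -> d - c < r ->
  `|W a b c d| <= 2 * e * ((b - a) + (d - c)) ^+ 2.
Proof.
move=> e0 xs; have [p [q /(_ _ e0)[r r0 hr]]] := uv y xs.
exists r => // a b c d /andP[ax xb] bs /andP[cy yd] bar dcr.
set l := (b - a) + (d - c).
have near x' y' : a <= x' <= b -> c <= y' <= d -> 
    `|u x' y' - u x y - (p * (x' - x) - q * (y' - y))| <= e * l /\
    `|v x' y' - v x y - (q * (x' - x) + p * (y' - y))| <= e * l.
  move=> /andP[h1 h2] /andP[h3 h4].
  have hx : `|x' - x| <= b - a by rewrite ler_norml; apply/andP; split; lra.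
  have hy : `|y' - y| <= d - c by rewrite ler_norml; apply/andP; split; lra.
  have [k1 k2] := hr x' y' (le_lt_trans hx bar) (le_lt_trans hy dcr).
  have hl : e * (`|x' - x| + `|y' - y|) <= e * l by rewrite ler_pM2l// /l lerD.
  by split; [exact: le_trans k1 hl|exact: le_trans k2 hl].
have ab : a <= b by lra. have cd : c <= d by lra.
have as_ : a < s0 by lra.
have := @segint_approx _ (fun x => u x c - u x d) (q * (d - c)) (2 * e * l) a b ab.
have := @segint_approx _ (fun y => v a y - v b y) (- (q * (b - a))) (2 * e * l) c d cd.
move=> H1; have {}H1 := H1 (ltac:(by apply: ctsonB; exact: ctsy)).
move=> H2; have {}H2 := H2 (ltac:(by apply: ctsonB; exact: ctsx)).
have {}H1 : `|segint (fun y => v a y - v b y) c d - - (q * (b - a)) * (d - c)| <= 2 * e * l * (d - c).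
  apply: H1 => y' yy; have aa : a <= a <= b by lra. have bb : a <= b <= b by lra.
  have [_] := near a y' aa yy; have [_] := near b y' bb yy.
  by rewrite !ler_norml => /andP[? ?] /andP[? ?]; apply/andP; split; lra.
have {}H2 : `|segint (fun x => u x c - u x d) a b - q * (d - c) * (b - a)| <= 2 * e * l * (b - a).
  apply: H2 => x' xx; have aa : c <= c <= d by lra. have bb : c <= d <= d by lra.
  have [+ _] := near x' c xx aa; have [+ _] := near x' d xx bb.
  by rewrite !ler_norml => /andP[? ?] /andP[? ?]; apply/andP; split; lra.
move: H1 H2; rewrite !ler_norml /boundary_integral => /andP[K1 K2] /andP[K3 K4].
by apply/andP; rewrite -/l expr2 {2 4}/l; split; lra.
Qed.

(** Bisection: a quarter on which the integral exceeds a fixed multiple [e] of the area always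
    survives, and the common point of the nested rectangles contradicts the local estimate. *)
Lemma goursat a b c d : a < b -> b < s0 -> c < d -> W a b c d = 0.
Proof.
move=> ab bs cd; apply/eqP; rewrite -normr_le0 leNgt; apply/negP => W0.
pose al := b - a; pose be := d - c.
have al0 : 0 < al by rewrite /al; lra.
have be0 : 0 < be by rewrite /be; lra.
pose h (n : nat) : R := 2^-1 ^+ n.
have h_gt0 n : 0 < h n by rewrite exprn_gt0.
have hS n : h n = 2 * h n.+1 by rewrite /h exprS mulrA divff ?mul1r.
pose e := `|W a b c d| / 2 / (al * be).
have albe0 : 0 < al * be by rewrite mulr_gt0.
have e0 : 0 < e by rewrite !divr_gt0.
pose bad n (z : R * R) := [/\ a <= z.1, z.1 + h n * al <= b &
  e * (h n * al) * (h n * be) < `|W z.1 (z.1 + h n * al) z.2 (z.2 + h n * be)|].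
have bad0 : bad 0%N (a, c).
  split => //=; rewrite /h expr0 ?mul1r; first by rewrite /al; lra.
  rewrite /al subrKC /be subrKC -/al -/be -mulrA /e divfK ?gt_eqF//; lra.
(* The implication sits inside the existential so that [choice] yields a total function; on
   rectangles that are not bad any value will do. *)
have step (nz : nat * (R * R)) : exists z', bad nz.1 nz.2 ->
   [/\ bad nz.1.+1 z', nz.2.1 <= z'.1, z'.1 + h nz.1.+1 * al <= nz.2.1 + h nz.1 * al,
     nz.2.2 <= z'.2 & z'.2 + h nz.1.+1 * be <= nz.2.2 + h nz.1 * be].
  case: nz => n [x y] /=; case: (pselect (bad n (x, y))) => [|nb]; last by exists (x, y).
  move=> [/= ax xb]; rewrite (hS n); set k := h n.+1.
  have k0 : 0 < k := h_gt0 _.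
  set A := k * al; set B := k * be.
  have A0 : 0 < A by rewrite mulr_gt0.
  have B0 : 0 < B by rewrite mulr_gt0.
  rewrite -!(mulrA 2) -/A -/B (_ : e * (2 * A) * (2 * B) = 4 * (e * A * B)) => [bd|]; last by ring.
  have xb' : x + 2 * A <= b by move: xb; rewrite (hS n) -mulrA.
  rewrite (@W_splitx x (x + A)) in bd; [|lra..].
  rewrite (@W_splity x (x + A) y (y + B)) in bd; [|lra..].
  rewrite (@W_splity (x + A) _ y (y + B)) in bd; [|lra..].
  rewrite (_ : x + 2 * A = x + A + A) in bd; last by ring.
  rewrite (_ : y + 2 * B = y + B + B) in bd; last by ring.
  case: (leP `|W x (x + A) y (y + B)| (e * A * B)) => [h1|h1]; last first.
    exists (x, y) => _; rewrite /bad /= -/A -/B; split=> //; [split=> //|..]; clear bd; lra.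
  case: (leP `|W x (x + A) (y + B) (y + B + B)| (e * A * B)) => [h2|h2]; last first.
    exists (x, y + B) => _; rewrite /bad /= -/A -/B; split=> //; [split=> //|..]; clear bd; lra.
  case: (leP `|W (x + A) (x + A + A) y (y + B)| (e * A * B)) => [h3|h3]; last first.
    exists (x + A, y) => _; rewrite /bad /= -/A -/B; split=> //; [split=> //|..]; clear bd; lra.
  case: (leP `|W (x + A) (x + A + A) (y + B) (y + B + B)| (e * A * B)) => [h4|h4]; last first.
    exists (x + A, y + B) => _; rewrite /bad /= -/A -/B; split=> //; [split=> //|..]; clear bd; lra.
  exfalso; move: bd; apply/negP; rewrite -leNgt.
  apply: le_trans (ler_normD _ _) _; apply: le_trans (lerD (ler_normD _ _) (ler_normD _ _)) _.
  set E := e * A * B in h1 h2 h3 h4 *; lra.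
have [f fP] := choice step.
pose z := fix z n := if n is m.+1 then f (m, z m) else (a, c).
have badz n : bad n (z n) by elim: n => // n /(fP (n, z n))[].
have zS n := fP (n, z n) (badz n).
have mon n m : [/\ (z n).1 <= (z (n + m)%N).1,
    (z (n + m)%N).1 + h (n + m)%N * al <= (z n).1 + h n * al,
    (z n).2 <= (z (n + m)%N).2 & (z (n + m)%N).2 + h (n + m)%N * be <= (z n).2 + h n * be].
  elim: m => [|m IH]; first by rewrite addn0.
  rewrite addnS; have [_ /= h1 h2 h3 h4] := zS (n + m)%N; move: IH => [k1 k2 k3 k4].
  split; [exact: le_trans k1 h1|exact: le_trans h2 k2|exact: le_trans k3 h3|exact: le_trans h4 k4].
(* Every lower corner lies below every upper corner, so the suprema of the lower corners belong to
   all the rectangles. *)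
have cross n m : (z n).1 <= (z m).1 + h m * al /\ (z n).2 <= (z m).2 + h m * be.
  case/orP: (leq_total n m) => [nm|mn].
    have [h1 _ h2 _] := mon n (m - n)%N; rewrite subnKC// in h1 h2.
    have := mulr_gt0 (h_gt0 m) al0; have := mulr_gt0 (h_gt0 m) be0; split; lra.
  have [_ h1 _ h2] := mon m (n - m)%N; rewrite subnKC// in h1 h2.
  have := mulr_gt0 (h_gt0 n) al0; have := mulr_gt0 (h_gt0 n) be0; split; lra.
pose X := sup (range (fun n => (z n).1)); pose Y := sup (range (fun n => (z n).2)).
have XP n : (z n).1 <= X <= (z n).1 + h n * al.
  apply/andP; split.
    apply: ub_le_sup; last by exists n.
    by exists ((z 0%N).1 + h 0%N * al) => _ [m _ <-]; exact: (cross _ _).1.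
  apply: ge_sup; first by exists (z 0%N).1, 0%N.
  by move=> _ [m _ <-]; exact: (cross _ _).1.
have YP n : (z n).2 <= Y <= (z n).2 + h n * be.
  apply/andP; split.
    apply: ub_le_sup; last by exists n.
    by exists ((z 0%N).2 + h 0%N * be) => _ [m _ <-]; exact: (cross _ _).2.
  apply: ge_sup; first by exists (z 0%N).2, 0%N.
  by move=> _ [m _ <-]; exact: (cross _ _).2.
have Xs : X < s0 by have [_ ? _] := badz 0%N; have /andP[_ ?] := XP 0%N; lra.
(* Chosen so that the local bound [2 * e' * (h n * al + h n * be) ^+ 2] equals [e] times the area of
   the n-th rectangle. *)
pose e' := e * (al * be) / (2 * (al + be) ^+ 2).
have ab2 : 0 < 2 * (al + be) ^+ 2 by rewrite mulr_gt0// exprn_gt0// addr_gt0.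
have e'0 : 0 < e' by rewrite divr_gt0// mulr_gt0.
have [r r0 hr] := W_local Y e'0 Xs.
have [n hn] : exists n, h n * (al + be) < r.
  have hc : h m @[m --> \oo] --> (0 : R).
    by apply: cvg_expr; rewrite ger0_norm ?invr_ge0// invf_lt1// ltr1n.
  have rab : 0 < r / (al + be) by rewrite divr_gt0// addr_gt0.
  move/cvgrPdist_lt : hc => /(_ _ rab)[N _ /(_ N (leqnn _))].
  rewrite /= sub0r normrN (gtr0_norm (h_gt0 N)) => hN.
  by exists N; rewrite -ltr_pdivlMr// addr_gt0.
have [_ zb hb] := badz n; move: hb; apply/negP; rewrite -leNgt.
have hal : 0 < h n * al by rewrite mulr_gt0.
have hbe : 0 < h n * be by rewrite mulr_gt0.
apply: le_trans (hr _ _ _ _ (XP n) _ (YP n) _ _) _; [lra|lra|lra|].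
rewrite le_eqVlt; apply/orP; left; apply/eqP; rewrite /e'.
have : al + be != 0 by rewrite gt_eqF// addr_gt0.
by rewrite !(addrC _ (h n * _)) !addrK => ?; field.
Qed.

End goursat.

(** * Real-valued norms and the modulus *)

Section real_norm.
Context {R : realType} {V : normedModType (C R)}.
Implicit Types x y : V.

(** Norms of modules over [C R] take values in [C R]; their real part brings estimates within reach
    of real arithmetic. *)
Definition nrm x : R := complex.Re `|x|.

Lemma nrmE x : `|x| = ((nrm x)%:C)%C :> C R.
Proof.
rewrite /nrm; have := normr_ge0 x; case: (`|x|) => a b.
by rewrite lecE /= => /andP[/eqP -> _].
Qed.

Lemma nrm_ge0 x : 0 <= nrm x.
Proof. by have : 0 <= `|x| := normr_ge0 x; rewrite nrmE lecE /= => /andP[]. Qed.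

Lemma nrm0 : nrm 0 = 0. Proof. by rewrite /nrm normr0. Qed.

Lemma nrm_eq0 x : (nrm x == 0) = (x == 0).
Proof. by have <- : (`|x| == 0) = (x == 0) := normr_eq0 x; rewrite nrmE eq_complex /= eqxx andbT. Qed.

Lemma nrm_gt0 x : (0 < nrm x) = (x != 0).
Proof. by rewrite lt_def nrm_ge0 andbT nrm_eq0. Qed.

Lemma nrmD x y : nrm (x + y) <= nrm x + nrm y.
Proof. by have : `|x + y| <= `|x| + `|y| := ler_normD x y; rewrite !nrmE -rmorphD lecR. Qed.

Lemma nrmN x : nrm (- x) = nrm x. Proof. by rewrite /nrm normrN. Qed.

Lemma nrmB x y : nrm (x - y) = nrm (y - x). Proof. by rewrite -nrmN opprB. Qed.

Lemma nrm_tri z x y : nrm (x - y) <= nrm (x - z) + nrm (z - y).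
Proof. by rewrite -{1}(subrK z x) -addrA nrmD. Qed.

Lemma ler_dist_nrm x y : `|nrm x - nrm y| <= nrm (x - y).
Proof.
have h1 := nrm_tri y x 0; have h2 := nrm_tri x y 0; rewrite !subr0 (nrmB y x) in h1 h2.
by rewrite ler_norml; apply/andP; split; lra.
Qed.

Lemma nbhs_nrmP x (A : set V) :
  nbhs x A <-> exists2 e : R, 0 < e & forall y, nrm (y - x) < e -> A y.
Proof.
split=> [/nbhs_ballP[e /= e0 h]|[e e0 h]].
  have eE : e = ((complex.Re e)%:C)%C.
    by case: e e0 {h} => a b; rewrite ltcE /= => /andP[/eqP->].
  exists (complex.Re e); first by move: e0; rewrite ltcE => /andP[].
  move=> y yx; apply: h; rewrite -ball_normE /ball_ /= distrC nrmE eE.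
  by rewrite ltcR.
apply/nbhs_ballP; exists (e%:C)%C => /=; first by rewrite ltcR.
by move=> y; rewrite -ball_normE /ball_ /= distrC nrmE ltcR => ?; exact: h.
Qed.

End real_norm.

Lemma nrmZ {R : realType} {V : normedModType (C R)} (a : C R) (x : V) : nrm (a *: x) = cabs a * nrm x.
Proof.
have : `|a *: x| = `|a| * `|x| := normrZ a x.
by rewrite (nrmE x) (nrmE (a *: x)) (@nrmE R (C R) a) -rmorphM => -[].
Qed.

Definition rc {R : realType} (x : R) : C R := (x%:C)%C.

Section cabs.
Context {R : realType}.
Implicit Types z w : C R.

Lemma cabs_nrm z : cabs z = nrm z. Proof. by []. Qed.
Lemma cabsE z : `|z| = ((cabs z)%:C)%C :> C R. Proof. exact: (@nrmE R (C R)). Qed.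
Lemma cabs_ge0 z : 0 <= cabs z. Proof. exact: (@nrm_ge0 R (C R)). Qed.
Lemma cabs0 : cabs (0 : C R) = 0. Proof. exact: (@nrm0 R (C R)). Qed.
Lemma cabs_eq0 z : (cabs z == 0) = (z == 0). Proof. exact: (@nrm_eq0 R (C R)). Qed.
Lemma cabs_gt0 z : (0 < cabs z) = (z != 0). Proof. exact: (@nrm_gt0 R (C R)). Qed.
Lemma cabsD z w : cabs (z + w) <= cabs z + cabs w. Proof. exact: (@nrmD R (C R)). Qed.
Lemma cabsN z : cabs (- z) = cabs z. Proof. exact: (@nrmN R (C R)). Qed.
Lemma cabsB z w : cabs (z - w) = cabs (w - z). Proof. exact: (@nrmB R (C R)). Qed.
Lemma cabs_tri v z w : cabs (z - w) <= cabs (z - v) + cabs (v - w).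
Proof. exact: (@nrm_tri R (C R)). Qed.
Lemma ler_dist_cabs z w : `|cabs z - cabs w| <= cabs (z - w).
Proof. exact: (@ler_dist_nrm R (C R)). Qed.
Lemma cabsM z w : cabs (z * w) = cabs z * cabs w.
Proof. exact: (@nrmZ R (C R)). Qed.
Lemma cabs1 : cabs (1 : C R) = 1. Proof. by rewrite /cabs normr1. Qed.
Lemma cabsV z : cabs z^-1 = (cabs z)^-1.
Proof.
have [->|z0] := eqVneq z 0; first by rewrite invr0 cabs0 invr0.
apply: (mulIf (_ : cabs z != 0)); first by rewrite cabs_eq0.
by rewrite -cabsM mulVf// cabs1 mulVf// cabs_eq0.
Qed.
Lemma cabsf z w : cabs (z / w) = cabs z / cabs w. Proof. by rewrite cabsM cabsV. Qed.
Lemma cabsX z n : cabs (z ^+ n) = cabs z ^+ n.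
Proof. by elim: n => [|n IH]; rewrite ?expr0 ?cabs1// !exprS cabsM IH. Qed.
Lemma cabsJ z : cabs (z^*) = cabs z.
Proof. by rewrite /cabs norm_conjC. Qed.
Lemma cabs_sqr z : cabs z ^+ 2 = complex.Re z ^+ 2 + complex.Im z ^+ 2.
Proof.
rewrite /cabs [`|z|]normc_def /= sqr_sqrtr//.
by rewrite addr_ge0// sqr_ge0.
Qed.
Lemma cabs_real (x : R) : cabs (rc x) = `|x|.
Proof. by rewrite /cabs [`|_|]normc_def /= expr0n addr0 sqrtr_sqr. Qed.
Lemma cabs_Re z : `|complex.Re z| <= cabs z.
Proof. by rewrite -[leLHS]sqrtr_sqr /cabs [`|z|]normc_def /= ler_wsqrtr// lerDl sqr_ge0. Qed.
Lemma cabs_Im z : `|complex.Im z| <= cabs z.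
Proof. by rewrite -[leLHS]sqrtr_sqr /cabs [`|z|]normc_def /= ler_wsqrtr// lerDr sqr_ge0. Qed.
Lemma cabs_le z : cabs z <= `|complex.Re z| + `|complex.Im z|.
Proof.
rewrite -(@ler_pXn2r _ 2)// ?nnegrE ?addr_ge0 ?cabs_ge0// cabs_sqr sqrrD.
by rewrite !real_normK ?num_real// -addrA lerD2l lerDr mulrn_wge0// mulr_ge0.
Qed.
Lemma cReM z w : complex.Re (z * w) = complex.Re z * complex.Re w - complex.Im z * complex.Im w.
Proof. by case: z; case: w. Qed.
Lemma cImM z w : complex.Im (z * w) = complex.Re z * complex.Im w + complex.Im z * complex.Re w.
Proof. by case: z => a b; case: w => c d /=. Qed.
Lemma cReD z w : complex.Re (z + w) = complex.Re z + complex.Re w.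
Proof. by case: z; case: w. Qed.
Lemma cImD z w : complex.Im (z + w) = complex.Im z + complex.Im w.
Proof. by case: z; case: w. Qed.
Lemma cReN z : complex.Re (- z) = - complex.Re z. Proof. by case: z. Qed.
Lemma cImN z : complex.Im (- z) = - complex.Im z. Proof. by case: z. Qed.
Lemma cReJ z : complex.Re (z^*) = complex.Re z. Proof. by case: z. Qed.
Lemma cImJ z : complex.Im (z^*) = - complex.Im z. Proof. by case: z. Qed.

Lemma rcD (x y : R) : rc (x + y) = rc x + rc y. Proof. exact: rmorphD. Qed.
Lemma rcN (x : R) : rc (- x) = - rc x. Proof. exact: rmorphN. Qed.
Lemma rcM (x y : R) : rc (x * y) = rc x * rc y. Proof. exact: rmorphM. Qed.
Lemma rcX (x : R) n : rc (x ^+ n) = rc x ^+ n. Proof. exact: rmorphXn. Qed.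
Lemma rcV (x : R) : rc x^-1 = (rc x)^-1. Proof. exact: fmorphV. Qed.
Lemma rc1 : rc (1 : R) = 1. Proof. by []. Qed.
Lemma rc_eq0 (x : R) : (rc x == 0) = (x == 0). Proof. exact: fmorph_eq0. Qed.
Lemma rc_inj : injective (@rc R). Proof. by move=> x y []. Qed.
Lemma rcJ (x : R) : (rc x)^* = rc x. Proof. exact: conjc_real. Qed.

Lemma mulJ_sqr z : z * z^* = rc (cabs z ^+ 2).
Proof. by rewrite -normCK cabsE rcX. Qed.

(** Reduces bounds on a modulus to bounds on a real part. *)
Lemma rotate_abs z : exists2 k : C R, cabs k = 1 & k * z = rc (cabs z).
Proof.
have [->|z0] := eqVneq z 0; first by exists 1; rewrite ?cabs1// cabs0 mulr0.
exists (z^* / rc (cabs z)).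
  by rewrite cabsf cabsJ cabs_real ger0_norm ?cabs_ge0// divff// cabs_eq0.
rewrite mulrAC (mulrC _ z) mulJ_sqr rcX expr2 mulfK//.
by rewrite rc_eq0 cabs_eq0.
Qed.

End cabs.

Section first_order.
Context {K : numFieldType} {V W : normedModType K}.

Lemma diff_near (f : V -> W) z : differentiable f z -> forall e : K, 0 < e ->
  \forall y \near z, `|f y - f z - 'd f z (y - z)| <= e * `|y - z|.
Proof.
move=> df e e0; have := diff_locallyxC df => _.
have /diff_locallyP[_ /eqaddoP h] := df.
have := h _ e0; rewrite near_simpl => /= {}h.
have : \forall y \near z, `|(f \o shift z - (cst (f z) + 'd f z)) (y - z)| <= e * `|y - z|.
  by move: h; rewrite (near_shift z) /= => h; near=> y; have := near h y => /(_ ltac:(by [])); rewrite /= sub0r.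
apply: filterS => y /=; rewrite fctE /= subrK !fctE opprD addrA.
by rewrite /GRing.add /=.
Unshelve. all: by end_near. Qed.

End first_order.

(** * Circle means and the maximum principle *)

Section eps_delta.
Context {R : realType}.

Lemma continuous_nrmP {V W : normedModType (C R)} (f : V -> W) z :
  {for z, continuous f} <-> forall e : R, 0 < e -> exists2 d : R, 0 < d &
    forall y, nrm (y - z) < d -> nrm (f y - f z) < e.
Proof.
split=> [cf e e0|h A /nbhs_nrmP[e e0 eA]].
  have : nbhs (f z) [set w | nrm (w - f z) < e] by apply/nbhs_nrmP; exists e.
  by move/cf => /nbhs_nrmP[d d0 hd]; exists d.
by have [d d0 hd] := h _ e0; apply/nbhs_nrmP; exists d => // y /hd; exact: eA.
Qed.

Lemma diff_nrm {V W : normedModType (C R)} (f : V -> W) z : differentiable f z ->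
  forall e : R, 0 < e -> exists2 d : R, 0 < d &
    forall y, nrm (y - z) < d -> nrm (f y - f z - 'd f z (y - z)) <= e * nrm (y - z).
Proof.
move=> df e e0; have e0' : 0 < (e%:C)%C :> C R by rewrite ltcR.
have /nbhs_nrmP[d d0 hd] := diff_near df e0'.
exists d => // y /hd.
have -> : `|f y - f z - 'd f z (y - z)| = ((nrm (f y - f z - 'd f z (y - z)))%:C)%C := nrmE _.
have -> : `|y - z| = ((nrm (y - z))%:C)%C := nrmE _.
by rewrite -rmorphM lecR.
Qed.

Definition cderiv (f : C R -> C R) (z l : C R) := forall e : R, 0 < e -> exists2 d : R, 0 < d &
  forall y, cabs (y - z) < d -> cabs (f y - f z - l * (y - z)) <= e * cabs (y - z).

Lemma diff_scalar {W : normedModType (C R)} (f : C R -> W) z h : differentiable f z ->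
  'd f z h = h *: 'd f z 1.
Proof. by move=> df; rewrite -[in LHS](mulr1 h) -[h * 1]/(h *: (1 : C R)) linearZ. Qed.

Lemma diff_cderiv f z : differentiable f z -> cderiv f z ('d f z 1).
Proof.
move=> df e e0; have [d d0 hd] := diff_nrm df e0; exists d => // y /hd.
by rewrite (diff_scalar (y - z) df) (_ : (y - z) *: _ = 'd f z 1 * (y - z))//; exact: mulrC.
Qed.

(** Also gives uniqueness of [l], which is how differentials are computed below: two [cderiv] facts
    on one function identify the two values. *)
Lemma cderiv_diff f z l : cderiv f z l -> differentiable f z /\ 'd f z 1 = l.
Proof.
move=> h.
have cv : (fun k : C R => k^-1 *: ((f \o shift z) (k *: (1 : C R)) - f z)) @ 0^' --> l.
  apply/cvgrPdist_le => e e0.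
  have eE : e = ((complex.Re e)%:C)%C.
    by case: e e0 => a b; rewrite ltcE /= => /andP[/eqP->].
  have e1 : 0 < complex.Re e by move: e0; rewrite ltcE => /andP[].
  have [d d0 hd] := h _ e1.
  have nz : nbhs (0 : C R) [set k | k != 0 -> `|l - k^-1 *: ((f \o shift z) (k *: (1 : C R)) - f z)| <= e].
    apply/nbhs_nrmP; exists d => // k; rewrite subr0 => kd /= k0.
    have := hd (k + z); rewrite addrK => /(_ kd) {}hd.
    rewrite eE [`|_|]cabsE lecR.
    have -> : l - k^-1 *: (f (k *: 1 + z) - f z) = - (k^-1 * (f (k + z) - f z - l * k)).
      by rewrite [k *: 1]mulr1 /GRing.scale /=; field.
    by rewrite cabsN cabsM cabsV ler_pdivrMl ?cabs_gt0// [leRHS]mulrC.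
  exact: nz.
have dv : derivable f z 1 by apply/cvg_ex; exists l.
have df : differentiable f z by apply/derivable1_diffP.
by split=> //; rewrite -deriveE//; exact: cvg_lim cv.
Qed.

Lemma is_cderiv_diff f z : differentiable f z <-> exists l, cderiv f z l.
Proof.
by split=> [/diff_cderiv h|[l /cderiv_diff[]//]]; exists ('d f z 1).
Qed.

Lemma real_first_order (f : R -> R) (x l : R) : is_derive x 1 f l ->
  forall e : R, 0 < e -> exists2 d : R, 0 < d & forall y, `|y - x| < d ->
    `|f y - f x - l * (y - x)| <= e * `|y - x|.
Proof.
move=> [dv dl] e e0; have df : differentiable f x by apply/derivable1_diffP.
have /nbhs_ballP[d /= d0 hd] := diff_near df e0; exists d => // y yd.
have := hd y; rewrite /ball /= distrC => /(_ yd).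
have -> : 'd f x (y - x) = (y - x) *: 'd f x 1.
  by rewrite -[in LHS](mulr1 (y - x)) -[(y - x) * 1]/((y - x) *: (1 : R)) linearZ.
by rewrite -deriveE// dl (_ : (y - x) *: l = l * (y - x))//; exact: mulrC.
Qed.

End eps_delta.

Section polar.
Context {R : realType}.

(** The exponential of [s + i t]. It unrolls a punctured disc into a half-plane, circles becoming
    vertical segments, which suits Goursat on rectangles. *)
Definition cexp (s t : R) : C R := (expR s * cos t +i* (expR s * sin t))%C.

Lemma cexpD s t a b : cexp (s + a) (t + b) = cexp s t * cexp a b.
Proof. by apply/eqP; rewrite eq_complex /= expRD cosD sinD; apply/andP; split; apply/eqP; ring. Qed.

Lemma cabs_cexp s t : cabs (cexp s t) = expR s.
Proof.
apply/eqP; rewrite -(@eqrXn2 _ 2)// ?cabs_ge0 ?expR_ge0// cabs_sqr /= !exprMn -mulrDr.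
by rewrite cos2Dsin2 mulr1.
Qed.

Lemma cexp_periodic s : cexp s (0 : R) = cexp s (2 * pi).
Proof. by rewrite /cexp mulr_natl cos2pi sin2pi cos0 sin0. Qed.

Lemma cexp_first_order0 (e : R) : 0 < e -> exists2 d : R, 0 < d & forall a b,
  `|a| < d -> `|b| < d -> cabs (cexp a b - 1 - (a +i* b)%C) <= e * (`|a| + `|b|).
Proof.
move=> e0; pose e1 := Num.min (e / 5) 1.
have e10 : 0 < e1 by rewrite lt_min ltr01 andbT divr_gt0.
have [d1 d10 h1] := real_first_order (is_derive_expR 0) e10.
have [d2 d20 h2] := real_first_order (is_derive_cos 0) e10.
have [d3 d30 h3] := real_first_order (is_derive_sin 0) e10.
exists (Num.min (e1 / 2) (Num.min d1 (Num.min d2 d3))).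
  by rewrite !lt_min d10 d20 d30 !andbT divr_gt0.
move=> a b; rewrite !lt_min => /and4P[ae a1 a2 a3] /and4P[be b1 b2 b3].
have {}h1 := h1 a; have {}h2 := h2 b; have {}h3 := h3 b.
rewrite !subr0 in h1 h2 h3; have {}h1 := h1 a1; have {}h2 := h2 b2; have {}h3 := h3 b3.
rewrite expR0 mul1r in h1; rewrite cos0 sin0 oppr0 mul0r subr0 in h2.
rewrite sin0 cos0 mul1r subr0 in h3.
apply: le_trans (cabs_le _) _ => /=.
rewrite oppr0 addr0.
have e1e : 5 * e1 <= e by have : e1 <= e / 5 by [rewrite ge_min lexx]; lra.
have e11 : e1 <= 1 by rewrite ge_min lexx orbT.
set E := expR a in h1 *.
have E1 : `|E - 1| <= e1.
  have -> : E - 1 = (E - 1 - a) + a by ring.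
  apply: le_trans (ler_normD _ _) _; have := normr_ge0 a; nra.
have E2 : `|E| <= 2.
  have -> : E = (E - 1) + 1 by ring.
  by apply: le_trans (ler_normD _ _) _; rewrite normr1; lra.
have -> : E * cos b - 1 - a = E * (cos b - 1) + (E - 1 - a) by ring.
have -> : E * sin b - b = E * (sin b - b) + (E - 1) * b by ring.
have k1 : `|E * (cos b - 1) + (E - 1 - a)| <= 2 * (e1 * `|b|) + e1 * `|a|.
  by apply: le_trans (ler_normD _ _) _; rewrite normrM lerD// ler_pM.
have k2 : `|E * (sin b - b) + (E - 1) * b| <= 2 * (e1 * `|b|) + e1 * `|b|.
  by apply: le_trans (ler_normD _ _) _; rewrite !normrM lerD// ler_pM.
apply: le_trans (lerD k1 k2) _; have := normr_ge0 a; have := normr_ge0 b; nra.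
Qed.

Lemma cexp_first_order s t (e : R) : 0 < e -> exists2 d : R, 0 < d & forall s' t',
  `|s' - s| < d -> `|t' - t| < d ->
  cabs (cexp s' t' - cexp s t - cexp s t * ((s' - s) +i* (t' - t))%C) <= e * (`|s' - s| + `|t' - t|).
Proof.
move=> e0; have [|d d0 hd] := @cexp_first_order0 (e / expR s).
  by rewrite divr_gt0// expR_gt0.
exists d => // s' t' sd td.
have -> : cexp s' t' = cexp s t * cexp (s' - s) (t' - t) by rewrite -cexpD !subrKC.
rewrite -[X in _ - X - _]mulr1 -!mulrBr cabsM cabs_cexp mulrC.
by rewrite -ler_pdivlMr ?expR_gt0// mulrAC; exact: hd.
Qed.

Lemma polar_first_order (f : C R -> C R) (z0 l : C R) s t : cderiv f (z0 + cexp s t) l ->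
  forall e : R, 0 < e -> exists2 d : R, 0 < d & forall s' t',
  `|s' - s| < d -> `|t' - t| < d ->
  cabs (f (z0 + cexp s' t') - f (z0 + cexp s t) - l * cexp s t * ((s' - s) +i* (t' - t))%C)
    <= e * (`|s' - s| + `|t' - t|).
Proof.
move=> hf e e0; set m := cexp s t.
have m0 : 0 <= cabs m := cabs_ge0 _. have l0 : 0 <= cabs l := cabs_ge0 _.
pose e1 := e / 2 / (cabs m + 1).
have e10 : 0 < e1 by rewrite !divr_gt0// ltr_wpDl.
pose e2 := Num.min 1 (e / 2 / (cabs l + 1)).
have e20 : 0 < e2 by rewrite lt_min ltr01 !divr_gt0// ltr_wpDl.
have [d1 d10 h1] := hf _ e10.
have [d2 d20 h2] := cexp_first_order s t e20.
exists (Num.min d2 (d1 / (2 * (cabs m + 1)))).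
  by rewrite lt_min d20 divr_gt0// mulr_gt0// ltr_wpDl.
move=> s' t'; rewrite !lt_min => /andP[s2 s1] /andP[t2 t1].
have {}h2 := h2 _ _ s2 t2; rewrite -/m in h2.
set D := `|s' - s| + `|t' - t| in h2 *; set w := (_ +i* _)%C in h2 *.
have D0 : 0 <= D by rewrite addr_ge0.
have wD : cabs w <= D by exact: cabs_le.
have DD : (cabs m + 1) * D < d1.
  by rewrite ltr_pdivlMr ?mulr_gt0 ?ltr_wpDl// in s1; rewrite ltr_pdivlMr ?mulr_gt0 ?ltr_wpDl// in t1; rewrite /D; nra.
have e21 : e2 <= 1 by rewrite ge_min lexx.
have e22 : e2 * (cabs l + 1) <= e / 2 by rewrite -ler_pdivlMr ?ltr_wpDl// ge_min lexx orbT.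
have md : cabs (cexp s' t' - m) <= (cabs m + 1) * D.
  have -> : cexp s' t' - m = (cexp s' t' - m - m * w) + m * w by ring.
  apply: le_trans (cabsD _ _) _; rewrite cabsM mulrDl mul1r addrC lerD//.
    by rewrite ler_wpM2l.
  by apply: le_trans h2 _; nra.
have := h1 (z0 + cexp s' t'); rewrite (_ : z0 + cexp s' t' - (z0 + m) = cexp s' t' - m); last by ring.
move=> /(_ (le_lt_trans md DD)) {}h1.
have -> : f (z0 + cexp s' t') - f (z0 + m) - l * m * w =
  (f (z0 + cexp s' t') - f (z0 + m) - l * (cexp s' t' - m)) + l * (cexp s' t' - m - m * w) by ring.
apply: le_trans (cabsD _ _) _; rewrite cabsM.
have k1 : e1 * cabs (cexp s' t' - m) <= e / 2 * D.
  apply: le_trans (ler_wpM2l (ltW e10) md) _; rewrite /e1 mulrA divfK//.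
  by rewrite gt_eqF// ltr_wpDl.
have k2 : cabs l * cabs (cexp s' t' - m - m * w) <= e / 2 * D.
  apply: le_trans (ler_wpM2l l0 h2) _; nra.
apply: le_trans (lerD (le_trans h1 k1) k2) _; lra.
Qed.

(** The pair is [i f]: in its boundary integral the vertical sides carry the integrals of [Re f]
    over two circles. *)
Lemma polar_crdiff (f : C R -> C R) (z0 : C R) s t : differentiable f (z0 + cexp s t) ->
  crdiff (fun s t => - complex.Im (f (z0 + cexp s t))) (fun s t => complex.Re (f (z0 + cexp s t))) s t.
Proof.
move=> /diff_cderiv; move: ('d f _ _ : C R) => l /polar_first_order hf.
exists (- complex.Im (l * cexp s t)), (complex.Re (l * cexp s t)) => e /hf[d d0 hd].
exists d => // s' t' sd td; have {hd} := hd _ _ sd td.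
set L := l * _; set X := f _; set Y := f _ => h; split.
  apply: le_trans h; apply: le_trans (cabs_Im _); rewrite -normrN le_eqVlt; apply/orP; left.
  apply/eqP; congr (`|_|); rewrite !(cImD, cImN) cImM /=; ring.
apply: le_trans h; apply: le_trans (cabs_Re _); rewrite le_eqVlt; apply/orP; left.
apply/eqP; congr (`|_|); rewrite !(cReD, cReN) cReM /=; ring.
Qed.

(** By Goursat the mean of [Re f] over a circle does not depend on the radius, and by continuity it
    tends to [Re (f z0)] as the radius shrinks; it cannot then be smaller on the whole circle of
    radius [r]. Leaving the centre out of the differentiability hypothesis is what allows isolated
    singularities later. *)
Lemma circle_mean_le (f : C R -> C R) (z0 : C R) (r0 r : R) :
  {for z0, continuous f} -> (forall z, 0 < cabs (z - z0) < r0 -> differentiable f z) ->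
  0 < r < r0 -> exists2 z, cabs (z - z0) = r & complex.Re (f z0) <= complex.Re (f z).
Proof.
move=> cf df /andP[r_gt0 rr0]; apply: contrapT => no.
have r00 : 0 < r0 := lt_trans r_gt0 rr0.
have expln (x : R) : 0 < x -> expR (ln x) = x by move=> x0; apply/lnK; rewrite posrE.
pose sg := ln r; pose s0 := ln r0.
have sgs : sg < s0 by rewrite ltr_ln ?posrE.
have lt y : complex.Re (f (z0 + cexp sg y)) < complex.Re (f z0).
  rewrite ltNge; apply/negP => h; apply: no; exists (z0 + cexp sg y) => //.
  by rewrite addrC addKr cabs_cexp expln.
have CR x y : x < s0 -> crdiff (fun s t => - complex.Im (f (z0 + cexp s t)))
    (fun s t => complex.Re (f (z0 + cexp s t))) x y.
  move=> xs; apply/polar_crdiff/df; rewrite addrC addKr cabs_cexp expR_gt0 /=.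
  by rewrite -(expln r0 r00) ltr_expR.
have pi2 : 0 < 2 * pi :> R by rewrite mulr_gt0 ?pi_gt0.
have ctsv x : x < s0 -> ctson (fun t => complex.Re (f (z0 + cexp x t))) 0 (2 * pi).
  by move=> xs t _; exact: (crdiff_ctsy (CR _ t xs)).2.
have [t0 t0P maxt] := @EVT_max R (fun t => complex.Re (f (z0 + cexp sg t))) 0 (2 * pi) (ltW pi2) (ctson_within (ctsv _ sgs)).
set M := complex.Re (f (z0 + cexp sg t0)) in maxt.
pose eta := (complex.Re (f z0) - M) / 2.
have eta0 : 0 < eta by rewrite divr_gt0// subr_gt0; exact: lt.
have /continuous_nrmP/(_ _ eta0)[d d0 hd] := cf.
(* An inner circle of radius [expR a < d], on which [Re f] stays above
   [Re (f z0) - eta = M + eta]. *)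
pose a := Num.min (ln (d / 2)) (sg - 1).
have asg : a < sg by rewrite gt_min ltrBlDr ltrDl ltr01 orbT.
have ad : expR a < d.
  apply: (@le_lt_trans _ _ (d / 2)); last by lra.
  by rewrite -[leRHS]expln ?divr_gt0// ler_expR ge_min lexx.
have as0 := lt_trans asg sgs.
have := goursat CR asg sgs pi2; rewrite /boundary_integral.
(* The two horizontal sides, at [t = 0] and [t = 2 pi], lie on the same radius and cancel. *)
rewrite (_ : (fun x => _ - _) = (fun=> 0)); last first.
  by apply/funext => x; rewrite cexp_periodic subrr.
rewrite segint_cst ?mul0r ?add0r; last exact: ltW.
move=> W0; have : segint (fun=> eta) 0 (2 * pi) <=
    segint (fun y => complex.Re (f (z0 + cexp a y)) - complex.Re (f (z0 + cexp sg y))) 0 (2 * pi).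
  apply: segint_le; first exact: ctson_cst.
    by apply: ctsonB; exact: ctsv.
  move=> y y2; have : complex.Re (f (z0 + cexp sg y)) <= M by apply: maxt; rewrite in_itv.
  have := hd (z0 + cexp a y); rewrite addrC addKr -cabs_nrm cabs_cexp => /(_ ad) h.
  have := le_lt_trans (cabs_Re _) h; rewrite cReD cReN ltr_norml => /andP[+ _].
  rewrite /eta; lra.
rewrite W0 segint_cst ?(ltW pi2)// subr0; apply/negP; rewrite -ltNge mulr_gt0//.
Qed.

End polar.

Section maximum_principle.
Context {R : realType}.
Implicit Types (f g q : C R -> C R) (z w : C R).

Lemma real_continuousP {V : normedModType (C R)} (f : V -> R) (z : V) :
  {for z, continuous f} <-> forall e : R, 0 < e -> exists2 d : R, 0 < d &
    forall y, nrm (y - z) < d -> `|f y - f z| < e.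
Proof.
split=> [cf e e0|h A /nbhs_ballP[e /= e0 eA]].
  have : nbhs (f z) (ball (f z) e) by apply: nbhsx_ballx.
  by move/cf/nbhs_nrmP => [d d0 hd]; exists d => // y /hd; rewrite /= /ball /= distrC.
have [d d0 hd] := h _ e0; apply/nbhs_nrmP; exists d => // y /hd yd.
by apply: eA; rewrite /ball /= distrC.
Qed.

Lemma continuous_cabs : continuous (@cabs R).
Proof.
move=> z; apply/real_continuousP => e e0; exists e => // y yz.
exact: le_lt_trans (ler_dist_cabs _ _) yz.
Qed.

Lemma compact_cdisc (r : R) : compact [set z : C R | cabs z <= r].
Proof.
have cc : continuous (fun p : R * R => (p.1 +i* p.2)%C : C R).
  move=> [a b] A /nbhs_nrmP[e e0 eA]; apply/nbhs_ballP; exists (e / 2) => /=.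
    by rewrite divr_gt0.
  move=> [c d] [/= h1 h2]; apply: eA; rewrite -[nrm _]/(cabs _); apply: le_lt_trans (cabs_le _) _ => /=.
  by move: h1 h2; rewrite /ball /= => h1 h2; rewrite distrC (distrC d); lra.
apply: (@subclosed_compact _ _ ((fun p : R * R => (p.1 +i* p.2)%C : C R) @` (`[-r, r] `*` `[-r, r]))).
- have -> : [set z : C R | cabs z <= r] = @cabs R @^-1` [set x | x <= r] by [].
  by apply: closed_comp => [z _|]; [exact: continuous_cabs|exact: closed_le].
- apply: continuous_compact; first exact: continuous_subspaceT.
  by apply: compact_setX; exact: segment_compact.
- move=> z /= zr; exists (complex.Re z, complex.Im z); last by case: z {zr}.
  have h1 := le_trans (cabs_Re z) zr; have h2 := le_trans (cabs_Im z) zr.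
  by rewrite /= !in_itv /= -!ler_norml.
Qed.

Lemma continuous_Re {V : normedModType (C R)} (f : V -> C R) (z : V) :
  {for z, continuous f} -> {for z, continuous (fun x => complex.Re (f x))}.
Proof.
move=> /continuous_nrmP cf; apply/real_continuousP => e /cf[d d0 hd]; exists d => // y /hd.
by apply: le_lt_trans; rewrite -cReN -cReD; exact: cabs_Re.
Qed.

(* holomorphic near z, except possibly at z itself *)
Definition punct_holo f z := exists2 r : R, 0 < r &
  forall w, 0 < cabs (w - z) < r -> differentiable f w.

(** Adding [e |z|^2] makes the inequality strict: at an interior maximum [z2] the perturbed function
    agrees, up to the real part of a linear term, with one obeying [circle_mean_le], yet exceeds its
    value at [z2] by [e rho^2] somewhere on a small circle. *)
Lemma maxmod_Re f (r M : R) : 0 < r ->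
  (forall z, cabs z <= r -> {for z, continuous f}) ->
  (forall z, cabs z < r -> punct_holo f z) ->
  (forall z, cabs z = r -> complex.Re (f z) <= M) ->
  forall z, cabs z <= r -> complex.Re (f z) <= M.
Proof.
move=> r0 cf pf fM z1 z1r; rewrite leNgt; apply/negP => Mz1.
(* On the boundary the perturbation [e r^2] is half the assumed excess, so the maximum of [k] is not
   attained there. *)
pose e := (complex.Re (f z1) - M) / 2 / r ^+ 2.
have e0 : 0 < e by rewrite !divr_gt0 ?subr_gt0 ?exprn_gt0.
pose k z := complex.Re (f z) + e * cabs z ^+ 2.
have ck : {within [set z : C R | cabs z <= r], continuous k}.
  apply: continuous_in_subspaceT => z; rewrite inE /= => zr.
  have c1 : {for z, continuous (fun x : C R => complex.Re (f x))} by apply: continuous_Re; exact: cf.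
  have c2 : {for z, continuous (fun x : C R => cabs x ^+ 2)}.
    apply: (@continuous_comp _ _ _ (@cabs R) (fun x => x ^+ 2)); first exact: continuous_cabs.
    exact: exprn_continuous.
  have c3 : {for z, continuous (fun x : C R => e * cabs x ^+ 2)}.
    by apply: continuousM => //; exact: cst_continuous.
  exact: continuousD c1 c3.
have [z2 z2r maxk] : exists2 c, c \in [set z : C R | cabs z <= r] &
    forall t, t \in [set z : C R | cabs z <= r] -> k t <= k c.
  apply: compact_EVT_max => //; last exact: compact_cdisc.
  by exists z1.
rewrite inE /= in z2r.
have kz : k z1 <= k z2 by apply: maxk; rewrite inE.
have {z2r} z2r : cabs z2 < r.
  rewrite lt_neqAle z2r andbT; apply/eqP => z2e; move: kz; rewrite /k; apply/negP.
  rewrite -ltNge; have := fM _ z2e; rewrite z2e.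
  have -> : e * r ^+ 2 = (complex.Re (f z1) - M) / 2 by rewrite /e divfK// gt_eqF// exprn_gt0.
  have : 0 <= e * cabs z1 ^+ 2 by rewrite mulr_ge0 ?(ltW e0) ?exprn_ge0 ?cabs_ge0.
  lra.
have [r1 r10 df] := pf _ z2r.
(* [Re (a (z - z2))] is the linear part of [e |z|^2] at [z2]; the remainder is exactly
   [e |z - z2|^2]. *)
pose a : C R := rc (2 * e) * z2^*.
pose F z := f z + a * z.
have da z : differentiable (fun z : C R => a * z) z.
  by apply: differentiableM => //; exact: differentiable_cst.
pose rho := Num.min (r1 / 2) ((r - cabs z2) / 2).
have rho0 : 0 < rho by rewrite lt_min !divr_gt0 ?subr_gt0.
have rho1 : rho < r1.
  by have : rho <= r1 / 2 by [rewrite ge_min lexx]; lra.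
have rho2 : rho < r - cabs z2.
  by have : rho <= (r - cabs z2) / 2 by [rewrite ge_min lexx orbT]; lra.
have [] := @circle_mean_le _ F z2 r1 rho.
- have c1 : {for z2, continuous f} by apply: cf; exact: ltW.
  have c2 : {for z2, continuous (fun z : C R => a * z)} by apply: differentiable_continuous; exact: da.
  exact: continuousD c1 c2.
- by move=> w /df dfw; apply: differentiableD => //; exact: da.
- by rewrite rho0.
move=> z zrho; have zr : cabs z <= r.
  by have := cabsD (z - z2) z2; rewrite subrK zrho; lra.
have := maxk z; rewrite inE /= => /(_ zr); rewrite /k /F !cReD /a !cReM /=.
have : cabs (z - z2) ^+ 2 = rho ^+ 2 by rewrite zrho.
have := exprn_gt0 2 rho0; rewrite !cabs_sqr cReD cReN cImD cImN !cImM !cReJ !cImJ /=.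
move: (complex.Re (f z)) (complex.Re (f z2)) (complex.Re z) (complex.Im z)
  (complex.Re z2) (complex.Im z2) (rho ^+ 2) => A B x y x2 y2 rr rr0 E H1 H2.
have := mulr_gt0 e0 rr0; rewrite -E !expr2 in H1 *; lra.
Qed.

Lemma maxmod f (r M : R) : 0 < r ->
  (forall z, cabs z <= r -> {for z, continuous f}) ->
  (forall z, cabs z < r -> punct_holo f z) ->
  (forall z, cabs z = r -> cabs (f z) <= M) ->
  forall z, cabs z <= r -> cabs (f z) <= M.
Proof.
move=> r0 cf pf fM z zr; have [k k1 kz] := rotate_abs (f z).
have -> : cabs (f z) = complex.Re (k * f z) by rewrite kz.
refine (@maxmod_Re (fun z => k * f z) r M r0 _ _ _ z zr).
- move=> w /cf cw.
  have ck : {for w, continuous (fun _ : C R => k)} by exact: cst_continuous.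
  exact: continuousM ck cw.
- move=> w /pf[d d0 hd]; exists d => // v /hd dv.
  have dk : differentiable (fun _ : C R => k) v by exact: differentiable_cst.
  exact: differentiableM dk dv.
- move=> w /fM fw; apply: le_trans (ler_norm _) _; apply: le_trans (cabs_Re _) _.
  by rewrite cabsM k1 mul1r.
Qed.

Lemma holo_punct f z (r : R) : cabs z < r -> (forall w, cabs w < r -> differentiable f w) ->
  punct_holo f z.
Proof.
move=> zr df; exists (r - cabs z); first by rewrite subr_gt0.
move=> w /andP[_ wz]; apply: df; have := cabsD (w - z) z; rewrite subrK; lra.
Qed.

End maximum_principle.

(** * Removable singularities and the Schwarz lemma *)

Section calculus.
Context {R : realType} {V : normedModType (C R)}.
Implicit Types (f g : V -> C R) (x : V).

(* The library states these for sums and products in the ring of functions; unifying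
   [fun y => f y + g y] with [f + g] over [C R] is prohibitively slow. *)
Lemma cts_cst (c : C R) x : {for x, continuous (fun _ : V => c)}.
Proof. exact: cst_continuous. Qed.
Lemma ctsB f g x : {for x, continuous f} -> {for x, continuous g} ->
  {for x, continuous (fun y => f y - g y)}.
Proof. by move=> cf cg; exact: continuousB cf cg. Qed.
Lemma ctsM f g x : {for x, continuous f} -> {for x, continuous g} ->
  {for x, continuous (fun y => f y * g y)}.
Proof. by move=> cf cg; exact: continuousM cf cg. Qed.
Lemma ctsV f x : f x != 0 -> {for x, continuous f} -> {for x, continuous (fun y => (f y)^-1)}.
Proof. exact: continuousV. Qed.
Lemma diff_cst_ (c : C R) x : differentiable (fun _ : V => c) x.
Proof. exact: differentiable_cst. Qed.
Lemma diffD_ f g x : differentiable f x -> differentiable g x ->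
  differentiable (fun y => f y + g y) x.
Proof. by move=> cf cg; exact: differentiableD cf cg. Qed.
Lemma diffB_ f g x : differentiable f x -> differentiable g x ->
  differentiable (fun y => f y - g y) x.
Proof. by move=> cf cg; exact: differentiableB cf cg. Qed.
Lemma diffM_ f g x : differentiable f x -> differentiable g x ->
  differentiable (fun y => f y * g y) x.
Proof. by move=> cf cg; exact: differentiableM cf cg. Qed.
Lemma diffV_ f x : f x != 0 -> differentiable f x -> differentiable (fun y => (f y)^-1) x.
Proof. by move=> f0 df; exact: differentiableV df f0. Qed.

End calculus.

Lemma cts_id {R : realType} (z : C R) : {for z, continuous (fun w : C R => w)}.
Proof. exact: cvg_id. Qed.
Lemma diff_id_ {R : realType} {V : normedModType (C R)} (z : V) : differentiable (fun w : V => w) z.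
Proof. exact: ex_diff. Qed.

Section removable.
Context {R : realType}.
Implicit Types (f g q : C R -> C R) (z w h : C R).

Lemma differentiable_near_eq f g z (r : R) : 0 < r ->
  (forall w, cabs (w - z) < r -> f w = g w) -> differentiable f z -> differentiable g z.
Proof.
move=> r0 fg /is_cderiv_diff[l hl]; apply/is_cderiv_diff; exists l => e /hl[d d0 hd].
exists (Num.min d r); first by rewrite lt_min d0.
move=> y; rewrite lt_min => /andP[yd yr]; rewrite -fg// -fg ?subrr ?cabs0//; exact: hd.
Qed.

Lemma continuous_near_eq f g z (r : R) : 0 < r ->
  (forall w, cabs (w - z) < r -> f w = g w) -> {for z, continuous f} -> {for z, continuous g}.
Proof.
move=> r0 fg /continuous_nrmP hl; apply/continuous_nrmP => e /hl[d d0 hd].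
exists (Num.min d r); first by rewrite lt_min d0.
move=> y; rewrite lt_min => /andP[yd yr]; rewrite -fg// -fg ?subrr ?cabs0//; exact: hd.
Qed.

Definition dslope f h z : C R := if z == h then 'd f h 1 else (f z - f h) / (z - h).

Lemma dslopeE f h z : z != h -> dslope f h z = (f z - f h) / (z - h).
Proof. by rewrite /dslope => /negbTE ->. Qed.

Lemma dslope_near f h z : z != h -> forall w, cabs (w - z) < cabs (z - h) ->
  (f w - f h) / (w - h) = dslope f h w.
Proof.
move=> zh w wz; rewrite dslopeE//; apply: contraTneq wz => ->.
by rewrite -leNgt cabsB.
Qed.

Lemma differentiable_quot f h z : z != h -> differentiable f z ->
  differentiable (fun w => (f w - f h) / (w - h)) z.
Proof.
move=> zh df.
have zh0 : z - h != 0 by rewrite subr_eq0.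
have d1 := diffB_ df (diff_cst_ (f h) z).
have d2 := diffB_ (diff_id_ z) (diff_cst_ h z).
exact: diffM_ d1 (diffV_ (f := fun w => w - h) zh0 d2).
Qed.

Lemma dslope_diff f h z : z != h -> differentiable f z -> differentiable (dslope f h) z.
Proof.
move=> zh df; have zh0 : 0 < cabs (z - h) by rewrite cabs_gt0 subr_eq0.
exact: (differentiable_near_eq zh0 (dslope_near f zh) (differentiable_quot zh df)).
Qed.

Lemma continuous_quot f h z : z != h -> {for z, continuous f} ->
  {for z, continuous (fun w => (f w - f h) / (w - h))}.
Proof.
move=> zh cf.
have zh0 : z - h != 0 by rewrite subr_eq0.
have d1 := ctsB cf (@cts_cst R (C R) (f h) z).
have d2 := ctsB (@cts_id _ z) (@cts_cst R (C R) h z).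
exact: ctsM d1 (ctsV (f := fun w => w - h) zh0 d2).
Qed.

Lemma dslope_cts f h z : differentiable f h -> {for z, continuous f} -> {for z, continuous (dslope f h)}.
Proof.
move=> dh cf; have [->|zh] := eqVneq z h; last first.
  have zh0 : 0 < cabs (z - h) by rewrite cabs_gt0 subr_eq0.
  exact: (continuous_near_eq zh0 (dslope_near f zh) (continuous_quot zh cf)).
apply/continuous_nrmP => e e0; have e20 : 0 < e / 2 by rewrite divr_gt0.
have [d d0 hd] := diff_cderiv dh e20; exists d => // y yd; rewrite -cabs_nrm.
rewrite {2}/dslope eqxx; have [->|yh] := eqVneq y h.
  by rewrite /dslope eqxx subrr cabs0.
rewrite dslopeE//; have yh0 : y - h != 0 by rewrite subr_eq0.
apply: (@le_lt_trans _ _ (e / 2)); last by lra.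
have -> : (f y - f h) / (y - h) - 'd f h 1 = (f y - f h - 'd f h 1 * (y - h)) / (y - h) by field.
by rewrite cabsf ler_pdivrMr ?cabs_gt0//; exact: hd.
Qed.

Lemma avoid_seq (s : seq (C R)) z : exists2 d : R, 0 < d &
  forall w, 0 < cabs (w - z) < d -> w \notin s.
Proof.
elim: s => [|a s [d d0 hd]]; first by exists 1.
have [->|az] := eqVneq a z.
  exists d => // w /[dup] wz /hd; rewrite inE negb_or => ->; rewrite andbT.
  by case/andP: wz; rewrite cabs_gt0 subr_eq0.
exists (Num.min d (cabs (a - z))); first by rewrite lt_min d0 cabs_gt0 subr_eq0.
move=> w /andP[w0]; rewrite lt_min => /andP[wd wa]; rewrite inE negb_or hd ?w0// andbT.
by apply: contraTneq wa => ->; rewrite ltxx.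
Qed.

Variables (q : C R -> C R) (r : R).
Hypothesis r0 : 0 < r.
Hypothesis cq : forall z, cabs z < r -> {for z, continuous q}.
Hypothesis dq : forall z, 0 < cabs z < r -> differentiable q z.

Let rho := r / 2.
Let rho0 : 0 < rho. Proof. by rewrite divr_gt0. Qed.
Let rhor : rho < r. Proof. by have := r0; rewrite /rho; lra. Qed.

Let q_bounded : exists2 B : R, 0 <= B & forall z, cabs z <= rho -> cabs (q z) <= B.
Proof.
have [? ? ?] := And3 r0 rho0 rhor.
have [] := @compact_EVT_max (C R) R (fun z => cabs (q z)) [set z : C R | cabs z <= rho].
- by exists 0; rewrite /= cabs0 ltW.
- exact: compact_cdisc.
- apply: continuous_in_subspaceT => z; rewrite inE /= => zr.
  apply: (@continuous_comp _ _ _ q (@cabs R)); last exact: continuous_cabs.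
  by apply: cq; lra.
move=> c _ hc; exists (cabs (q c)); first exact: cabs_ge0.
by move=> z zr; apply: hc; rewrite inE.
Qed.

(** Tends to 0 with [h] and controls both terms of the numerator when two difference quotients of
    [q] are subtracted. *)
Let omega h : R := cabs h + cabs (q h - q 0).

(** The estimate is elementary on the circle [|z| = rho], where [z] keeps away from [h] and [h'].
    The maximum principle carries it inside, since differentiability can fail only at [0], [h] and
    [h'], where continuity remains. *)
Let dslope_close : exists2 K : R, 0 <= K & forall h h' z, 0 < cabs h < rho / 2 -> 0 < cabs h' < rho / 2 ->
  cabs z <= rho -> cabs (dslope q h z - dslope q h' z) <= K * (omega h + omega h').
Proof.
have [? ? ?] := And3 r0 rho0 rhor.
have [B B0 hB] := q_bounded.
exists ((2 * B + 2 * rho) / (rho / 2) ^+ 2).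
  by rewrite divr_ge0 ?sqr_ge0// addr_ge0// mulr_ge0// ltW.
move=> h h' z /andP[h0 h1] /andP[h'0 h'1] zr.
have hr : 0 < cabs h < r by rewrite h0; lra.
have h'r : 0 < cabs h' < r by rewrite h'0; lra.
apply: (@maxmod _ (fun z => dslope q h z - dslope q h' z) rho) zr => //.
- move=> w wr; have cw : {for w, continuous q} by apply: cq; lra.
  exact: ctsB (dslope_cts (dq hr) cw) (dslope_cts (dq h'r) cw).
- move=> w wr; have [d d0 hd] := avoid_seq [:: 0; h; h'] w.
  exists (Num.min d (r - cabs w)); first by rewrite lt_min d0 subr_gt0; lra.
  move=> v /andP[v0]; rewrite lt_min => /andP[vd vr].
  have := hd v; rewrite v0 vd => /(_ isT); rewrite !inE !negb_or => /and3P[vn0 vh vh'].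
  have vr' : 0 < cabs v < r.
    rewrite cabs_gt0 vn0 /=; have := cabsD (v - w) w; rewrite subrK; lra.
  exact: diffB_ (dslope_diff vh (dq vr')) (dslope_diff vh' (dq vr')).
move=> w wr.
have sep k : cabs k < rho / 2 -> rho / 2 <= cabs (w - k).
  move=> kr; have := cabsD (w - k) k; rewrite subrK wr; lra.
have s1 := sep _ h1; have s2 := sep _ h'1.
have r20 : 0 < rho / 2 by rewrite divr_gt0.
have w1 : w - h != 0 by rewrite -cabs_gt0; lra.
have w2 : w - h' != 0 by rewrite -cabs_gt0; lra.
have n1 : w != h by rewrite -subr_eq0.
have n2 : w != h' by rewrite -subr_eq0.
rewrite (dslopeE _ n1) (dslopeE _ n2).
have -> : (q w - q h) / (w - h) - (q w - q h') / (w - h') =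
   ((q w - q h) * (h - h') + (q h' - q h) * (w - h)) / ((w - h) * (w - h')).
  by field; rewrite w1 w2.
rewrite cabsf cabsM ler_pdivrMr; last by rewrite mulr_gt0 ?cabs_gt0.
have H1 : cabs (q w - q h) <= 2 * B.
  have := cabsD (q w) (- q h); rewrite cabsN.
  have := hB w; rewrite wr lexx => /(_ isT); have := hB h; have hh : cabs h <= rho by lra.
  move=> /(_ hh); lra.
have H2 : cabs (h - h') <= omega h + omega h'.
  have := cabsD h (- h'); rewrite cabsN /omega.
  have := cabs_ge0 (q h - q 0); have := cabs_ge0 (q h' - q 0); lra.
have H3 : cabs (q h' - q h) <= omega h + omega h'.
  have := cabs_tri (q 0) (q h') (q h); rewrite (cabsB (q 0)) /omega.
  have := cabs_ge0 h; have := cabs_ge0 h'; lra.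
have H4 : cabs (w - h) <= 2 * rho.
  have := cabsD w (- h); rewrite cabsN; lra.
have O0 : 0 <= omega h + omega h' by apply: le_trans H2; exact: cabs_ge0.
apply: le_trans (cabsD _ _) _; rewrite !cabsM.
have H5 : cabs (q w - q h) * cabs (h - h') + cabs (q h' - q h) * cabs (w - h) <=
   (2 * B + 2 * rho) * (omega h + omega h').
  rewrite mulrDl; apply: lerD; first by apply: ler_pM => //; exact: cabs_ge0.
  by rewrite [leRHS]mulrC; apply: ler_pM => //; exact: cabs_ge0.
apply: le_trans H5 _.
have -> : (2 * B + 2 * rho) / (rho / 2) ^+ 2 * (omega h + omega h') * (cabs (w - h) * cabs (w - h')) =
  (2 * B + 2 * rho) * (omega h + omega h') * (cabs (w - h) * cabs (w - h') / (rho / 2) ^+ 2) by ring.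
apply: ler_peMr; first by rewrite mulr_ge0// addr_ge0// mulr_ge0// ltW.
rewrite ler_pdivlMr ?exprn_gt0// mul1r expr2.
by apply: ler_pM => //; exact: ltW.
Qed.

Let slope z : C R := (q z - q 0) / z.

(** The limit [h' -> 0] in [dslope_close], at fixed [z != 0]. *)
Let slope_close : exists2 K : R, 0 <= K & forall h z, 0 < cabs h < rho / 2 -> 0 < cabs z <= rho ->
  cabs (dslope q h z - slope z) <= K * omega h.
Proof.
have [? ? ?] := And3 r0 rho0 rhor.
have [K K0 hK] := dslope_close; exists K => // h z hh /andP[z0 zr].
rewrite leNgt; apply/negP => lt.
pose eta := cabs (dslope q h z - slope z) - K * omega h.
have eta0 : 0 < eta by rewrite subr_gt0.
have zn0 : z != 0 by rewrite -cabs_gt0.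
have cs : {for (0 : C R), continuous (fun h' => (q z - q h') / (z - h'))}.
  have c0 : {for (0 : C R), continuous q} by apply: cq; rewrite cabs0.
  have z00 : z - 0 != 0 by rewrite subr0.
  have k1 := ctsB (@cts_cst R (C R) (q z) 0) c0.
  have k2 := ctsB (@cts_cst R (C R) z 0) (@cts_id _ 0).
  exact: ctsM k1 (ctsV (f := fun w => z - w) z00 k2).
have e20 : 0 < eta / 2 by rewrite divr_gt0.
have e30 : 0 < eta / 4 / (K + 1) by rewrite !divr_gt0// ltr_wpDl.
have /continuous_nrmP/(_ _ e20)[d d0 hd] := cs.
have /continuous_nrmP/(_ _ e30)[d' d'0 hd'] : {for (0 : C R), continuous q}.
  by apply: cq; rewrite cabs0.
(* The real point [rc m] serves as [h']: replacing its quotient by [slope z] costs less than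
   [eta / 2], and [K * omega] at most [3 / 8 * eta], together less than [eta]. *)
pose m := Num.min (Num.min (d / 2) (d' / 2)) (Num.min (Num.min (rho / 4) (cabs z / 2)) (eta / 8 / (K + 1))).
have m0 : 0 < m by rewrite !lt_min !divr_gt0// ltr_wpDl.
have [m1 m2 m3 m4 m5] : [/\ m <= d / 2, m <= d' / 2, m <= rho / 4, m <= cabs z / 2 & m <= eta / 8 / (K + 1)].
  by split; rewrite !ge_min lexx ?orbT.
have am : cabs (rc m) = m by rewrite cabs_real gtr0_norm.
have h'r : 0 < cabs (rc m) < rho / 2 by rewrite am m0; lra.
have H1 := hK h (rc m) z hh h'r zr.
have zm : z != rc m by apply: contraTneq m4 => ->; rewrite am -ltNge; lra.
have := hd (rc m); rewrite !subr0 -!cabs_nrm am (_ : m < d); last by lra.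
move=> /(_ isT); rewrite -dslopeE// => H2.
have := hd' (rc m); rewrite subr0 -!cabs_nrm am (_ : m < d'); last by lra.
move=> /(_ isT) => H3.
have := cabs_tri (dslope q (rc m) z) (dslope q h z) (slope z).
have K1 : 0 < K + 1 by rewrite ltr_wpDl.
have KO : K * omega (rc m) <= 3 / 8 * eta.
  rewrite /omega am; rewrite ltr_pdivlMr// in H3; rewrite ler_pdivlMr// in m5.
  have := cabs_ge0 (q (rc m) - q 0); nra.
move: H1 H2; rewrite mulrDr /slope /eta => H1 H2; rewrite /eta in KO; lra.
Qed.

(** The difference quotient at 0 is a uniform limit, as [h -> 0], of the functions [dslope q h],
    each continuous at 0. So it is Cauchy at 0 and the derivative exists. *)
Lemma removable_singularity : differentiable q 0.
Proof.
have [? ? ?] := And3 r0 rho0 rhor.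
have [K K0 hK] := slope_close.
have small e : 0 < e -> exists2 h : C R, 0 < cabs h < rho / 2 & K * omega h < e.
  move=> e0; have e1 : 0 < e / 2 / (K + 1) by rewrite !divr_gt0// ltr_wpDl.
  have /continuous_nrmP/(_ _ e1)[d d0 hd] : {for (0 : C R), continuous q}.
    by apply: cq; rewrite cabs0.
  pose m := Num.min (Num.min (d / 2) (rho / 4)) (e / 4 / (K + 1)).
  have m0 : 0 < m by rewrite !lt_min !divr_gt0// ltr_wpDl.
  have [m1 m2 m3] : [/\ m <= d / 2, m <= rho / 4 & m <= e / 4 / (K + 1)].
    by split; rewrite !ge_min lexx ?orbT.
  have am : cabs (rc m) = m by rewrite cabs_real gtr0_norm.
  exists (rc m); first by rewrite am m0; lra.
  have := hd (rc m); rewrite subr0 -!cabs_nrm am (_ : m < d); last by lra.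
  move=> /(_ isT) H3; have K1 : 0 < K + 1 by rewrite ltr_wpDl.
  rewrite ltr_pdivlMr// in H3; rewrite ler_pdivlMr// in m3.
  rewrite /omega am; have := cabs_ge0 (q (rc m) - q 0); nra.
have cauchy e : 0 < e -> exists2 d : R, 0 < d & forall z z', 0 < cabs z < d -> 0 < cabs z' < d ->
    cabs (slope z - slope z') < e.
  move=> e0; have e4 : 0 < e / 4 by rewrite divr_gt0.
  have [h hh hKe] := small _ e4.
  have : {for (0 : C R), continuous (dslope q h)}.
    apply: dslope_cts; last by apply: cq; rewrite cabs0.
    by apply: dq; case/andP: hh => -> /=; lra.
  move=> /continuous_nrmP/(_ _ e4)[d d0 hd]; exists (Num.min d rho); first by rewrite lt_min d0.
  move=> z z'; rewrite !lt_min => /and3P[z0 zd zr] /and3P[z'0 z'd z'r].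
  have := hd z; rewrite subr0 -!cabs_nrm => /(_ zd) H1.
  have := hd z'; rewrite subr0 -!cabs_nrm => /(_ z'd) H2.
  have := hK h z hh; rewrite z0 (ltW zr) => /(_ isT) H3.
  have := hK h z' hh; rewrite z'0 (ltW z'r) => /(_ isT) H4.
  have := cabs_tri (dslope q h z) (slope z) (slope z').
  have := cabs_tri (dslope q h 0) (dslope q h z) (slope z').
  have := cabs_tri (dslope q h z') (dslope q h 0) (slope z').
  rewrite (cabsB (slope z) (dslope q h z)) (cabsB (dslope q h 0) (dslope q h z')); lra.
have [d1 d10 hd1] := cauchy 1 ltr01.
pose z1 := rc (d1 / 2).
have z1d : 0 < cabs z1 < d1 by rewrite cabs_real gtr0_norm ?divr_gt0//=; lra.
pose B := cabs (slope z1) + 1.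
have nz (P : C R -> Prop) (d : R) : 0 < d -> (forall z, 0 < cabs z < d -> P z) -> (0 : C R)^' P.
  move=> d0 hP; have : nbhs (0 : C R) [set z | z != 0 -> P z]; last by exact.
  apply/nbhs_nrmP; exists d => // y; rewrite subr0 => yd /= y0; apply: hP.
  by rewrite cabs_gt0 y0.
(* Compactness supplies a cluster point of the slopes; the Cauchy property makes it their limit. *)
have := @compact_cdisc R B; move=> /(_ (slope @ (0 : C R)^') _) [].
  apply: (nz _ d1 d10) => z zd /=; have := hd1 z z1 zd z1d.
  by have := cabsD (slope z - slope z1) (slope z1); rewrite subrK /B; lra.
move=> l [_ cl]; apply/is_cderiv_diff; exists l => e e0.
have e2 : 0 < e / 2 by rewrite divr_gt0.
have [d d0 hd] := cauchy _ e2.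
exists d => // y; rewrite subr0 => yd.
have [->|y0] := eqVneq y 0; first by rewrite subrr mulr0 subrr cabs0 mulr0.
have y0' : 0 < cabs y by rewrite cabs_gt0.
have -> : q y - q 0 - l * y = (slope y - l) * y by rewrite /slope; field.
rewrite cabsM ler_pM2r//.
have [] := cl (slope @` [set z | 0 < cabs z < d]) [set w | cabs (w - l) < e / 2].
- by apply: (nz _ d d0) => z zd /=; exists z.
- by apply/nbhs_nrmP; exists (e / 2).
move=> _ [[z /= zd <-] zl]; have := hd y z; rewrite y0' yd => /(_ isT zd).
have := cabs_tri (slope z) (slope y) l; lra.
Qed.

End removable.

Section schwarz.
Context {R : realType}.
Implicit Types (f g q : C R -> C R) (z w : C R).

(** Away from 0 this is the quotient rule; at 0 the quotient is continuous and the singularity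
    removable. *)
Lemma dslope0_holo g (r : R) : 0 < r -> (forall z, cabs z < r -> differentiable g z) ->
  forall z, cabs z < r -> differentiable (dslope g 0) z.
Proof.
move=> r0 dg; have dg0 : differentiable g 0 by apply: dg; rewrite cabs0.
have dn w : 0 < cabs w < r -> differentiable (dslope g 0) w.
  by case/andP=> w0 wr; apply: dslope_diff; [rewrite -cabs_gt0|exact: dg].
move=> z zr; have [->|z0] := eqVneq z 0; last by apply: dn; rewrite cabs_gt0 z0.
apply: (@removable_singularity _ _ r r0) => // w wr.
by apply: dslope_cts => //; apply: differentiable_continuous; exact: dg.
Qed.

Lemma dslope0E g z : g 0 = 0 -> g z = z * dslope g 0 z.
Proof.
move=> g0; have [->|z0] := eqVneq z 0; first by rewrite mul0r.
by rewrite dslopeE// g0 !subr0 mulrC divfK.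
Qed.

Lemma schwarz g (r M : R) : 0 < r -> (forall z, cabs z < r -> differentiable g z) ->
  (forall z, cabs z < r -> cabs (g z) <= M) -> g 0 = 0 ->
  forall z, cabs z < r -> cabs (dslope g 0 z) <= M / r.
Proof.
move=> r0 dg gM g0 z zr; rewrite leNgt; apply/negP => lt.
set Q := cabs (dslope g 0 z) in lt.
have M0 : 0 <= M by have := gM 0; rewrite g0 cabs0 => /(_ r0).
have Q0 : 0 < Q by apply: le_lt_trans lt; rewrite divr_ge0// ltW.
have MQ : M / Q < r by rewrite ltr_pdivrMr// -ltr_pdivrMl// mulrC.
(* A circle around [z] inside the disc with [M / rho < Q], on which the bound on [g] contradicts the
   value [Q] at [z]. *)
pose rho := (Num.max (cabs z) (M / Q) + r) / 2.
have mr : Num.max (cabs z) (M / Q) < r by rewrite gt_max zr MQ.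
have zm : cabs z <= Num.max (cabs z) (M / Q) by rewrite le_max lexx.
have Mm : M / Q <= Num.max (cabs z) (M / Q) by rewrite le_max lexx orbT.
have [zrho rhor Mrho] : [/\ cabs z < rho, rho < r & M / Q < rho] by rewrite /rho; split; lra.
have rho0 : 0 < rho by apply: le_lt_trans zrho; exact: cabs_ge0.
have dq := dslope0_holo r0 dg.
have : Q <= M / rho.
  apply: (@maxmod _ (dslope g 0) rho (M / rho) rho0 _ _ _ z (ltW zrho)).
  - by move=> w wr; apply: differentiable_continuous; apply: dq; lra.
  - move=> w wr; apply: (@holo_punct _ _ _ r); first lra.
    exact: dq.
  - move=> w wr; have wr' : cabs w < r by lra.
    have := gM _ wr'; rewrite (dslope0E w g0) cabsM wr mulrC.
    by rewrite ler_pdivlMr.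
by apply/negP; rewrite -ltNge ltr_pdivrMr// mulrC -ltr_pdivrMr.
Qed.

Lemma schwarz_le g (r M : R) : 0 < r -> (forall z, cabs z < r -> differentiable g z) ->
  (forall z, cabs z < r -> cabs (g z) <= M) -> g 0 = 0 ->
  forall z, cabs z < r -> cabs (g z) <= M / r * cabs z.
Proof.
move=> r0 dg gM g0 z zr; rewrite (dslope0E z g0) cabsM mulrC ler_wpM2r ?cabs_ge0//.
exact: schwarz.
Qed.

Lemma schwarz_diff g (r M : R) : 0 < r -> (forall z, cabs z < r -> differentiable g z) ->
  (forall z, cabs z < r -> cabs (g z) <= M) -> g 0 = 0 -> cabs ('d g 0 1) <= M / r.
Proof.
move=> r0 dg gM g0; have := schwarz r0 dg gM g0; move=> /(_ 0); rewrite cabs0 => /(_ r0).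
by rewrite /dslope eqxx.
Qed.

Lemma mobius_identity (a w : C R) :
  cabs (1 - a^* * w) ^+ 2 - cabs (w - a) ^+ 2 = (1 - cabs a ^+ 2) * (1 - cabs w ^+ 2).
Proof.
rewrite !cabs_sqr !(cReD, cImD, cReN, cImN) !(cReM, cImM) cReJ cImJ.
rewrite (_ : complex.Re (1 : C R) = 1)// (_ : complex.Im (1 : C R) = 0)//; ring.
Qed.

Lemma mobius_le (a w : C R) : cabs a <= 1 -> cabs w <= 1 -> cabs (w - a) <= cabs (1 - a^* * w).
Proof.
move=> a1 w1; rewrite -(@ler_pXn2r _ 2)// ?nnegrE ?cabs_ge0// -subr_ge0 mobius_identity.
by rewrite mulr_ge0// subr_ge0 expr_le1// cabs_ge0.
Qed.

Lemma mobius_denom (a w : C R) : cabs a < 1 -> cabs w <= 1 -> 1 - a^* * w != 0.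
Proof.
move=> a1 w1; rewrite subr_eq0; apply/eqP => h.
have : cabs (a^* * w) = 1 by rewrite -h cabs1.
rewrite cabsM cabsJ => {}h.
have := cabs_ge0 a; have := cabs_ge0 w; nra.
Qed.

Lemma mobius_schwarz f : (forall z, cabs z < 1 -> differentiable f z) ->
  (forall z, cabs z < 1 -> cabs (f z) <= 1) -> cabs (f 0) < 1 -> forall z, cabs z < 1 ->
  cabs (f z - f 0) <= cabs z * cabs (1 - (f 0)^* * f z).
Proof.
move=> df f1 f0 z z1; set a := f 0.
pose m w := (f w - a) / (1 - a^* * f w).
have dn w : cabs w < 1 -> 1 - a^* * f w != 0 by move=> /f1; exact: mobius_denom.
have : cabs (m z) <= 1 / 1 * cabs z.
  apply: (schwarz_le ltr01 _ _ _ z1); last by rewrite /m subrr mul0r.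
  - move=> w w1; have d1 := diffB_ (df _ w1) (@diff_cst_ R (C R) a w).
    have d2 := diffB_ (@diff_cst_ R (C R) 1 w) (diffM_ (@diff_cst_ R (C R) (a^*) w) (df _ w1)).
    exact: diffM_ d1 (diffV_ (f := fun w => 1 - a^* * f w) (dn _ w1) d2).
  - move=> w w1; rewrite cabsf ler_pdivrMr ?cabs_gt0 ?dn// mul1r.
    by apply: mobius_le; [exact: ltW|exact: f1].
by rewrite divr1 mul1r cabsf ler_pdivrMr ?cabs_gt0 ?dn.
Qed.

Lemma diff_le f (k : C R -> R) (r : R) : 0 < r -> differentiable f 0 -> {for 0, continuous k} ->
  (forall z, cabs z < r -> cabs (f z - f 0) <= cabs z * k z) -> cabs ('d f 0 1) <= k 0.
Proof.
move=> r0 df ck fk; rewrite leNgt; apply/negP => lt.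
pose e := (cabs ('d f 0 1) - k 0) / 3; have e0 : 0 < e by rewrite divr_gt0// subr_gt0.
have [d d0 hd] := diff_cderiv df e0.
have /real_continuousP/(_ _ e0)[d' d'0 hd'] := ck.
pose m := Num.min r (Num.min d d') / 2.
have mm : 0 < Num.min r (Num.min d d') by rewrite !lt_min r0 d0.
have [m1 m2 m3] : [/\ Num.min r (Num.min d d') <= r, Num.min r (Num.min d d') <= d &
  Num.min r (Num.min d d') <= d'] by split; rewrite !ge_min lexx ?orbT.
have m0 : 0 < m by rewrite divr_gt0.
have am : cabs (rc m) = m by rewrite cabs_real gtr0_norm.
have := hd (rc m); rewrite subr0 am (_ : m < d); last by rewrite /m; lra.
move=> /(_ isT) H1.
have := hd' (rc m); rewrite subr0 -cabs_nrm am (_ : m < d'); last by rewrite /m; lra.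
move=> /(_ isT); rewrite ltr_norml => /andP[_ H2].
have := fk (rc m); rewrite am (_ : m < r); last by rewrite /m; lra.
move=> /(_ isT) H3.
have H4 : cabs ('d f 0 1) * m <= e * m + m * k (rc m).
  rewrite -{1}am -cabsM.
  have -> : 'd f 0 1 * rc m = - (f (rc m) - f 0 - 'd f 0 1 * rc m) + (f (rc m) - f 0) by ring.
  by apply: le_trans (cabsD _ _) _; rewrite cabsN lerD.
rewrite (mulrC _ m) (mulrC _ m) -mulrDr ler_pM2l// in H4.
rewrite /e in H2 H4; lra.
Qed.

(** The first-order part of [mobius_schwarz] at 0. *)
Lemma schwarz_pick f : (forall z, cabs z < 1 -> differentiable f z) ->
  (forall z, cabs z < 1 -> cabs (f z) < 1) -> cabs ('d f 0 1) <= 1 - cabs (f 0) ^+ 2.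
Proof.
move=> df f1; have d0 : cabs (0 : C R) < 1 by rewrite cabs0.
pose k z : R := cabs (1 - (f 0)^* * f z).
have -> : 1 - cabs (f 0) ^+ 2 = k 0.
  rewrite /k mulrC mulJ_sqr -rc1 -rcN -rcD cabs_real ger0_norm// subr_ge0 expr_le1// ?cabs_ge0//.
  exact/ltW/f1.
apply: (@diff_le f k 1 ltr01 (df _ d0)).
  have c1 := ctsB (@cts_cst R (C R) 1 0) (ctsM (@cts_cst R (C R) ((f 0)^*) 0) (differentiable_continuous (df _ d0))).
  exact: (@continuous_comp _ _ _ (fun z => 1 - (f 0)^* * f z) (@cabs R) 0 c1 (@continuous_cabs _ _)).
move=> z z1; apply: mobius_schwarz => //; first by move=> w /f1 /ltW.
exact: f1.
Qed.

(** The function [g z / z] maps into the closed disc and takes a value near 1 at 0, so Schwarz-Pick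
    keeps it near 1 on [|z| <= r]. *)
Lemma schwarz_rigidity g (c e r : R) : (forall z, cabs z < 1 -> differentiable g z) ->
  (forall z, cabs z < 1 -> cabs (g z) <= 1) -> g 0 = 0 -> 'd g 0 1 = rc c ->
  0 < e -> e <= 1 / 2 -> 1 - e <= c -> r < 1 ->
  forall z, cabs z <= r -> cabs (g z - z) <= 7 * e / (1 - r).
Proof.
move=> dg g1 g0 gc e0 e2 ec r1 z zr.
have dq := dslope0_holo ltr01 dg.
have q1 w : cabs w < 1 -> cabs (dslope g 0 w) <= 1.
  by move=> w1; rewrite -[leRHS](divr1 1); exact: schwarz.
set q := dslope g 0 in dq q1.
have q0 : q 0 = rc c by rewrite /q /dslope eqxx.
have d0 : cabs (0 : C R) < 1 by rewrite cabs0.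
have c1 : c <= 1 by have := q1 _ d0; rewrite q0 cabs_real; have := ler_norm c; lra.
have k1 : 0 < 1 - e by lra.
(* Scaling by [k] moves the value at 0 strictly inside the disc, as [mobius_schwarz] requires, even
   when [c = 1]. The scaling and the distance from [c'] to 1 cost [3 * e], Schwarz-Pick
   [4 * e / (1 - r)]. *)
pose k := 1 - e; pose c' := k * c.
have c'0 : 0 <= c' by rewrite /c' /k; nra.
have c'1 : c' <= 1 - e by rewrite /c' /k; nra.
have c'2 : 1 - 2 * e <= c' by rewrite /c' /k; nra.
have z1 : cabs z < 1 by lra.
have ak : cabs (rc k) = k by rewrite cabs_real ger0_norm// ltW.
have A1 w : cabs w < 1 -> differentiable (fun w => rc k * q w) w.
  by move=> w1; exact: diffM_ (@diff_cst_ R (C R) (rc k) w) (dq _ w1).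
have A2 w : cabs w < 1 -> cabs (rc k * q w) <= 1.
  by move=> w1; rewrite cabsM ak; have := q1 _ w1; have := cabs_ge0 (q w); rewrite /k; nra.
have A3 : cabs (rc k * q 0) < 1 by rewrite q0 -rcM -/c' cabs_real ger0_norm//; lra.
have := mobius_schwarz A1 A2 A3 z1; rewrite q0 -rcM -/c' rcJ; set Q := rc k * q z.
have -> : 1 - rc c' * Q = rc (1 - c' ^+ 2) - rc c' * (Q - rc c').
  by rewrite rcD rcN rcX rc1; ring.
set X := cabs (Q - rc c') => H.
have X0 : 0 <= X := cabs_ge0 _.
have H1 : X <= r * (4 * e + X).
  apply: le_trans H _; apply: ler_pM => //; first exact: cabs_ge0.
    exact: cabs_ge0.
  apply: le_trans (cabsD _ _) _; rewrite cabsN cabsM !cabs_real -/X !ger0_norm//; last first.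
    by rewrite subr_ge0 expr_le1//; lra.
  rewrite expr2; nra.
have H2 : X <= 4 * e / (1 - r).
  rewrite ler_pdivlMr ?subr_gt0//; nra.
have z0 := cabs_ge0 z.
have q1z : cabs (q z - 1) <= 7 * e / (1 - r).
  have -> : q z - 1 = (1 - rc k) * q z + (Q - rc c') + (rc c' - 1) by rewrite /Q; ring.
  apply: le_trans (cabsD _ _) _.
  have h1 : cabs (rc c' - 1) <= 2 * e by rewrite -rc1 -rcN -rcD cabs_real ler_norml; apply/andP; split; lra.
  have h2 : cabs ((1 - rc k) * q z + (Q - rc c')) <= e + X.
    apply: le_trans (cabsD _ _) _; rewrite lerD// cabsM -rc1 -rcN -rcD cabs_real ger0_norm; last by rewrite /k; lra.
    by have := q1 _ z1; have := cabs_ge0 (q z); rewrite /k; nra.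
  apply: le_trans (lerD h2 h1) _.
  have : 3 * e <= 3 * e / (1 - r) by rewrite ler_pdivlMr ?subr_gt0//; nra.
  have -> : 7 * e / (1 - r) = 3 * e / (1 - r) + 4 * e / (1 - r) by ring.
  lra.
rewrite (dslope0E z g0) -/q.
have -> : z * q z - z = z * (q z - 1) by ring.
rewrite cabsM; apply: le_trans q1z; have := cabs_ge0 (q z - 1); nra.
Qed.

End schwarz.

(** * Cauchy estimates on balls of normed modules *)

Section holo_normed.
Context {R : realType}.

Lemma cderiv_line {V : normedModType (C R)} (h : V -> C R) (z v : V) (l : C R) :
  differentiable h (z + l *: v) ->
  cderiv (fun m : C R => h (z + m *: v)) l ('d h (z + l *: v) v).
Proof.
move=> dh e e0; have v1 : 0 < nrm v + 1 by rewrite ltr_wpDl// nrm_ge0.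
have e1 : 0 < e / (nrm v + 1) by rewrite divr_gt0.
have [d d0 hd] := diff_nrm dh e1; exists (d / (nrm v + 1)); first by rewrite divr_gt0.
move=> y; rewrite ltr_pdivlMr// => yd.
have yl : z + y *: v - (z + l *: v) = (y - l) *: v by rewrite opprD addrACA subrr add0r scalerBl.
have := hd (z + y *: v); rewrite yl nrmZ.
have yd' : cabs (y - l) * nrm v < d by have := cabs_ge0 (y - l); nra.
move=> /(_ yd'); have -> : 'd h (z + l *: v) ((y - l) *: v) = 'd h (z + l *: v) v * (y - l).
  by rewrite linearZ; exact: mulrC.
move=> H; apply: le_trans H _.
rewrite -mulrA ler_wpM2l ?(ltW e0)// ler_pdivrMl//.
by have := cabs_ge0 (y - l); nra.
Qed.

Lemma diff_line {V : normedModType (C R)} (h : V -> C R) (z v : V) (l : C R) :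
  differentiable h (z + l *: v) -> differentiable (fun m : C R => h (z + m *: v)) l.
Proof. by move=> /cderiv_line /cderiv_diff[]. Qed.

Lemma cderivB (f g : C R -> C R) z l m : cderiv f z l -> cderiv g z m ->
  cderiv (fun w => f w - g w) z (l - m).
Proof.
move=> hf hg e e0; have e2 : 0 < e / 2 by rewrite divr_gt0.
have [d d0 hd] := hf _ e2; have [d' d'0 hd'] := hg _ e2.
exists (Num.min d d'); first by rewrite lt_min d0.
move=> y; rewrite lt_min => /andP[/hd H1 /hd' H2].
have -> : f y - g y - (f z - g z) - (l - m) * (y - z) =
  (f y - f z - l * (y - z)) - (g y - g z - m * (y - z)) by ring.
apply: le_trans (cabsD _ _) _; rewrite cabsN; lra.
Qed.

Lemma cderiv_cst (c z : C R) : cderiv (fun _ => c) z 0.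
Proof. by move=> e e0; exists 1 => // y _; rewrite subrr mul0r subrr cabs0 mulr_ge0// ?cabs_ge0 ?ltW. Qed.

Section bounded_on_ball.
Context {V : normedModType (C R)} (h : V -> C R) (z0 : V) (r M : R).
Hypothesis dh : forall z, nrm (z - z0) < r -> differentiable h z.
Hypothesis hM : forall z, nrm (z - z0) < r -> cabs (h z - h z0) <= M.

(** The Schwarz lemma on the complex line through [z0] and [z]. *)
Lemma ball_lipschitz z : nrm (z - z0) < r -> cabs (h z - h z0) <= M / r * nrm (z - z0).
Proof.
move=> zr; have [->|zz0] := eqVneq z z0.
  by rewrite !subrr cabs0 nrm0 mulr0.
have v0 : 0 < nrm (z - z0) by rewrite nrm_gt0 subr_eq0.
have r0 : 0 < r := lt_trans v0 zr.
pose v := z - z0; pose s := r / nrm v.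
have s0 : 0 < s by rewrite divr_gt0.
have ls l : cabs l < s -> nrm (z0 + l *: v - z0) < r.
  by rewrite addrC addKr nrmZ /s ltr_pdivlMr.
have := @schwarz_le _ (fun l : C R => h (z0 + l *: v) - h z0) s M s0 _ _ _ 1.
rewrite !scale1r subrKC cabs1 mulr1 => H; have -> : M / r * nrm (z - z0) = M / s.
  by rewrite /s /v; field; rewrite !gt_eqF.
apply: H.
- move=> l /ls /dh /diff_line dl; exact: diffB_ dl (@diff_cst_ R (C R) (h z0) l).
- by move=> l /ls /hM.
- by rewrite scale0r addr0 subrr.
- by rewrite /s ltr_pdivlMr// mul1r.
Qed.

Lemma ball_diff_bound v : 0 < r -> cabs ('d h z0 v) <= M / r * nrm v.
Proof.
move=> r0; have dh0 : differentiable h z0 by apply: dh; rewrite subrr nrm0.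
have [->|vn0] := eqVneq v 0; first by rewrite linear0 cabs0 nrm0 mulr0.
have v0 : 0 < nrm v by rewrite nrm_gt0.
pose s := r / nrm v.
have s0 : 0 < s by rewrite divr_gt0.
have ls l : cabs l < s -> nrm (z0 + l *: v - z0) < r.
  by rewrite addrC addKr nrmZ /s ltr_pdivlMr.
have dl l : cabs l < s -> differentiable (fun l : C R => h (z0 + l *: v) - h z0) l.
  by move=> /ls /dh /diff_line dl; exact: diffB_ dl (@diff_cst_ R (C R) (h z0) l).
have := @schwarz_diff _ (fun l : C R => h (z0 + l *: v) - h z0) s M s0 dl _ _.
have -> : 'd (fun l : C R => h (z0 + l *: v) - h z0) 0 1 = 'd h z0 v.
  have dh0' : differentiable h (z0 + 0 *: v) by rewrite scale0r addr0.
  have := cderiv_diff (cderivB (cderiv_line dh0') (cderiv_cst (h z0) 0)).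
  by rewrite scale0r addr0 subr0 => -[].
have -> : M / r * nrm v = M / s by rewrite /s; field; rewrite !gt_eqF.
apply; first by move=> l /ls /hM.
by rewrite scale0r addr0 subrr.
Qed.

End bounded_on_ball.

(** Differentiability alone makes curves [C^1] only through this lemma. The increment
    [h (z + w) - h z] is [O(nrm w)] on a smaller ball by [ball_lipschitz], and a Cauchy estimate
    passes this to its differential, giving a Lipschitz bound for ['d h z v] at [z0]. *)
Lemma diff_vector_continuous {V : normedModType (C R)} (h : V -> C R) (z0 v : V) (r M : R) :
  0 < r -> (forall z, nrm (z - z0) < r -> differentiable h z) ->
  (forall z, nrm (z - z0) < r -> cabs (h z) <= M) ->
  {for z0, continuous (fun z => 'd h z v)}.
Proof.
move=> r0 dh hM; have M0 : 0 <= M.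
  by apply: le_trans (hM z0 _); rewrite ?cabs_ge0// subrr nrm0.
have key w : nrm w < r / 4 -> cabs ('d h (z0 + w) v - 'd h z0 v) <= 32 * M / r / r * nrm v * nrm w.
  move=> wr; pose k z := h (z + w) - h z.
  have zw z : nrm (z - z0) < r / 4 -> nrm (z + w - z0) < r.
    move=> zr; have := nrmD (z - z0) w; rewrite addrAC; lra.
  have dsh z : nrm (z - z0) < r / 4 -> differentiable (fun z : V => h (z + w)) z.
    move=> zr; have d2 : differentiable (fun _ : V => w) z by exact: differentiable_cst.
    have d1 : differentiable (fun z : V => z + w) z by exact: differentiableD (diff_id_ z) d2.
    exact: (differentiable_comp d1 (dh _ (zw _ zr))).
  have dk z : nrm (z - z0) < r / 4 -> differentiable k z.
    move=> zr; have d2 : differentiable h z by apply: dh; lra.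
    exact: diffB_ (dsh z zr) d2.
  have kM z : nrm (z - z0) < r / 4 -> cabs (k z) <= 4 * M / r * nrm w / 2 * 2.
    move=> zr; have -> : 4 * M / r * nrm w / 2 * 2 = (2 * M) / (r / 2) * nrm (z + w - z).
      by rewrite (addrC z) addrK; field; rewrite gt_eqF.
    apply: (@ball_lipschitz _ h z (r / 2) (2 * M)).
    - by move=> y yr; apply: dh; have := nrm_tri z y z0; lra.
    - move=> y yr; apply: le_trans (cabsD _ _) _; rewrite cabsN.
      have h1 : cabs (h y) <= M by apply: hM; have := nrm_tri z y z0; lra.
      have h2 : cabs (h z) <= M by apply: hM; lra.
      lra.
    - by rewrite (addrC z) addrK; lra.
  have z00 : nrm (z0 - z0) < r / 4 by rewrite subrr nrm0; lra.
  have E : 'd k z0 v = 'd h (z0 + w) v - 'd h z0 v.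
    have dkl : differentiable k (z0 + 0 *: v) by rewrite scale0r addr0; exact: dk.
    have d1 : differentiable h (z0 + w + 0 *: v) by rewrite scale0r addr0; apply: dh; exact: zw.
    have d2 : differentiable h (z0 + 0 *: v) by rewrite scale0r addr0; apply: dh; rewrite subrr nrm0.
    have FE : (fun m : C R => k (z0 + m *: v)) = (fun m : C R => h (z0 + w + m *: v) - h (z0 + m *: v)).
      by apply/funext => m; rewrite /k (addrAC z0 w).
    have c1 := cderiv_line dkl; rewrite FE scale0r addr0 in c1.
    have [_ e1] := cderiv_diff c1.
    have c2 := cderivB (cderiv_line d1) (cderiv_line d2); rewrite !scale0r !addr0 in c2.
    have [_ e2] := cderiv_diff c2.
    exact: etrans (esym e1) e2.
  rewrite -E; have kB z : nrm (z - z0) < r / 4 -> cabs (k z - k z0) <= 8 * M / r * nrm w.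
    move=> zr; apply: le_trans (cabsD _ _) _; rewrite cabsN.
    have := kM _ zr; have := kM _ z00.
    have -> : 4 * M / r * nrm w / 2 * 2 = 4 * M / r * nrm w by field; rewrite gt_eqF.
    have -> : 8 * M / r * nrm w = 2 * (4 * M / r * nrm w) by ring.
    lra.
  have r40 : 0 < r / 4 by lra.
  apply: le_trans (ball_diff_bound dk kB v r40) _.
  by rewrite le_eqVlt; apply/orP; left; apply/eqP; field; rewrite gt_eqF.
apply/continuous_nrmP => e e0.
pose K := 32 * M / r / r * nrm v.
have K0 : 0 <= K by rewrite !mulr_ge0 ?invr_ge0 ?nrm_ge0 ?(ltW r0).
have K1 : 0 < K + 1 by rewrite ltr_wpDl.
exists (Num.min (r / 4) (e / (K + 1))); first by rewrite lt_min !divr_gt0.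
move=> y; rewrite lt_min => /andP[yr ye]; have := key _ yr; rewrite subrKC -/K => H.
apply: le_lt_trans H _; rewrite ltr_pdivlMr// in ye.
have := nrm_ge0 (y - z0); nra.
Qed.

End holo_normed.

(** * Hyperbolic functions *)

Section tanh.
Context {R : realType}.
Implicit Types x t : R.

Definition ch x : R := (expR x + expR (- x)) / 2.
Definition sh x : R := (expR x - expR (- x)) / 2.
Definition th x : R := sh x / ch x.
(** The inverse of [th]. With the density [1 / (1 - |z|^2)] of the disc, [ath |z|] is the Poincare
    distance from 0 to [z]. *)
Definition ath x : R := (ln (1 + x) - ln (1 - x)) / 2.

Lemma ch_gt0 x : 0 < ch x.
Proof. by rewrite divr_gt0// addr_gt0// expR_gt0. Qed.

Lemma ch_neq0 x : ch x != 0. Proof. by rewrite gt_eqF// ch_gt0. Qed.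

Lemma ch2_sh2 x : ch x ^+ 2 - sh x ^+ 2 = 1.
Proof.
have e : expR x * expR (- x) = 1 by rewrite -expRD subrr expR0.
have -> : ch x ^+ 2 - sh x ^+ 2 = expR x * expR (- x) by rewrite /ch /sh; field.
exact: e.
Qed.

Lemma onem_th2 x : 1 - th x ^+ 2 = (ch x ^+ 2)^-1.
Proof.
have := ch2_sh2 x; have := ch_neq0 x => c0 e.
by rewrite /th expr_div_n -[1](divff (expf_neq0 2 c0)) -mulrBl e mul1r.
Qed.

Lemma th2_lt1 x : th x ^+ 2 < 1.
Proof. by rewrite -subr_gt0 onem_th2 invr_gt0 exprn_gt0// ch_gt0. Qed.

Lemma th_lt1 x : `|th x| < 1.
Proof.
by rewrite -(@ltr_pXn2r _ 2)// ?nnegrE// expr1n real_normK ?num_real// th2_lt1.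
Qed.

Lemma sh_ge0 x : 0 <= x -> 0 <= sh x.
Proof. by move=> x0; rewrite divr_ge0// subr_ge0 ler_expR; lra. Qed.

Lemma th_ge0 x : 0 <= x -> 0 <= th x.
Proof. by move=> x0; rewrite divr_ge0 ?sh_ge0 ?(ltW (ch_gt0 _)). Qed.

Lemma th0 : th 0 = 0. Proof. by rewrite /th /sh oppr0 subrr !mul0r. Qed.

Lemma thK x : ath (th x) = x.
Proof.
have c0 := ch_neq0 x; have cp := ch_gt0 x.
have e1 : 1 + th x = expR x / ch x by rewrite /th /sh; rewrite -{1}(divff c0) -mulrDl /ch; congr (_ / _); field.
have e2 : 1 - th x = expR (- x) / ch x by rewrite /th /sh; rewrite -{1}(divff c0) -mulrBl /ch; congr (_ / _); field.
rewrite /ath e1 e2 (@ln_div _ (expR x)) ?(@ln_div _ (expR (- x))) ?posrE ?expR_gt0 ?ch_gt0// !expRK; by field.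
Qed.

Lemma athK x : `|x| < 1 -> th (ath x) = x.
Proof.
rewrite ltr_norml => /andP[x1 x2]; set y := ath x.
have p1 : 0 < 1 + x by lra. have p2 : 0 < 1 - x by lra.
have e : expR (2 * y) = (1 + x) / (1 - x).
  by rewrite /y /ath mulrC divfK// -ln_div ?posrE// lnK// posrE divr_gt0.
have e0 : expR y != 0 by rewrite gt_eqF// expR_gt0.
have e2 : expR y ^+ 2 = (1 + x) / (1 - x) by rewrite expr2 -expRD -e; congr expR; ring.
have n2 : 1 - x != 0 by rewrite gt_eqF.
have s0 : expR y ^+ 2 + 1 != 0 by rewrite gt_eqF// ltr_wpDl// exprn_ge0// expR_ge0.
have -> : th y = (expR y ^+ 2 - 1) / (expR y ^+ 2 + 1).
  by rewrite /th /sh /ch expRN; field; rewrite s0 e0.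
rewrite e2 in s0 *; field; rewrite n2 /=; apply/eqP; lra.
Qed.

Lemma th_mono x t : x <= t -> th x <= th t.
Proof.
move=> xt; rewrite /th ler_pdivrMr ?ch_gt0// mulrAC ler_pdivlMr ?ch_gt0//.
rewrite -subr_ge0; have -> : sh t * ch x - sh x * ch t = sh (t - x).
  by rewrite /sh /ch opprB !expRD; field.
by apply: sh_ge0; lra.
Qed.

Lemma ch_le x t : 0 <= x -> x <= t -> ch x <= ch t.
Proof.
move=> x0 xt; rewrite -(@ler_pXn2r _ 2)// ?nnegrE ?(ltW (ch_gt0 _))//.
have c1 := ch2_sh2 x; have c2 := ch2_sh2 t.
have : sh x <= sh t by rewrite /sh; have := xt; rewrite -ler_expR; have : expR (- t) <= expR (- x) by [rewrite ler_expR; lra]; lra.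
have := sh_ge0 x0; nra.
Qed.

Lemma is_derive_th x : is_derive x 1 th (1 - th x ^+ 2).
Proof.
have c0 := ch_neq0 x.
have dN : is_derive x 1 (fun y => expR (- y)) (- expR (- x)).
  have := @is_derive1_comp R expR -%R x (expR (- x)) (-1).
  by move=> H; apply: is_derive_eq (H _ _) _; rewrite mulrN1.
have dc : is_derive x 1 ch (sh x).
  by apply: is_derive_eq; rewrite ?scaler0 ?addr0 /GRing.scale /= /sh; ring.
have ds : is_derive x 1 sh (ch x).
  by apply: is_derive_eq; rewrite ?scaler0 ?addr0 /GRing.scale /= /ch; ring.
have dv : is_derive x 1 (fun y => (ch y)^-1) (- (ch x) ^- 2 * sh x).
  split; first by apply: derivableV => //; apply: ex_derive.
  by rewrite deriveV// derive_val.
apply: is_derive_eq; rewrite /GRing.scale /= /th; field.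
exact: c0.
Qed.

Lemma is_derive_ath x : `|x| < 1 -> is_derive x 1 ath (1 - x ^+ 2)^-1.
Proof.
rewrite ltr_norml => /andP[x1 x2]; have p1 : 0 < 1 + x by lra. have p2 : 0 < 1 - x by lra.
have d1 : is_derive x 1 (fun y : R => ln (1 + y)) ((1 + x)^-1 * 1).
  have H : is_derive (1 + x) 1 (@ln R) (1 + x)^-1 := is_derive1_ln p1.
  have H2 : is_derive x 1 (fun y : R => 1 + y) 1 by apply: is_derive_eq; rewrite ?add0r ?mulr1 ?mul1r.
  exact: (@is_derive1_comp R (@ln R) (fun y : R => 1 + y) x _ _ H H2).
have d2 : is_derive x 1 (fun y : R => ln (1 - y)) ((1 - x)^-1 * (- 1)).
  have H : is_derive (1 - x) 1 (@ln R) (1 - x)^-1 := is_derive1_ln p2.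
  have H2 : is_derive x 1 (fun y : R => 1 - y) (- 1) by apply: is_derive_eq; rewrite ?add0r ?mulr1 ?mul1r.
  exact: (@is_derive1_comp R (@ln R) (fun y : R => 1 - y) x _ _ H H2).
apply: is_derive_eq; rewrite ?scaler0 ?addr0 /GRing.scale /=; field.
have n1 : 1 + x != 0 by rewrite gt_eqF.
have n2 : 1 - x != 0 by rewrite gt_eqF.
have -> : 1 - x ^+ 2 = (1 - x) * (1 + x) by ring.
by rewrite mulf_neq0 //= n1 n2.
Qed.

End tanh.

(** * Curves and the infinitesimal Kobayashi metric *)

Section row_norm.
Context {R : realType} {d : nat}.
Implicit Types x y : 'rV[C R]_d.

Lemma nrm_row_lt x (e : R) : 0 < e -> (nrm x < e <-> forall j, cabs (x 0 j) < e).
Proof.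
move=> e0; have e0' : 0 < rc e :> C R by rewrite ltcR.
have E : (nrm x < e) <-> ball (0 : 'rV[C R]_d) (rc e) x.
  rewrite mx_norm_ball /ball_ /= sub0r normrN.
  have -> : `|x| = rc (nrm x) := nrmE x.
  by rewrite ltcR.
split=> [/E[_ h] j|h].
  have := h 0 j; rewrite -ball_normE /ball_ /= mxE sub0r normrN.
  by rewrite [`|_|]cabsE ltcR.
apply/E; split=> // i j; rewrite ord1 -ball_normE /ball_ /= mxE sub0r normrN.
by rewrite [`|_|]cabsE ltcR.
Qed.

Lemma cabs_coord x j : cabs (x 0 j) <= nrm x.
Proof.
rewrite leNgt; apply/negP => lt; have x0 : 0 < cabs (x 0 j) := le_lt_trans (nrm_ge0 _) lt.
by have /(nrm_row_lt x x0)/(_ j) := lt; rewrite ltxx.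
Qed.

Lemma nrm_row_le x (e : R) : 0 <= e -> (forall j, cabs (x 0 j) <= e) -> nrm x <= e.
Proof.
move=> e0 h; rewrite leNgt; apply/negP => lt.
by have : nrm x < (e + nrm x) / 2; [apply/nrm_row_lt; [lra|move=> j; have := h j; lra]|lra].
Qed.

End row_norm.

Section real_curves.
Context {R : realType}.

Lemma first_order_is_derive (f : R -> R) (x l : R) :
  (forall e : R, 0 < e -> exists2 d : R, 0 < d & forall y, `|y - x| < d ->
    `|f y - f x - l * (y - x)| <= e * `|y - x|) -> is_derive x 1 f l.
Proof.
move=> h.
have cv : (fun k : R => k^-1 *: ((f \o shift x) (k *: (1 : R)) - f x)) @ 0^' --> l.
  apply/cvgrPdist_le => e e0; have [d d0 hd] := h _ e0.
  have nz : nbhs (0 : R) [set k | k != 0 -> `|l - k^-1 *: ((f \o shift x) (k *: (1 : R)) - f x)| <= e].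
    apply/nbhs_ballP; exists d => // k; rewrite /ball /= sub0r normrN => kd k0.
    have := hd (k + x); rewrite addrK => /(_ kd) {}hd.
    have -> : l - k^-1 *: (f (k *: 1 + x) - f x) = - (k^-1 * (f (k + x) - f x - l * k)).
      by rewrite [k *: 1]mulr1 /GRing.scale /=; field.
    by rewrite normrN normrM normfV ler_pdivrMl ?normr_gt0// [leRHS]mulrC.
  exact: nz.
have dv : derivable f x 1 by apply/cvg_ex; exists l.
by split=> //; exact: cvg_lim cv.
Qed.

(** Spelled out because the parameter is real while the target is normed over [C R]. *)
Definition rder {V : normedModType (C R)} (c : R -> V) (t : R) (v : V) :=
  forall e : R, 0 < e -> exists2 d : R, 0 < d & forall s, `|s - t| < d ->
    nrm (c s - c t - rc (s - t) *: v) <= e * `|s - t|.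

Lemma rder_lipschitz {V : normedModType (C R)} (c : R -> V) t v : rder c t v ->
  exists2 d : R, 0 < d & forall s, `|s - t| < d -> nrm (c s - c t) <= (nrm v + 1) * `|s - t|.
Proof.
move=> /(_ _ ltr01)[d d0 hd]; exists d => // s /hd; rewrite mul1r => H.
rewrite -(subrK (rc (s - t) *: v) (c s - c t)).
apply: le_trans (nrmD _ _) _; rewrite nrmZ cabs_real mulrDl mul1r addrC lerD//.
by rewrite mulrC.
Qed.

Lemma rder_continuous {V : normedModType (C R)} (c : R -> V) t v : rder c t v ->
  {for t, continuous c}.
Proof.
move=> /rder_lipschitz[d d0 hd] A /nbhs_nrmP[e e0 eA].
have v1 : 0 < nrm v + 1 by rewrite ltr_wpDl// nrm_ge0.
apply/nbhs_ballP; exists (Num.min d (e / (nrm v + 1))) => /=; first by rewrite lt_min d0 divr_gt0.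
move=> s; rewrite /ball /= distrC lt_min => /andP[/hd H se]; apply: eA.
by apply: le_lt_trans H _; rewrite mulrC -ltr_pdivlMr.
Qed.

Lemma rder_chain {V : normedModType (C R)} (h : V -> C R) (c : R -> V) t v :
  differentiable h (c t) -> rder c t v -> rder (fun s => h (c s)) t ('d h (c t) v).
Proof.
move=> dh cv e e0; set l := 'd h (c t) v.
have v1 : 0 < nrm v + 1 by rewrite ltr_wpDl// nrm_ge0.
have [M M0 hM] : exists2 M : R, 0 < M & forall w, cabs ('d h (c t) w) <= M * nrm w.
  have /continuous_nrmP/(_ _ ltr01)[d d0 hd] : {for 0, continuous ('d h (c t))}.
    exact: diff_continuous.
  exists (2 / d); first by rewrite divr_gt0.
  move=> w; have [->|w0] := eqVneq w 0; first by rewrite linear0 cabs0 nrm0 mulr0.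
  have nw : 0 < nrm w by rewrite nrm_gt0.
  pose a := d / 2 / nrm w; have a0 : 0 < a by rewrite !divr_gt0.
  have aE : cabs (rc a) = a by rewrite cabs_real gtr0_norm.
  have aw : a * nrm w = d / 2 by rewrite /a divfK// gt_eqF.
  have := hd (rc a *: w); rewrite subr0 linear0 subr0 linearZ nrmZ aE aw (_ : d / 2 < d); last by lra.
  move=> /(_ isT); rewrite nrmZ aE -cabs_nrm => H.
  have -> : 2 / d * nrm w = a^-1 by rewrite /a; field; rewrite !gt_eqF.
  by rewrite -[leRHS]mulr1 ler_pdivlMl// ltW.
have e1 : 0 < e / 2 / (nrm v + 1) by rewrite !divr_gt0.
have e2 : 0 < e / 2 / M by rewrite !divr_gt0.
have [d1 d10 h1] := diff_nrm dh e1.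
have [d2 d20 h2] := cv _ e2.
have [d3 d30 h3] := rder_lipschitz cv.
exists (Num.min d2 (Num.min d3 (d1 / (nrm v + 1)))); first by rewrite !lt_min d20 d30 divr_gt0.
move=> s; rewrite !lt_min => /and3P[s2 s3 s1]; have {}h2 := h2 _ s2; have {}h3 := h3 _ s3.
have := h1 (c s) (le_lt_trans h3 _); rewrite mulrC -ltr_pdivlMr// => /(_ s1) H1.
have E : h (c s) - h (c t) - rc (s - t) *: l = (h (c s) - h (c t) - 'd h (c t) (c s - c t))
   + 'd h (c t) (c s - c t - rc (s - t) *: v).
  rewrite /l [X in _ = _ + X]linearB [X in _ = _ + (_ - X)]linearZ. by rewrite [RHS]addrA subrK.
rewrite E; apply: le_trans (nrmD _ _) _.
have k1 : nrm (h (c s) - h (c t) - 'd h (c t) (c s - c t)) <= e / 2 * `|s - t|.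
  apply: le_trans H1 _; apply: le_trans (ler_wpM2l (ltW e1) h3) _.
  by rewrite mulrA divfK ?gt_eqF.
have k2 : nrm ('d h (c t) (c s - c t - rc (s - t) *: v)) <= e / 2 * `|s - t|.
  apply: le_trans (hM _) _; apply: le_trans (ler_wpM2l (ltW M0) h2) _.
  by rewrite mulrA (mulrC M) divfK ?gt_eqF.
lra.
Qed.

Lemma rder_Re (k : R -> C R) (t : R) (l : C R) : rder k t l ->
  is_derive t 1 (fun s => complex.Re (k s)) (complex.Re l).
Proof.
move=> kl; apply: first_order_is_derive => e /kl[d d0 hd]; exists d => // s /hd.
apply: le_trans; apply: le_trans (cabs_Re _).
by rewrite !(cReD, cReN) -[_ *: _]/(rc (s - t) * l) cReM /= mul0r subr0 (mulrC (s - t)).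
Qed.

Lemma rder_real (a : R -> R) (t l : R) : is_derive t 1 a l -> rder (fun s => rc (a s)) t (rc l).
Proof.
move=> /real_first_order h e /h[d d0 hd]; exists d => // s /hd.
have -> : rc (a s) - rc (a t) - rc (s - t) *: rc l = rc (a s - a t - l * (s - t)).
  by rewrite -[_ *: _]/(rc (s - t) * rc l) -rcM -!rcN -!rcD (mulrC l).
by rewrite -cabs_nrm cabs_real.
Qed.

Lemma rder_row {d : nat} (g : R -> 'rV[C R]_d) (t : R) (a b : 'I_d -> R) :
  (forall j, is_derive t 1 (re_coord g j) (a j)) ->
  (forall j, is_derive t 1 (im_coord g j) (b j)) ->
  rder g t (\row_j (a j +i* b j)%C).
Proof.
move=> ga gb e e0; have e2 : 0 < e / 2 by rewrite divr_gt0.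
have [da da0 hda] : exists2 da : R, 0 < da & forall s j, `|s - t| < da ->
    `|re_coord g j s - re_coord g j t - a j * (s - t)| <= e / 2 * `|s - t|.
  have /choice[D DP] : forall j, exists da : R, 0 < da /\ forall s, `|s - t| < da ->
    `|re_coord g j s - re_coord g j t - a j * (s - t)| <= e / 2 * `|s - t|.
    by move=> j; have [x x0 hx] := real_first_order (ga j) e2; exists x.
  (* The default 1 keeps the minimum positive when there is no coordinate. *)
  exists (\big[Num.min/1]_j D j).
    by elim/big_ind: _ => // [x y x0 y0|j _]; [rewrite lt_min x0|exact: (DP j).1].
  move=> s j sD; apply: (DP j).2; apply: lt_le_trans sD _.
  by rewrite (bigD1 j)//= ge_min lexx.
have [db db0 hdb] : exists2 db : R, 0 < db & forall s j, `|s - t| < db ->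
    `|im_coord g j s - im_coord g j t - b j * (s - t)| <= e / 2 * `|s - t|.
  have /choice[D DP] : forall j, exists da : R, 0 < da /\ forall s, `|s - t| < da ->
    `|im_coord g j s - im_coord g j t - b j * (s - t)| <= e / 2 * `|s - t|.
    by move=> j; have [x x0 hx] := real_first_order (gb j) e2; exists x.
  exists (\big[Num.min/1]_j D j).
    by elim/big_ind: _ => // [x y x0 y0|j _]; [rewrite lt_min x0|exact: (DP j).1].
  move=> s j sD; apply: (DP j).2; apply: lt_le_trans sD _.
  by rewrite (bigD1 j)//= ge_min lexx.
exists (Num.min da db); first by rewrite lt_min da0.
move=> s; rewrite lt_min => /andP[sa sb]; apply: nrm_row_le; first by rewrite mulr_ge0// ltW.
move=> j; rewrite !mxE; apply: le_trans (cabs_le _) _.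
rewrite !(cReD, cImD, cReN, cImN) cReM cImM /= !mul0r subr0 addr0.
have := hda s j sa; have := hdb s j sb; rewrite /re_coord /im_coord.
rewrite (mulrC (a j)) (mulrC (b j)); lra.
Qed.

Lemma continuous_complex (a b : R -> R) (t : R) : {for t, continuous a} -> {for t, continuous b} ->
  {for t, continuous (fun s => (a s +i* b s)%C : C R)}.
Proof.
move=> ca cb A /nbhs_nrmP[e e0 eA]; have e2 : 0 < e / 2 by rewrite divr_gt0.
have /cvgrPdist_lt/(_ _ e2)/nbhs_ballP[d1 /= d10 h1] := ca.
have /cvgrPdist_lt/(_ _ e2)/nbhs_ballP[d2 /= d20 h2] := cb.
apply/nbhs_ballP; exists (Num.min d1 d2) => /=; first by rewrite lt_min d10.
move=> s; rewrite /ball /= lt_min => /andP[/h1 k1 /h2 k2]; apply: eA.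
rewrite -cabs_nrm; apply: le_lt_trans (cabs_le _) _ => /=.
by move: k1 k2; rewrite /= distrC (distrC (b t)); lra.
Qed.

End real_curves.

Import HBSimple HBNNSimple.

(** * Lower integrals and growth along curves *)

Section lower_integral.
Context d (T : measurableType d) (R : realType) (mu : {measure set T -> \bar R}).
Local Open Scope ereal_scope.
Implicit Types (f g : T -> \bar R) (A B : set T).

(* [\int] of a non-measurable nonnegative function is its lower integral, which
   is still monotone and superadditive. *)
Lemma ge0_le_lower_integral A f g : (forall x, A x -> 0 <= f x) ->
  (forall x, A x -> f x <= g x) -> \int[mu]_(x in A) f x <= \int[mu]_(x in A) g x.
Proof.
move=> f0 fg; have g0 x : A x -> 0 <= g x by move=> Ax; exact: le_trans (f0 _ Ax) (fg _ Ax).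
rewrite !ge0_integralE//; apply: le_ereal_sup => _ [h /= hf <-]; exists h => //= x.
apply: le_trans (hf x) _; rewrite /patch; case: ifPn => //; rewrite inE => Ax; exact: fg.
Qed.

(** Simple functions below [f] on [A] and on [B] add up to one below [f] on the union. The suprema
    are taken one at a time, after the infinite case is set aside so that subtraction makes
    sense. *)
Lemma ge0_lower_integralU A B f : [disjoint A & B] -> (forall x, 0 <= f x) ->
  \int[mu]_(x in A) f x + \int[mu]_(x in B) f x <= \int[mu]_(x in A `|` B) f x.
Proof.
move=> AB f0.
have [->|fin] := eqVneq (\int[mu]_(x in A `|` B) f x) +oo; first exact: leey.
set I := \int[mu]_(x in A `|` B) f x in fin *.
have key (h1 h2 : {nnsfun T >-> R}) : (forall x, (h1 x)%:E <= (f \_ A) x) ->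
    (forall x, (h2 x)%:E <= (f \_ B) x) -> sintegral mu h1 + sintegral mu h2 <= I.
  move=> H1 H2; rewrite -sintegralD /I ge0_integralE//; apply: ereal_sup_ubound.
  exists (add_nnsfun h1 h2) => //= x; rewrite EFinD.
  have := H1 x; have := H2 x; rewrite /patch.
  case: ifPn => xB; case: ifPn => xA.
  - exfalso; move: AB => /disj_setPLR /(_ x); rewrite !inE in xA xB => /(_ xA); exact.
  - rewrite inE in xB; rewrite mem_set; last by right.
    by move=> k2 k1; rewrite -[leRHS]add0e; exact: leeD.
  - rewrite inE in xA; rewrite mem_set; last by left.
    by move=> k2 k1; rewrite -[leRHS]adde0; exact: leeD.
  - rewrite memNset; first by move=> k2 k1; rewrite -[leRHS]adde0; exact: leeD.
    by move=> [Ax|Bx]; [move: xA|move: xB]; rewrite mem_set.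
have I0 : 0 <= I by apply: integral_ge0.
have If : I \is a fin_num by rewrite ge0_fin_numE// lt_neqAle fin leey.
have B_le (h1 : {nnsfun T >-> R}) : (forall x, (h1 x)%:E <= (f \_ A) x) ->
    \int[mu]_(x in B) f x <= I - sintegral mu h1.
  move=> H1; have s1 : sintegral mu h1 \is a fin_num.
    rewrite ge0_fin_numE ?sintegral_ge0//; apply: le_lt_trans (_ : I < +oo); last by rewrite -ge0_fin_numE.
    have H0 x : (@nnsfun0 _ T R x)%:E <= (f \_ B) x by rewrite /= /patch; case: ifP.
    by have := key _ _ H1 H0; rewrite sintegral0 adde0.
  rewrite ge0_integralE//; apply: ge_ereal_sup => _ [h2 /= H2 <-].
  by rewrite leeBrDr// addeC; exact: key.
have Bf : \int[mu]_(x in B) f x \is a fin_num.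
  have H0 x : (@nnsfun0 _ T R x)%:E <= (f \_ A) x by rewrite /= /patch; case: ifP.
  have := B_le _ H0; rewrite sintegral0 sube0 => BI.
  rewrite ge0_fin_numE ?integral_ge0//; apply: le_lt_trans BI _; by rewrite -ge0_fin_numE.
rewrite -leeBrDr// [leLHS]ge0_integralE//; apply: ge_ereal_sup => _ [h1 /= H1 <-].
have s1 : sintegral mu h1 \is a fin_num.
  rewrite ge0_fin_numE ?sintegral_ge0//; apply: le_lt_trans (_ : I < +oo); last by rewrite -ge0_fin_numE.
  have H0 x : (@nnsfun0 _ T R x)%:E <= (f \_ B) x by rewrite /= /patch; case: ifP.
  by have := key _ _ H1 H0; rewrite sintegral0 adde0.
by rewrite leeBrDr// addeC -leeBrDr//; exact: B_le.
Qed.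

End lower_integral.

Section growth.
Context {R : realType}.
Local Notation mu := (@lebesgue_measure R).

(* FTC against the lower integral of a majorant of [|F'|] *)
Lemma growth_piece (k : R -> \bar R) (F f : R -> R) (a b : R) : a <= b ->
  (forall t, a <= t <= b -> is_derive t 1 F (f t)) ->
  (forall t, a <= t <= b -> {for t, continuous f}) ->
  (forall t, 0 <= k t)%E -> (forall t, a < t < b -> (`|f t|%:E <= k t)%E) ->
  ((F b - F a)%:E <= \int[mu]_(t in `]a, b]) k t)%E.
Proof.
move=> ab dF cf k0 fk; move: ab; rewrite le_eqVlt => /predU1P[->|ab].
  by rewrite subrr integral_ge0.
have cF t : a <= t <= b -> {for t, continuous F}.
  by move=> /dF[dv _]; apply: differentiable_continuous; apply/derivable1_diffP.
have wf : {within `[a, b], continuous f} by exact: ctson_within.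
have iF : (\int[mu]_(x in `[a, b]) (f x)%:E = (F b)%:E - (F a)%:E)%E.
  apply: continuous_FTC2 => //.
    split.
    - by move=> t; rewrite in_itv /= => /andP[ta tb]; have [] := dF t _; rewrite ?(ltW ta) ?(ltW tb).
    - by apply: cvg_at_right_filter; apply: cF; rewrite lexx ltW.
    - by apply: cvg_at_left_filter; apply: cF; rewrite lexx ltW.
  move=> t; rewrite in_itv /= => /andP[ta tb]; rewrite derive1E.
  by have [|_ ->] := dF t _; rewrite ?(ltW ta) ?(ltW tb).
have cnf : {within `[a, b], continuous (fun t => `|f t|)}.
  by apply: ctson_within => t /cf ct; apply: (@continuous_comp _ _ _ f (fun x => `|x|)) => //; exact: norm_continuous.
have inf : mu.-integrable `[a, b] (EFin \o (fun t => `|f t|)).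
  by apply: continuous_compact_integrable => //; exact: segment_compact.
have int_f : mu.-integrable `[a, b] (EFin \o f).
  by apply: continuous_compact_integrable => //; exact: segment_compact.
rewrite EFinB -iF.
apply: (@le_trans _ _ (\int[mu]_(x in `[a, b]) `|f x|%:E)%E).
  by apply: le_integral => // t _; rewrite lee_fin ler_norm.
(* The majorant is compared with [|f t|] on the open interval only: where two pieces of a curve
   meet, its velocity need not be that of either piece. The point [b] is then restored, so that
   consecutive half-open pieces are disjoint. *)
rewrite integral_itv_bndoo; last first.
  apply: measurable_funS (measurable_int _ inf) => //.
  exact: subset_itv_oo_cc.
apply: (@le_trans _ _ (\int[mu]_(x in `]a, b[) k x)%E).
  by apply: ge0_le_lower_integral => t /=; rewrite ?lee_fin// in_itv /= => tab; exact: fk.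
have -> : (`]a, b]%classic : set R) = `]a, b[ `|` [set b].
  by rewrite setUitv1//= ?bnd_simp.
apply: le_trans (ge0_lower_integralU _ _ _) => //.
  by rewrite integral_set1 adde0.
by apply/disj_setPLR => t /=; rewrite in_itv /= => /andP[_ tb] /= te; rewrite te ltxx in tb.
Qed.

Lemma growth (k : R -> \bar R) (F : R -> R) (n : nat) (s : nat -> R) : (forall t, 0 <= k t)%E ->
  (forall i, (i < n)%N -> s i < s i.+1 /\ exists G g : R -> R,
    [/\ {in `[s i, s i.+1], F =1 G}, forall t, s i <= t <= s i.+1 -> is_derive t 1 G (g t),
        forall t, s i <= t <= s i.+1 -> {for t, continuous g} &
        forall t, s i < t < s i.+1 -> (`|g t|%:E <= k t)%E]) ->
  forall t, s 0%N <= t <= s n -> ((F t - F (s 0%N))%:E <= \int[mu]_(x in `[s 0%N, t]) k x)%E.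
Proof.
move=> k0; elim: n => [_ t|n IH H t /andP[t0 tn]].
  by move=> /andP[h1 h2]; have -> : t = s 0%N; [lra|rewrite subrr integral_ge0].
have {}IH := IH (fun i ni => H i (ltnW ni)).
have mono m : (m <= n)%N -> s 0%N <= s m.
  by elim: m => // m Hm mn; have [sm _] := H m (leqW mn); apply: le_trans (ltW sm); apply: Hm; exact: ltnW.
have s0n := mono n (leqnn _).
have [tsn|snt] := leP t (s n); first by apply: IH; rewrite t0.
have [_ [G [g [FG dG cg gk]]]] := H n (ltnSn n).
have -> : F t - F (s 0%N) = (F (s n) - F (s 0%N)) + (G t - G (s n)).
  rewrite -!FG ?in_itv /= ?lexx ?(ltW snt)//; first by ring.
  by rewrite (le_trans (ltW snt) tn).
have -> : (`[s 0%N, t]%classic : set R) = `[s 0%N, s n] `|` `]s n, t].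
  by rewrite -itv_bndbnd_setU// bnd_simp// ltW.
apply: le_trans (ge0_lower_integralU _ _ _) => //; last first.
  by apply/disj_setPLR => x /=; rewrite !in_itv /= => /andP[_ xn] /andP[nx _]; lra.
rewrite EFinD; apply: leeD; first by apply: IH; rewrite s0n lexx.
apply: (@growth_piece k G g) => //; first exact: ltW.
- by move=> x /andP[x1 x2]; apply: dG; rewrite x1; lra.
- by move=> x /andP[x1 x2]; apply: cg; rewrite x1; lra.
- by move=> x /andP[x1 x2]; apply: gk; rewrite x1; lra.
Qed.

End growth.

(** * Lower bounds for the Kobayashi metric from holomorphic functions *)

Section kobayashi_estimates.
Context {R : realType} {d : nat}.
Implicit Types (D : set 'rV[C R]_d).

Lemma diff_of_comp {U V W : normedModType (C R)} (f : U -> V) (g : V -> W) x v :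
  differentiable f x -> differentiable g (f x) ->
  'd (fun y => g (f y)) x v = 'd g (f x) ('d f x v).
Proof. by move=> df dg; exact: (congr1 (fun k => k v) (diff_comp df dg)). Qed.

Lemma differentiable_of_comp {U V W : normedModType (C R)} (f : U -> V) (g : V -> W) x :
  differentiable f x -> differentiable g (f x) -> differentiable (fun y => g (f y)) x.
Proof. exact: differentiable_comp. Qed.

Lemma holo_bounded_by1 D (h : 'rV[C R]_d -> C R) z : open D -> D z ->
  (forall w, D w -> differentiable h w) -> (forall w, D w -> cabs (h w) < 1) ->
  exists2 r : R, 0 < r & (forall w, nrm (w - z) < r -> differentiable h w) /\
                         (forall w, nrm (w - z) < r -> cabs (h w) <= 1).
Proof.
move=> oD Dz dh h1; have /nbhs_nrmP[r r0 hr] : nbhs z D by exact: open_nbhs_nbhs.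
by exists r => //; split=> w /hr; [exact: dh|move/h1/ltW].
Qed.

Lemma kobayashi_royden_ge0 D z X : (0 <= kobayashi_royden D z X)%E.
Proof. by apply: le_ereal_inf_tmp => _ [a _ <-]; rewrite lee_fin cabs_ge0. Qed.

(** Schwarz-Pick for [h \o phi], for each competing disc [phi]. *)
Lemma kobayashi_royden_lower D (h : 'rV[C R]_d -> C R) z X : D z ->
  (forall w, D w -> differentiable h w) -> (forall w, D w -> cabs (h w) < 1) ->
  ((cabs ('d h z X) / (1 - cabs (h z) ^+ 2))%:E <= kobayashi_royden D z X)%E.
Proof.
move=> Dz dh h1; apply: le_ereal_inf_tmp => _ [a [phi [[dphi Dphi] phi0 aX]] <-].
have d00 : @unit_disc R 0 by rewrite /unit_disc /= cabs0.
have dphi0 := dphi _ d00.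
have dhz : differentiable h (phi 0) by apply: dh; rewrite phi0.
rewrite lee_fin ler_pdivrMr; last by rewrite subr_gt0 expr_lt1// ?cabs_ge0// h1.
have E : 'd h z X = a * 'd (fun l => h (phi l)) 0 1.
  rewrite (@diff_of_comp (C R) _ _ phi h 0 1 dphi0 dhz) phi0 -aX derive1E'//.
  by rewrite linearZ.
rewrite E cabsM ler_wpM2l ?cabs_ge0//.
have -> : h z = h (phi 0) by rewrite phi0.
apply: (@schwarz_pick _ (fun l => h (phi l))) => l l1.
  by apply: differentiable_of_comp; [exact: dphi|apply: dh; exact: Dphi].
by apply: h1; exact: Dphi.
Qed.

Lemma C1_rder (c : R -> 'rV[C R]_d) t : C1_curve c -> rder c t (velocity c t).
Proof.
move=> cc; apply: rder_row => j.
- by have [[dc _] _] := cc j; rewrite derive1E; apply: derivableP; exact: dc.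
- by have [_ [dc _]] := cc j; rewrite derive1E; apply: derivableP; exact: dc.
Qed.

Lemma diff_row_sum (h : 'rV[C R]_d -> C R) z v :
  'd h z v = \sum_j v 0 j * 'd h z (delta_mx 0 j).
Proof.
rewrite [in LHS](row_sum_delta v) linear_sum; apply: eq_bigr => j _.
by rewrite linearZ.
Qed.

(** Expanding the velocity in coordinates separates its variation from that of the differential,
    whose continuity is known on fixed vectors. *)
Lemma continuous_diff_velocity (h : 'rV[C R]_d -> C R) D (c : R -> 'rV[C R]_d) t :
  open D -> (forall w, D w -> differentiable h w) -> (forall w, D w -> cabs (h w) < 1) ->
  C1_curve c -> D (c t) -> {for t, continuous (fun s => 'd h (c s) (velocity c s))}.
Proof.
move=> oD dh h1 cc Dct.
have -> : (fun s => 'd h (c s) (velocity c s)) =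
    (fun s => \sum_j velocity c s 0 j * 'd h (c s) (delta_mx 0 j)).
  by apply/funext => s; exact: diff_row_sum.
have ct : {for t, continuous c} := rder_continuous (C1_rder t cc).
have [r r0 [dr hr]] := holo_bounded_by1 oD Dct dh h1.
have cj j : {for t, continuous (fun s => velocity c s 0 j * 'd h (c s) (delta_mx 0 j))}.
  apply: continuousM.
    have -> : (fun s => velocity c s 0 j) = (fun s => (derive1 (re_coord c j) s +i* derive1 (im_coord c j) s)%C).
      by apply/funext => s; rewrite mxE.
    have [[_ c1] [_ c2]] := cc j; exact: continuous_complex (c1 t) (c2 t).
  have c3 : {for c t, continuous (fun z => 'd h z (delta_mx 0 j))}.
    exact: (@diff_vector_continuous _ _ h (c t) (delta_mx 0 j) r 1 r0 dr hr).
  exact: (@continuous_comp _ _ _ c (fun z => 'd h z (delta_mx 0 j)) t ct c3).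
have : {for t, continuous (\sum_j (fun s => velocity c s 0 j * 'd h (c s) (delta_mx 0 j)))}.
  elim/big_ind: _ => [|f g cf cg|j _]; [exact: cst_continuous|exact: continuousD cf cg|exact: cj].
rewrite (_ : \sum_j _ = (fun s => \sum_j velocity c s 0 j * 'd h (c s) (delta_mx 0 j)))//.
by apply/funext => s; rewrite fct_sumE.
Qed.

Lemma re_curve_continuous (k : R -> C R) t : {for t, continuous k} ->
  {for t, continuous (fun s => complex.Re (k s))}.
Proof.
move=> ck; apply: (@continuous_comp _ _ _ k (fun z : C R => complex.Re z)) => //.
by apply: continuous_Re; exact: cts_id.
Qed.

Lemma velocity_near (g h : R -> 'rV[C R]_d) (a b t : R) : a < t < b ->
  {in `[a, b], g =1 h} -> velocity g t = velocity h t.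
Proof.
move=> /andP[ta tb] gh; apply/rowP => j; rewrite !mxE.
have near : \forall s \near t, g s = h s.
  near=> s; apply: gh; rewrite in_itv /=; apply/andP; split; apply: ltW; near: s.
  - exact: lt_nbhsr. 
  - exact: lt_nbhsl.
by congr (_ +i* _)%C; rewrite !derive1E; apply: near_eq_derive; rewrite ?oner_neq0//;
  apply: filterS near => s; rewrite /re_coord /im_coord => ->.
Unshelve. all: by end_near. Qed.

(** With [k] rotating [h (c s)] onto the positive axis, [ath (Re (k h))] grows along the curve no
    faster than the length. Bounding all intermediate points, and not only [y], is what the lifting
    argument uses. *)
Lemma curve_lower D (h : 'rV[C R]_d -> C R) x y c (K s : R) : open D ->
  (forall w, D w -> differentiable h w) -> (forall w, D w -> cabs (h w) < 1) ->
  joins D x y c -> h x = 0 -> s \in `[0, 1] ->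
  (\int[@lebesgue_measure R]_(t in `[0%R, 1%R]) kobayashi_royden D (c t) (velocity c t) <= K%:E)%E ->
  cabs (h (c s)) <= th K.
Proof.
move=> oD dh' h1' [[n [p [p0 pn pP]]] Dc c0 c1] hx s01 intK.
have [k k1 kh] := rotate_abs (h (c s)).
pose H z := k * h z.
have dh w : D w -> differentiable H w.
  by move=> /dh' dw; exact: diffM_ (@diff_cst_ R _ k w) dw.
have h1 w : D w -> cabs (H w) < 1 by move=> /h1'; rewrite /H cabsM k1 mul1r.
pose F t := ath (complex.Re (H (c t))).
have Re1 z : D z -> `|complex.Re (H z)| < 1 by move=> /h1; apply: le_lt_trans; exact: cabs_Re.
have mono m q : (m + q <= n)%N -> p m <= p (m + q)%N.
  elim: q => [|q IH] mq; first by rewrite addn0.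
  rewrite addnS in mq *; have [/ltW pq _] := pP _ mq.
  by apply: le_trans pq; apply: IH; exact: ltnW.
have p01 i t : (i < n)%N -> p i <= t <= p i.+1 -> t \in `[0, 1].
  move=> ni /andP[ti it]; rewrite in_itv /= -p0 -pn.
  have := mono 0%N i; rewrite add0n => /(_ (ltnW ni)).
  have := mono i.+1 (n - i.+1)%N; rewrite subnKC// => /(_ (leqnn _)); lra.
have sn : p 0%N <= s <= p n by move: s01; rewrite in_itv /= p0 pn.
have := @growth R (fun t => kobayashi_royden D (c t) (velocity c t)) F n p
  (fun t => kobayashi_royden_ge0 _ _ _) _ s sn.
have growthP : forall i, (i < n)%N -> p i < p i.+1 /\ exists G g : R -> R,
    [/\ {in `[p i, p i.+1], F =1 G}, forall t, p i <= t <= p i.+1 -> is_derive t 1 G (g t),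
        forall t, p i <= t <= p i.+1 -> {for t, continuous g} &
        forall t, p i < t < p i.+1 -> (`|g t|%:E <= kobayashi_royden D (c t) (velocity c t))%E].
  move=> i ni; have [pi [e ce ge]] := pP i ni; split=> //.
  exists (fun t => ath (complex.Re (H (e t)))).
  exists (fun t => (1 - complex.Re (H (e t)) ^+ 2)^-1 * complex.Re ('d H (e t) (velocity e t))).
  have De t : p i <= t <= p i.+1 -> D (e t).
    by move=> tp; rewrite -ge ?in_itv//; apply: Dc; exact: p01 tp.
  have dRe t : p i <= t <= p i.+1 ->
      is_derive t 1 (fun t => complex.Re (H (e t))) (complex.Re ('d H (e t) (velocity e t))).
    by move=> tp; apply: rder_Re; apply: rder_chain; [exact/dh/De|exact: C1_rder].
  split.
  - by move=> t tp; rewrite /F ge.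
  - move=> t tp; have d1 := is_derive_ath (Re1 _ (De _ tp)).
    exact: (@is_derive1_comp R (@ath R) (fun t => complex.Re (H (e t))) t _ _ d1 (dRe t tp)).
  - move=> t tp; have cRe : {for t, continuous (fun t => complex.Re (H (e t)))}.
      by have [dv _] := dRe _ tp; apply: differentiable_continuous; apply/derivable1_diffP.
    apply: continuousM; last first.
      apply: re_curve_continuous; apply: (@continuous_diff_velocity _ D) => //; exact: De.
    apply: continuousV.
      by rewrite gt_eqF// subr_gt0 -real_normK ?num_real// expr_lt1// Re1//; exact: De.
    apply: continuousB; first exact: cst_continuous.
    by apply: (@continuous_comp _ _ _ _ (fun x : R => x ^+ 2)) => //; exact: exprn_continuous.
  move=> t tp; have tp' : p i <= t <= p i.+1 by case/andP: tp => t1 t2; rewrite !ltW.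
  have Dt := De _ tp'.
  rewrite (velocity_near tp ge) ge ?in_itv//.
  apply: le_trans (kobayashi_royden_lower (velocity e t) Dt dh h1); rewrite lee_fin.
  (* Taking real parts shrinks the numerator and enlarges the denominator [1 - |.|^2], so the
     Schwarz-Pick quotient dominates. *)
  have R2 : `|complex.Re (H (e t))| ^+ 2 <= cabs (H (e t)) ^+ 2.
    by rewrite ler_pXn2r ?nnegrE ?cabs_ge0// cabs_Re.
  have H2 : cabs (H (e t)) ^+ 2 < 1 by rewrite expr_lt1// ?cabs_ge0// h1.
  rewrite real_normK ?num_real// in R2.
  have E0 : 0 <= 1 - complex.Re (H (e t)) ^+ 2 by lra.
  rewrite normrM mulrC normfV (ger0_norm E0).
  apply: ler_pM => //; first by rewrite invr_ge0; lra.
    exact: cabs_Re.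
  by rewrite lef_pV2 ?posrE//; lra.
move=> /(_ growthP).
have Hs : H (c s) = rc (cabs (h (c s))) by rewrite /H kh.
have F0 : F (p 0%N) = 0 by rewrite /F p0 c0 /H hx mulr0 /= /ath addr0 subr0 subrr mul0r.
have Fs : F s = ath (cabs (h (c s))) by rewrite /F Hs.
rewrite F0 subr0 p0 Fs => lower.
have c1s : cabs (h (c s)) < 1 by apply: h1'; exact: Dc.
rewrite -[leLHS]athK; last by rewrite ger0_norm// cabs_ge0.
apply: th_mono; rewrite -lee_fin; apply: le_trans lower _; apply: le_trans intK.
move: s01; rewrite in_itv /= => /andP[s0 s1].
have -> : (`[0, 1]%classic : set R) = `[0, s] `|` `]s, 1].
  by rewrite -itv_bndbnd_setU// bnd_simp.
apply: le_trans (ge0_lower_integralU _ _ _) => //.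
- by rewrite -[leLHS]adde0 leeD2l// integral_ge0// => t _; exact: kobayashi_royden_ge0.
- by apply/disj_setPLR => t /=; rewrite !in_itv /= => /andP[_ ts] /andP[st _]; lra.
- by move=> t; exact: kobayashi_royden_ge0.
Qed.

End kobayashi_estimates.

(** * Upper bounds for the Kobayashi distance from analytic discs *)

Section kobayashi_upper.
Context {R : realType} {d : nat}.
Implicit Types (D : set 'rV[C R]_d) (f : C R -> 'rV[C R]_d).

Lemma rder_Im (k : R -> C R) (t : R) (l : C R) : rder k t l ->
  is_derive t 1 (fun s => complex.Im (k s)) (complex.Im l).
Proof.
move=> kl; apply: first_order_is_derive => e /kl[r r0 hr]; exists r => // s /hr.
apply: le_trans; apply: le_trans (cabs_Im _).
by rewrite !(cImD, cImN) -[_ *: _]/(rc (s - t) * l) cImM /= mul0r addr0 (mulrC (s - t)).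
Qed.

Lemma im_curve_continuous (k : R -> C R) t : {for t, continuous k} ->
  {for t, continuous (fun s => complex.Im (k s))}.
Proof.
move=> ck; have := @re_curve_continuous R (fun s => - 'i%C * k s) t.
have -> : (fun s => complex.Re (- 'i%C * k s)) = (fun s => complex.Im (k s)).
  by apply/funext => s; case: (k s) => a b /=; rewrite oppr0 mul0r sub0r mulN1r opprK.
have c0 : {for t, continuous (fun _ : R => (- 'i%C) : C R)} by exact: cst_continuous.
by move=> H; exact: H (continuousM c0 ck).
Qed.

Lemma is_derive_C1_real (F l : R -> R) : (forall t : R, is_derive t 1 F (l t)) ->
  continuous l -> C1_real F.
Proof.
move=> dF cl; split; first by move=> t; have [] := dF t.
have -> : derive1 F = l by apply/funext => t; rewrite derive1E; have [_ ->] := dF t.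
exact: cl.
Qed.

Lemma differentiable_component {V : normedModType (C R)} (f : V -> 'rV[C R]_d) z j : differentiable f z ->
  differentiable (fun w => f w 0 j) z.
Proof.
move=> df; apply: (@differentiable_of_comp _ _ _ _ f (fun x : 'rV[C R]_d => x 0 j)) => //.
exact: differentiable_coord.
Qed.

Lemma diff_component {V : normedModType (C R)} (f : V -> 'rV[C R]_d) z v j : differentiable f z ->
  'd (fun w => f w 0 j) z v = 'd f z v 0 j.
Proof.
move=> df; have dj := differentiable_component j df.
have dj0 : differentiable (fun w => f w 0 j) (z + 0 *: v) by rewrite scale0r addr0.
have [_ e1] := cderiv_diff (cderiv_line dj0); rewrite scale0r addr0 in e1.
suff c2 : cderiv (fun m : C R => f (z + m *: v) 0 j) 0 ('d f z v 0 j).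
  have [_ e2] := cderiv_diff c2; exact: etrans (esym e1) e2.
move=> e e0; have v1 : 0 < nrm v + 1 by rewrite ltr_wpDl// nrm_ge0.
have ev : 0 < e / (nrm v + 1) by rewrite divr_gt0.
have [r r0 hr] := diff_nrm df ev; exists (r / (nrm v + 1)); first by rewrite divr_gt0.
move=> y; rewrite subr0 ltr_pdivlMr// => yr.
have := hr (z + y *: v); rewrite addrC addKr nrmZ.
have yr' : cabs y * nrm v < r by have := cabs_ge0 y; nra.
move=> /(_ yr') H.
have E : 'd f z (y *: v) = y *: 'd f z v by rewrite linearZ.
rewrite E in H; have := le_trans (cabs_coord _ j) H.
rewrite !mxE scale0r addr0 (addrC z) (mulrC y ('d f z v 0 j)) => {}H.
apply: le_trans H _; rewrite -mulrA ler_wpM2l ?(ltW e0)// ler_pdivrMl//.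
by have := cabs_ge0 y; nra.
Qed.

Definition disc_aut (a z : C R) : C R := (z + a) / (1 + a^* * z).

Lemma disc_aut_denom (a z : C R) : cabs a < 1 -> cabs z <= 1 -> 1 + a^* * z != 0.
Proof.
move=> a1 z1; have := @mobius_denom _ (- a) z; rewrite cabsN => /(_ a1 z1).
by rewrite rmorphN mulNr opprK.
Qed.

Lemma disc_aut_lt1 (a z : C R) : cabs a < 1 -> cabs z < 1 -> cabs (disc_aut a z) < 1.
Proof.
move=> a1 z1; have dn := disc_aut_denom a1 (ltW z1).
rewrite cabsf ltr_pdivrMr ?cabs_gt0// mul1r.
rewrite -(@ltr_pXn2r _ 2)// ?nnegrE ?cabs_ge0// -subr_gt0.
have := mobius_identity (- a) z; rewrite rmorphN mulNr !opprK cabsN => ->.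
by rewrite mulr_gt0// subr_gt0 expr_lt1// cabs_ge0.
Qed.

Lemma disc_aut_diff (a z : C R) : cabs a < 1 -> cabs z <= 1 -> differentiable (disc_aut a) z.
Proof.
move=> a1 z1; have dn := disc_aut_denom a1 z1.
have d1 := diffD_ (diff_id_ z) (@diff_cst_ R (C R) a z).
have d2 := diffD_ (@diff_cst_ R (C R) 1 z) (diffM_ (@diff_cst_ R (C R) (a^*) z) (diff_id_ z)).
exact: diffM_ d1 (diffV_ (f := fun z => 1 + a^* * z) dn d2).
Qed.

Lemma disc_aut0 (a : C R) : disc_aut a 0 = a.
Proof. by rewrite /disc_aut mulr0 addr0 add0r divr1. Qed.

Lemma disc_aut_diff0 (a : C R) : cabs a < 1 -> 'd (disc_aut a) 0 1 = rc (1 - cabs a ^+ 2).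
Proof.
move=> a1; suff : cderiv (disc_aut a) 0 (rc (1 - cabs a ^+ 2)) by move=> /cderiv_diff[].
(* The remainder is [- l a^* y^2 / (1 + a^* y)], and [|y| < 1 / 2] keeps its denominator above
   [1 / 2]. *)
move=> e e0; exists (Num.min (1 / 2) (e / 2)); first by rewrite lt_min !divr_gt0.
move=> y; rewrite subr0 lt_min => /andP[y1 y2]; rewrite disc_aut0.
have dn : 1 + a^* * y != 0 by apply: disc_aut_denom => //; lra.
set l := rc (1 - cabs a ^+ 2).
have lE : l = 1 - a * a^* by rewrite mulJ_sqr -rc1 -rcN -rcD.
have -> : disc_aut a y - a - l * y = - (l * a^* * y ^+ 2) / (1 + a^* * y).
  by rewrite lE /disc_aut; field.
rewrite cabsf ler_pdivrMr ?cabs_gt0// cabsN (cabsM _ (y ^+ 2)) cabsX (cabsM l) cabsJ cabs_real.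
have a2 : cabs a ^+ 2 <= 1 by rewrite expr_le1// ?cabs_ge0// ltW.
rewrite ger0_norm ?subr_ge0//.
have dn2 : 1 / 2 <= cabs (1 + a^* * y).
  have := cabsD (1 + a^* * y) (- (a^* * y)); rewrite addrK cabs1 cabsN cabsM cabsJ.
  by have := cabs_ge0 a; have := cabs_ge0 y; nra.
have y0 := cabs_ge0 y; have a0 := cabs_ge0 a.
have h1 : (1 - cabs a ^+ 2) * cabs a * cabs y ^+ 2 <= 1 * cabs y ^+ 2.
  rewrite ler_wpM2r ?exprn_ge0//; have := exprn_ge0 2 a0; nra.
apply: le_trans h1 _; rewrite mul1r expr2.
have h2 : e * cabs y * (1 / 2) <= e * cabs y * cabs (1 + a^* * y) by rewrite ler_wpM2l// mulr_ge0// ltW.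
apply: le_trans h2; nra.
Qed.

(** The competitor is [f] recentred at [a] by a disc automorphism, whose derivative at 0 supplies
    the factor [1 - a ^+ 2]. *)
Lemma kobayashi_royden_disc_upper D f (a s : R) : holo (@unit_disc R) D f -> `|a| < 1 -> 0 <= s ->
  (kobayashi_royden D (f (rc a)) (rc (s * (1 - a ^+ 2)) *: 'd f (rc a) 1)%R <= s%:E)%E.
Proof.
move=> [df Df] a1 s0; apply: ereal_inf_lbound => /=.
have ac : cabs (rc a) < 1 by rewrite cabs_real.
have d00 : cabs (0 : C R) <= 1 by rewrite cabs0.
exists (rc s); last by rewrite cabs_real ger0_norm.
exists (fun l => f (disc_aut (rc a) l)).
have dd l : @unit_disc R l -> differentiable (fun l => f (disc_aut (rc a) l)) l.
  move=> l1; apply: differentiable_of_comp; first by apply: disc_aut_diff => //; exact: ltW.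
  by apply: df; exact: disc_aut_lt1.
split.
- by split=> // l l1; apply: Df; exact: disc_aut_lt1.
- by rewrite disc_aut0.
have dl0 : @unit_disc R 0 by rewrite /unit_disc /= cabs0.
have daf : differentiable f (disc_aut (rc a) 0) by rewrite disc_aut0; exact: df.
have E := @diff_of_comp R (C R) _ _ (disc_aut (rc a)) f 0 1 (disc_aut_diff ac d00) daf.
rewrite derive1E'; last exact: dd.
have E2 := disc_aut_diff0 ac.
have E3 : 'd f (disc_aut (rc a) 0) (rc (1 - cabs (rc a) ^+ 2)) = rc (1 - a ^+ 2) *: 'd f (rc a) 1.
  rewrite disc_aut0 cabs_real real_normK ?num_real//.
  exact: diff_scalar (df _ ac).
have E4 := etrans E (etrans (congr1 ('d f (disc_aut (rc a) 0)) E2) E3).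
apply: etrans (congr1 (fun v => rc s *: v) E4) _.
by rewrite scalerA -rcM.
Qed.

(** The radius is run through as [th (L * t)], at constant Poincare speed [L], so the integrand is
    at most [L]. Boundedness of [D] bounds the components of [f], which makes their derivatives
    continuous and the curve [C^1]. *)
Lemma kobayashi_disc_upper D f (L : R) : bounded_set D -> holo (@unit_disc R) D f -> 0 <= L ->
  (kobayashi D (f 0%R) (f (rc (th L))) <= L%:E)%E.
Proof.
move=> bD [df Df] L0.
have [M hM] : exists M : R, forall z, D z -> nrm z <= M.
  have [N [Nreal hN]] := bD; exists (complex.Re N + 1) => z Dz.
  have NE : N = rc (complex.Re N) by case: N Nreal {hN} => x y; rewrite complex_real => /eqP ->.
  have : N < rc (complex.Re N + 1) by rewrite {1}NE ltcR ltrDl.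
  move=> /hN /(_ z Dz) /=; have -> : `|z| = rc (nrm z) := nrmE z.
  by rewrite lecR.
pose a t := th (L * t).
have a1 t : `|a t| < 1 := th_lt1 _.
have ac t : @unit_disc R (rc (a t)) by rewrite /unit_disc /= cabs_real.
pose a' t := (1 - a t ^+ 2) * L.
have da (t : R) : is_derive t 1 a (a' t).
  have dL : is_derive t 1 (fun t => L * t) L.
    by apply: is_derive_eq; rewrite /GRing.scale /= mulr1.
  exact: (@is_derive1_comp R (@th R) (fun t => L * t) t _ _ (is_derive_th (L * t)) dL).
have cta : continuous a.
  by move=> t; have [dv _] := da t; apply: differentiable_continuous; apply/derivable1_diffP.
have cta' : continuous a'.
  move=> t; have c0 : {for t, continuous (fun s => a s ^+ 2)}.
    exact: (@continuous_comp _ _ _ a (fun x : R => x ^+ 2) t (cta t) (@exprn_continuous R 2 (a t))).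
  have c1 : {for t, continuous (fun _ : R => 1 : R)} by exact: cst_continuous.
  have c2 : {for t, continuous (fun _ : R => L : R)} by exact: cst_continuous.
  exact: continuousM (continuousB c1 c0) c2.
have crc (b : R -> R) t : {for t, continuous b} -> {for t, continuous (fun s => rc (b s))}.
  by move=> cb; apply: continuous_complex => //; exact: cst_continuous.
pose g t := f (rc (a t)).
pose k j (z : C R) : C R := f z 0 j.
have dk j z : @unit_disc R z -> differentiable (k j) z.
  by move=> /df; exact: differentiable_component.
pose l j t : C R := 'd (k j) (rc (a t)) (rc (a' t)).
have dg j t : rder (fun s => k j (rc (a s))) t (l j t).
  by apply: rder_chain; [exact: dk|exact: rder_real].
have lE j t : l j t = rc (a' t) * 'd (k j) (rc (a t)) 1.
  exact: diff_scalar (dk j _ (ac t)).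
have cl j : continuous (l j).
  move=> t; rewrite (_ : l j = (fun t => rc (a' t) * 'd (k j) (rc (a t)) 1)); last first.
    by apply/funext => s; exact: lE.
  have c1 : {for t, continuous (fun s => rc (a' s))} by apply: crc; exact: cta'.
  pose r := 1 - `|a t|; have r0 : 0 < r by rewrite subr_gt0.
  have rd z : nrm (z - rc (a t)) < r -> @unit_disc R z.
    rewrite -cabs_nrm /r => zr; have := cabsD (z - rc (a t)) (rc (a t)).
    by rewrite subrK cabs_real /unit_disc /=; lra.
  have c3 : {for rc (a t), continuous (fun z => 'd (k j) z 1)}.
    apply: (@diff_vector_continuous R _ (k j) (rc (a t)) 1 r M r0) => z /rd zd; first exact: dk.
    by apply: le_trans (cabs_coord _ _) _; apply: hM; exact: Df.
  have c4 : {for t, continuous (fun s => rc (a s))} by apply: crc; exact: cta.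
  exact: continuousM c1 (@continuous_comp _ _ _ (fun s => rc (a s)) (fun z => 'd (k j) z 1) t c4 c3).
have dre j (t : R) : is_derive t 1 (re_coord g j) (complex.Re (l j t)) by exact: rder_Re (dg j t).
have dim j (t : R) : is_derive t 1 (im_coord g j) (complex.Im (l j t)) by exact: rder_Im (dg j t).
have C1g : C1_curve g.
  move=> j; split; [apply: is_derive_C1_real (dre j) _|apply: is_derive_C1_real (dim j) _] => t.
    by apply: re_curve_continuous; exact: cl.
  by apply: im_curve_continuous; exact: cl.
have vg t : velocity g t = rc (L * (1 - a t ^+ 2)) *: 'd f (rc (a t)) 1.
  apply/rowP => j; rewrite !mxE -(diff_component _ j (df _ (ac t))).
  have [_ r1] := dre j t; have [_ r2] := dim j t; rewrite !derive1E r1 r2.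
  have := lE j t; rewrite /a' (mulrC _ L) => <-.
  by case: (l j t).
have jg : joins D (f 0) (f (rc (th L))) g.
  split.
  - exists 1%N, (fun i => i%:R); split=> // i; rewrite ltnS leqn0 => /eqP ->.
    by split; [exact: ltr01|exists g].
  - by move=> t _; apply: Df; exact: ac.
  - by rewrite /g /a mulr0 th0.
  - by rewrite /g /a mulr1.
apply: (@le_trans _ _ (\int[@lebesgue_measure R]_(t in `[0%R, 1%R]) kobayashi_royden D (g t) (velocity g t))%E).
  by apply: ereal_inf_lbound; exists g.
apply: (@le_trans _ _ (\int[@lebesgue_measure R]_(t in `[0%R, 1%R]) (cst L%:E) t)%E).
  apply: ge0_le_lower_integral => t _; first exact: kobayashi_royden_ge0.
  by rewrite vg; apply: kobayashi_royden_disc_upper.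
have mu01 := @lebesgue_measure_itv R `[0, 1].
rewrite integral_cst//= mu01 /= lte_fin ltr01 oppr0 adde0 mule1; exact: lexx.
Qed.

End kobayashi_upper.

(** * Hyperbolic geometry of the unit ball *)

Section ball.
Context {R : realType} {d : nat}.
Implicit Types (x y z u v w : 'rV[C R]_d) (a b : C R).

Definition hdot u v : C R := \sum_j u 0 j * (v 0 j)^*.
Definition bn2 u : R := \sum_j cabs (u 0 j) ^+ 2.

Lemma bn2_ge0 u : 0 <= bn2 u.
Proof. by apply: sumr_ge0 => j _; rewrite sqr_ge0. Qed.

Lemma bn2_0 : bn2 0 = 0.
Proof. by rewrite /bn2 big1// => j _; rewrite mxE cabs0 expr0n. Qed.

Lemma bn2_eq0 u : bn2 u = 0 -> u = 0.
Proof.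
move=> /eqP; rewrite psumr_eq0; last by move=> j _; rewrite sqr_ge0.
move=> /allP h; apply/rowP => j; rewrite mxE; have := h j; rewrite mem_index_enum => /(_ isT) /=.
by rewrite sqrf_eq0 cabs_eq0 => /eqP.
Qed.

Lemma hdotDl u v w : hdot (u + v) w = hdot u w + hdot v w.
Proof. by rewrite -big_split; apply: eq_bigr => j _; rewrite mxE mulrDl. Qed.
Lemma hdotZl a u w : hdot (a *: u) w = a * hdot u w.
Proof. by rewrite mulr_sumr; apply: eq_bigr => j _; rewrite mxE mulrA. Qed.
Lemma hdotNl u w : hdot (- u) w = - hdot u w.
Proof. by rewrite -scaleN1r hdotZl mulN1r. Qed.
Lemma hdotBl u v w : hdot (u - v) w = hdot u w - hdot v w.
Proof. by rewrite hdotDl hdotNl. Qed.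
Lemma hdotC u v : (hdot u v)^* = hdot v u.
Proof.
rewrite rmorph_sum; apply: eq_bigr => j _.
by rewrite [LHS]rmorphM [X in _ * X]conjCK mulrC.
Qed.
Lemma hdot0l v : hdot 0 v = 0. Proof. by rewrite -(scale0r 0) hdotZl mul0r. Qed.
Lemma hdotZr a u w : hdot u (a *: w) = a^* * hdot u w.
Proof.
rewrite mulr_sumr; apply: eq_bigr => j _; rewrite mxE.
by rewrite [RHS]mulrCA; congr (_ * _); exact: rmorphM.
Qed.
Lemma hdotDr u v w : hdot u (v + w) = hdot u v + hdot u w.
Proof. by rewrite -big_split; apply: eq_bigr => j _; rewrite mxE; apply: etrans (mulrDr _ _ _); congr (_ * _); exact: rmorphD. Qed.
Lemma hdotNr u w : hdot u (- w) = - hdot u w.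
Proof. by rewrite -scaleN1r hdotZr rmorphN rmorph1 mulN1r. Qed.
Lemma hdotBr u v w : hdot u (v - w) = hdot u v - hdot u w.
Proof. by rewrite hdotDr hdotNr. Qed.
Lemma hdotvv u : hdot u u = rc (bn2 u).
Proof. by rewrite /bn2 [RHS]rmorph_sum; apply: eq_bigr => j _; rewrite mulJ_sqr. Qed.

Lemma bn2E u : bn2 u = complex.Re (hdot u u). Proof. by rewrite hdotvv. Qed.

Lemma bn2_comb a b u v :
  bn2 (a *: u + b *: v) = cabs a ^+ 2 * bn2 u + cabs b ^+ 2 * bn2 v + 2 * complex.Re (a * b^* * hdot u v).
Proof.
rewrite bn2E !(hdotDl, hdotDr, hdotZl, hdotZr) !hdotvv -(hdotC u v).
case: (hdot u v) => p q; rewrite !cabs_sqr; case: a => a1 a2; case: b => b1 b2.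
rewrite !(cReD, cReM, cImM, cReJ, cImJ) /=; ring.
Qed.

Lemma bn2Z a u : bn2 (a *: u) = cabs a ^+ 2 * bn2 u.
Proof. by rewrite -[a *: u]addr0 -(scale0r u) bn2_comb cabs0 rmorph0 mulr0 mul0r /= expr0n /= mul0r mulr0 !addr0. Qed.

Lemma cauchy_schwarz u v : cabs (hdot u v) ^+ 2 <= bn2 u * bn2 v.
Proof.
set c := hdot u v; set V := bn2 v.
(* Expands to [V * (bn2 u * V - |c|^2)], so [V] is divided out only once it is known to be
   positive. *)
have := bn2_ge0 (rc V *: u + (- c) *: v); rewrite bn2_comb cabs_real cabsN -/V -/c.
have -> : complex.Re (rc V * (- c)^* * c) = - (V * cabs c ^+ 2).
  by rewrite rmorphN mulrN mulNr -mulrA (mulrC _ c) mulJ_sqr -rcM.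
have V0 : 0 <= V := bn2_ge0 _; rewrite ger0_norm// => H.
have H2 : 0 <= V * (bn2 u * V - cabs c ^+ 2) by rewrite expr2 in H; lra.
move: V0; rewrite le_eqVlt => /predU1P[V0|V0].
  have v0 : v = 0 by apply: bn2_eq0.
  by rewrite /c v0 -(hdotC 0) hdot0l rmorph0 cabs0 expr0n mulr_ge0// bn2_ge0.
by rewrite -subr_ge0 -(pmulr_rge0 _ V0).
Qed.

Lemma one_sub_hdot_neq0 u v : bn2 u < 1 -> bn2 v < 1 -> 1 - hdot u v != 0.
Proof.
move=> u1 v1; rewrite subr_eq0; apply/eqP => h; have := cauchy_schwarz u v.
by rewrite -h cabs1 expr1n; have := bn2_ge0 u; have := bn2_ge0 v; nra.
Qed.

(* The involutive automorphism of the ball exchanging 0 and [x]. *)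
Definition ball_aut x z : 'rV[C R]_d :=
  (1 - hdot z x)^-1 *:
   (x - rc (Num.sqrt (1 - bn2 x)) *: z - (hdot z x / rc (1 + Num.sqrt (1 - bn2 x))) *: x).

(** Since [1 - th^2 = 1 / ch^2], this is the formula for the squared hyperbolic cosine of the
    distance between [x] and [z]. Writing [1 / (1 + s)] for [(1 - s) / |x|^2], where
    [s^2 = 1 - |x|^2], keeps the automorphism defined at [x = 0]. *)
Lemma bn2_ball_aut x z : bn2 x < 1 -> bn2 z < 1 ->
  bn2 (ball_aut x z) = 1 - (1 - bn2 x) * (1 - bn2 z) / cabs (1 - hdot z x) ^+ 2.
Proof.
move=> x1 z1; have := one_sub_hdot_neq0 z1 x1; rewrite /ball_aut.
set s := Num.sqrt _; set c := hdot z x => c0.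
have s0 : 0 < s by rewrite sqrtr_gt0 subr_gt0.
have s2 : s ^+ 2 = 1 - bn2 x by rewrite sqr_sqrtr// subr_ge0 ltW.
have s1 : 1 + s != 0 by rewrite gt_eqF// ltr_wpDl.
have -> : x - rc s *: z - (c / rc (1 + s)) *: x = (1 - c / rc (1 + s)) *: x + (- rc s) *: z.
  by rewrite scalerBl scale1r scaleNr addrAC.
rewrite bn2Z bn2_comb cabsV exprVn cabsN -(hdotC z x) -/c -s2 -[in LHS](subKr 1 (bn2 x)) -s2.
have cc : 0 < cabs (1 - c) ^+ 2 by rewrite exprn_gt0// cabs_gt0.
have cc0 : cabs (1 - c) ^+ 2 != 0 by rewrite gt_eqF.
apply: (mulfI cc0); rewrite mulVKf// [RHS]mulrBr mulr1 [X in _ = _ - X]mulrC divfK//.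
rewrite -rcV -rcN rcJ !cabs_sqr !(cReD, cImD, cReN, cImN, cReM, cImM, cReJ, cImJ) /=.
case: (c) => p q /=; field. exact: s1.
Qed.

Lemma ball_aut_ball x z : bn2 x < 1 -> bn2 z < 1 -> bn2 (ball_aut x z) < 1.
Proof.
move=> x1 z1; rewrite bn2_ball_aut// ltrBlDr ltrDl divr_gt0//.
  by rewrite mulr_gt0// subr_gt0.
by rewrite exprn_gt0// cabs_gt0 one_sub_hdot_neq0.
Qed.

Lemma ball_aut0 x : ball_aut x 0 = x.
Proof. by rewrite /ball_aut hdot0l subr0 invr1 scale1r mul0r scale0r scaler0 !subr0. Qed.

Lemma ball_autx x : bn2 x < 1 -> ball_aut x x = 0.
Proof.
move=> x1; apply: bn2_eq0; rewrite bn2_ball_aut// hdotvv -rc1 -rcN -rcD cabs_real real_normK ?num_real//.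
by rewrite expr2 divff ?subrr// mulf_neq0// gt_eqF// subr_gt0.
Qed.

Lemma ball_autK x z : bn2 x < 1 -> bn2 z < 1 -> ball_aut x (ball_aut x z) = z.
Proof.
move=> x1 z1; have c0 := one_sub_hdot_neq0 z1 x1.
set w := ball_aut x z; set s := Num.sqrt (1 - bn2 x).
have s0 : 0 < s by rewrite sqrtr_gt0 subr_gt0.
have s2 : s ^+ 2 = 1 - bn2 x by rewrite sqr_sqrtr// subr_ge0 ltW.
have rs0 : rc s != 0 by rewrite rc_eq0 gt_eqF.
have rs1 : 1 + rc s != 0 by rewrite -rc1 -rcD rc_eq0 gt_eqF// ltr_wpDl.
set c := hdot z x in c0 *.
have wx : hdot w x = 1 - rc s ^+ 2 / (1 - c).
  rewrite /w /ball_aut hdotZl !hdotBl !hdotZl hdotvv -/s -/c.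
  have -> : rc (bn2 x) = 1 - rc s ^+ 2 by rewrite -rcX s2 -rc1 -rcN -rcD subKr.
  rewrite rcD rc1; field; by rewrite c0 rs1.
rewrite /ball_aut -/s wx subKr.
apply/rowP => j; rewrite /w /ball_aut -/c -/s !mxE rcD rc1; field.
by rewrite rs1 rs0 c0.
Qed.

(** The conjugation falls on the constant vector only. *)
Lemma differentiable_hdot {V : normedModType (C R)} (f : V -> 'rV[C R]_d) v (p : V) :
  differentiable f p -> differentiable (fun q : V => hdot (f q) v) p.
Proof.
move=> df.
have dj j : differentiable (fun q : V => f q 0 j * (v 0 j)^*) p.
  exact: diffM_ (differentiable_component j df) (@diff_cst_ R V ((v 0 j)^*) p).
have := differentiable_sum dj.
by rewrite (_ : \sum_i _ = fun q : V => hdot (f q) v)//; apply/funext => q; rewrite fct_sumE.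
Qed.

Lemma unit_ballE z : @unit_ball R d z = (bn2 z < 1) :> Prop. Proof. by []. Qed.

(** Recentre [psi] at [psi x] and apply [curve_lower] to its component along the direction [v] of
    the image of [c s], where that component equals the full norm. *)
Lemma ball_lower_curve (D : set 'rV[C R]_d) (psi : 'rV[C R]_d -> 'rV[C R]_d) x y c (K s : R) :
  open D -> holo D (@unit_ball R d) psi -> joins D x y c -> s \in `[0, 1] ->
  (\int[@lebesgue_measure R]_(t in `[0%R, 1%R]) kobayashi_royden D (c t) (velocity c t) <= K%:E)%E ->
  cabs (1 - hdot (psi (c s)) (psi x)) ^+ 2 <= ch K ^+ 2 * (1 - bn2 (psi x)) * (1 - bn2 (psi (c s))).
Proof.
move=> oD [dpsi Bpsi] jc s01 intK; have [pc Dc c0 c1] := jc.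
have Dx : D x by rewrite -c0; apply: Dc; rewrite in_itv /= lexx ler01.
have Dcs := Dc _ s01.
set a := psi x; have a1 : bn2 a < 1 by exact: Bpsi.
have b1 : bn2 (psi (c s)) < 1 by exact: Bpsi.
set w := ball_aut a (psi (c s)); pose r := Num.sqrt (bn2 w).
have r2 : r ^+ 2 = bn2 w by rewrite sqr_sqrtr// bn2_ge0.
have r0 : 0 <= r by rewrite sqrtr_ge0.
(* As [0^-1 = 0], [v] vanishes with [w]; hence a bound by 1 instead of unit length. *)
pose v := rc r^-1 *: w.
have v1 : bn2 v <= 1.
  rewrite bn2Z cabs_real -r2 -exprMn ger0_norm ?invr_ge0//.
  by have [->|rn0] := eqVneq r 0; [rewrite invr0 mul0r expr0n|rewrite mulVf// expr1n].
have wv : hdot w v = rc r.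
  rewrite hdotZr rcJ hdotvv -rcM -r2; congr rc.
  by have [->|rn0] := eqVneq r 0; [rewrite invr0 mul0r|rewrite expr2 mulKf].
pose h z := hdot (ball_aut a (psi z)) v.
have h1 z : D z -> cabs (h z) < 1.
  move=> /Bpsi pz; have w1 := ball_aut_ball a1 pz.
  rewrite -(@ltr_pXn2r _ 2)// ?nnegrE ?cabs_ge0// expr1n.
  apply: le_lt_trans (cauchy_schwarz _ _) _.
  exact: le_lt_trans (ler_piMr (bn2_ge0 _) v1) w1.
have dh z : D z -> differentiable h z.
  move=> Dz; have dz := dpsi _ Dz; have pz : bn2 (psi z) < 1 by exact: Bpsi.
  have hE : h = fun z => (1 - hdot (psi z) a)^-1 *
      (hdot a v - rc (Num.sqrt (1 - bn2 a)) * hdot (psi z) v -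
       hdot (psi z) a * (rc (1 + Num.sqrt (1 - bn2 a)))^-1 * hdot a v).
    by apply/funext => y'; rewrite /h /ball_aut hdotZl !hdotBl !hdotZl.
  rewrite hE; have cst_ k := @diff_cst_ R 'rV[C R]_d k z.
  have dv := differentiable_hdot v dz; have da := differentiable_hdot a dz.
  have dn := diffV_ (f := fun z => 1 - hdot (psi z) a) (one_sub_hdot_neq0 pz a1) (diffB_ (cst_ 1) da).
  have d1 := diffB_ (cst_ (hdot a v)) (diffM_ (cst_ (rc (Num.sqrt (1 - bn2 a)))) dv).
  have d2 := diffM_ (diffM_ da (cst_ (rc (1 + Num.sqrt (1 - bn2 a)))^-1)) (cst_ (hdot a v)).
  exact: diffM_ dn (diffB_ d1 d2).
have hx : h x = 0 by rewrite /h ball_autx// hdot0l.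
have := curve_lower oD dh h1 jc hx s01 intK.
rewrite /h -/w wv cabs_real ger0_norm// => rK.
have rK2 : bn2 w <= th K ^+ 2 by rewrite -r2 ler_pXn2r ?nnegrE//; apply: le_trans rK.
have := bn2_ball_aut a1 b1; rewrite -/w => wE.
have cp : 0 < cabs (1 - hdot (psi (c s)) a) ^+ 2.
  by rewrite exprn_gt0// cabs_gt0 one_sub_hdot_neq0.
have cK : 0 < ch K ^+ 2 by rewrite exprn_gt0// ch_gt0.
have H : (ch K ^+ 2)^-1 <= (1 - bn2 a) * (1 - bn2 (psi (c s))) / cabs (1 - hdot (psi (c s)) a) ^+ 2.
  by rewrite -onem_th2; clear -wE rK2; lra.
by move: H; rewrite ler_pdivlMr// mulrC ler_pdivrMr// mulrC mulrA.
Qed.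

(** The disc [l -> phi (ball_aut u (l *: e))] takes the values [phi u] at 0 and [phi v] at [r], so
    the distance is at most [ath r]. *)
Lemma ball_upper (D : set 'rV[C R]_d) (phi : 'rV[C R]_d -> 'rV[C R]_d) u v (K : R) :
  bounded_set D -> holo (@unit_ball R d) D phi -> bn2 u < 1 -> bn2 v < 1 -> 0 <= K ->
  (K%:E <= kobayashi D (phi u) (phi v))%E ->
  ch K ^+ 2 * (1 - bn2 u) * (1 - bn2 v) <= cabs (1 - hdot v u) ^+ 2.
Proof.
move=> bD [dphi Dphi] u1 v1 K0 Kk.
set w := ball_aut u v; pose r := Num.sqrt (bn2 w).
have w1 : bn2 w < 1 by exact: ball_aut_ball.
have r2 : r ^+ 2 = bn2 w by rewrite sqr_sqrtr// bn2_ge0.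
have r0 : 0 <= r by rewrite sqrtr_ge0.
have r1 : r < 1 by rewrite -(@ltr_pXn2r _ 2)// ?nnegrE// r2 expr1n.
pose e := rc r^-1 *: w.
have e1 : bn2 e <= 1.
  rewrite bn2Z cabs_real -r2 -exprMn ger0_norm ?invr_ge0//.
  by have [->|rn0] := eqVneq r 0; [rewrite invr0 mul0r expr0n|rewrite mulVf// expr1n].
have re : rc r *: e = w.
  rewrite /e scalerA -rcM; have [rz|rn0] := eqVneq r 0; last by rewrite mulfV// scale1r.
  by rewrite rz mul0r scale0r; apply/esym/bn2_eq0; rewrite -r2 rz expr0n.
have Be l : cabs l < 1 -> bn2 (l *: e) < 1.
  move=> l1; rewrite bn2Z; have : cabs l ^+ 2 < 1 by rewrite expr_lt1// cabs_ge0.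
  exact: le_lt_trans (ler_piMr (sqr_ge0 _) e1).
pose f l := phi (ball_aut u (l *: e)).
have hf : holo (@unit_disc R) D f.
  split=> l l1; last exact: Dphi _ (ball_aut_ball u1 (Be _ l1)).
  apply: differentiable_of_comp; last exact: dphi _ (ball_aut_ball u1 (Be _ l1)).
  pose s := rc (Num.sqrt (1 - bn2 u)); pose s' := (rc (1 + Num.sqrt (1 - bn2 u)))^-1.
  pose q (l : C R) := (1 - l * hdot e u)^-1.
  have dn : 1 - l * hdot e u != 0 by rewrite -hdotZl; exact: one_sub_hdot_neq0 (Be _ l1) u1.
  have did := diff_id_ l; have cst_ k := @diff_cst_ R (C R) k l.
  have dq : differentiable q l.
    have dnn := diffB_ (cst_ 1) (diffM_ did (cst_ (hdot e u))).
    exact: (@diffV_ R (C R) (fun l : C R => 1 - l * hdot e u) l dn dnn).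
  have fE : (fun l => ball_aut u (l *: e)) =
    (fun l : C R => (q l * (1 - l * hdot e u * s')) *: u) + (fun l : C R => (q l * (- s * l)) *: e).
    apply/funext => m; rewrite /ball_aut hdotZl -/s -/s' -/(q m) !fctE.
    rewrite -!scalerA -scalerDr; congr (_ *: _).
    by rewrite scalerBl scale1r scaleNr addrAC -scalerA -(scalerA m).
  rewrite fE; apply: differentiableD; apply: differentiableZl.
    exact: diffM_ dq (diffB_ (cst_ 1) (diffM_ (diffM_ did (cst_ (hdot e u))) (cst_ s'))).
  exact: diffM_ dq (diffM_ (cst_ (- s)) did).
have L0 : 0 <= ath r.
  by rewrite /ath divr_ge0// subr_ge0 ler_ln ?posrE; clear -r0 r1; lra.
have thL : th (ath r) = r by rewrite athK// ger0_norm.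
have := kobayashi_disc_upper bD hf L0; rewrite /f thL re scale0r ball_aut0 ball_autK// => H.
have KL : K <= ath r by rewrite -lee_fin; exact: le_trans Kk H.
have Kr : th K <= r by rewrite -thL; exact: th_mono.
have Kr2 : th K ^+ 2 <= bn2 w by rewrite -r2 ler_pXn2r ?nnegrE ?th_ge0.
have := bn2_ball_aut u1 v1; rewrite -/w => wE.
have cp : 0 < cabs (1 - hdot v u) ^+ 2.
  by rewrite exprn_gt0// cabs_gt0 one_sub_hdot_neq0.
have cK : 0 < ch K ^+ 2 by rewrite exprn_gt0// ch_gt0.
have : (1 - bn2 u) * (1 - bn2 v) / cabs (1 - hdot v u) ^+ 2 <= (ch K ^+ 2)^-1.
  by rewrite -onem_th2; clear -wE Kr2; lra.
by rewrite ler_pdivrMr// ler_pdivlMl// mulrA.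
Qed.

End ball.

(** * Self-maps of the ball with Jacobian of modulus close to 1 *)

Section near_isometry.
Context {R : realType} {d : nat}.
Implicit Types (u v w x : 'rV[C R]_d) (a b : C R) (F : 'rV[C R]_d -> 'rV[C R]_d).

Definition bnorm u : R := Num.sqrt (bn2 u).

Lemma bnorm_ge0 u : 0 <= bnorm u. Proof. exact: sqrtr_ge0. Qed.
Lemma bnorm_sqr u : bnorm u ^+ 2 = bn2 u. Proof. by rewrite sqr_sqrtr// bn2_ge0. Qed.
Lemma bnorm_lt1 u : bn2 u < 1 -> bnorm u < 1.
Proof. by move=> u1; rewrite -(@ltr_pXn2r _ 2)// ?nnegrE ?bnorm_ge0// bnorm_sqr expr1n. Qed.
Lemma bnorm_le u (r : R) : 0 <= r -> bn2 u <= r ^+ 2 -> bnorm u <= r.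
Proof. by move=> r0 ur; rewrite -(@ler_pXn2r _ 2)// ?nnegrE ?bnorm_ge0// bnorm_sqr. Qed.

Lemma direction u : exists2 e : 'rV[C R]_d, bn2 e <= 1 &
  rc (bnorm u) *: e = u /\ hdot u e = rc (bnorm u).
Proof.
exists (rc (bnorm u)^-1 *: u).
  rewrite bn2Z cabs_real -bnorm_sqr -exprMn ger0_norm ?invr_ge0 ?bnorm_ge0//.
  by have [->|rn0] := eqVneq (bnorm u) 0; [rewrite invr0 mul0r expr0n|rewrite mulVf// expr1n].
split.
  rewrite scalerA -rcM; have [rz|rn0] := eqVneq (bnorm u) 0; last by rewrite mulfV// scale1r.
  by rewrite rz mul0r scale0r; apply/esym/bn2_eq0; rewrite -bnorm_sqr rz expr0n.
rewrite hdotZr rcJ hdotvv -rcM -bnorm_sqr; congr rc.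
by have [->|rn0] := eqVneq (bnorm u) 0; [rewrite invr0 mul0r|rewrite expr2 mulKf].
Qed.

Lemma hdot_le u v (r s : R) : 0 <= r -> 0 <= s -> bn2 u <= r ^+ 2 -> bn2 v <= s ^+ 2 ->
  cabs (hdot u v) <= r * s.
Proof.
move=> r0 s0 ur vs; rewrite -(@ler_pXn2r _ 2)// ?nnegrE ?cabs_ge0 ?mulr_ge0//.
apply: le_trans (cauchy_schwarz _ _) _; rewrite exprMn.
by apply: ler_pM => //; exact: bn2_ge0.
Qed.

Lemma bn2D_le u v : bn2 (u + v) <= 2 * bn2 u + 2 * bn2 v.
Proof.
have := bn2_comb 1 1 u v; have := bn2_comb 1 (- 1) u v.
rewrite !scale1r cabsN cabs1 expr1n rmorph1 rmorphN rmorph1 mulr1 !mul1r mulN1r cReN.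
by have := bn2_ge0 (u + -1 *: v); lra.
Qed.

Lemma diff_hdot {V : normedModType (C R)} (f : V -> 'rV[C R]_d) w (p q : V) : differentiable f p ->
  'd (fun y : V => hdot (f y) w) p q = hdot ('d f p q) w.
Proof.
move=> df; have dj := differentiable_hdot w df.
have dj0 : differentiable (fun y : V => hdot (f y) w) (p + 0 *: q) by rewrite scale0r addr0.
have [_ e1] := cderiv_diff (cderiv_line dj0); rewrite scale0r addr0 in e1.
suff c2 : cderiv (fun m : C R => hdot (f (p + m *: q)) w) 0 (hdot ('d f p q) w).
  have [_ e2] := cderiv_diff c2; exact: etrans (esym e1) e2.
move=> e e0; pose K := 1 + \sum_j cabs (w 0 j).
have S0 : 0 <= \sum_j cabs (w 0 j) by apply: sumr_ge0 => j _; exact: cabs_ge0.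
have K0 : 0 < K by rewrite /K; lra.
have hK x : cabs (hdot x w) <= K * nrm x.
  have : cabs (hdot x w) <= \sum_j cabs (w 0 j) * nrm x.
    rewrite /hdot; elim/big_ind2: _ => [|x1 x2 y1 y2 h1 h2|j _]; first by rewrite cabs0.
      exact: le_trans (cabsD _ _) (lerD h1 h2).
    by rewrite cabsM cabsJ mulrC ler_wpM2l ?cabs_ge0// cabs_coord.
  by rewrite -mulr_suml /K mulrDl mul1r; have := nrm_ge0 x; lra.
have v1 : 0 < nrm q + 1 by rewrite ltr_wpDl// nrm_ge0.
have ev : 0 < e / K / (nrm q + 1) by rewrite !divr_gt0.
have [r r0 hr] := diff_nrm df ev; exists (r / (nrm q + 1)); first by rewrite divr_gt0.
move=> y; rewrite subr0 ltr_pdivlMr// => yr.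
have := hr (p + y *: q); rewrite addrC addKr nrmZ.
have yr' : cabs y * nrm q < r by have := cabs_ge0 y; nra.
move=> /(_ yr') H.
have E : 'd f p (y *: q) = y *: 'd f p q by rewrite linearZ.
rewrite E in H; rewrite scale0r addr0.
have -> : hdot (f (p + y *: q)) w - hdot (f p) w - hdot ('d f p q) w * y =
    hdot (f (p + y *: q) - f p - y *: 'd f p q) w.
  by rewrite !hdotBl hdotZl (mulrC y).
apply: le_trans (hK _) _; apply: le_trans (ler_wpM2l (ltW K0) H) _.
have -> : K * (e / K / (nrm q + 1) * (cabs y * nrm q)) = e * (cabs y * (nrm q / (nrm q + 1))).
  by field; rewrite !gt_eqF.
rewrite ler_wpM2l ?(ltW e0)// ler_piMr ?cabs_ge0// ler_pdivrMr//; lra.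
Qed.

Section det.
Local Open Scope sesquilinear_scope.

Lemma hdot_mulmx u v : hdot u v = (u *m v ^t*) 0 0.
Proof. by rewrite mxE; apply: eq_bigr => j _; rewrite !mxE. Qed.

Lemma hdot_mulmxl (J : 'M[C R]_d) u v : hdot (u *m J) v = hdot u (v *m J ^t*).
Proof. by rewrite !hdot_mulmx trmx_mul map_mxM trmxCK mulmxA. Qed.

(* The eigenvalues of [J J^*] lie in [0, 1] and their product is [|det J|^2]. *)
Lemma det_near_isometry (J : 'M[C R]_d) (e : R) : (forall v, bn2 (v *m J) <= bn2 v) ->
  1 - e <= cabs (\det J) ^+ 2 -> forall v, (1 - e) * bn2 v <= bn2 (v *m J).
Proof.
move=> Jle detJ v; pose H := J *m J ^t*.
have HC : H ^t* = H by rewrite /H trmx_mul map_mxM trmxCK.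
have Hn : H \is normalmx by apply/normalmxP; rewrite HC.
have /orthomx_spectralP := Hn.
set P := spectralmx H; set D := spectral_diag H => HE.
have Pu : P \is unitarymx := spectral_unitarymx H.
have PV : invmx P = P ^t* := invmx_unitary Pu.
have PPt : P *m P ^t* = 1%:M by apply/unitarymxP.
have PtP : P ^t* *m P = 1%:M by rewrite -PV mulVmx// unitarymx_unit.
have key y : rc (bn2 (y *m J)) = \sum_j D 0 j * rc (cabs ((y *m P ^t*) 0 j) ^+ 2).
  rewrite -hdotvv hdot_mulmx.
  rewrite (_ : (y *m J) *m (y *m J) ^t* = (y *m P ^t*) *m diag_mx D *m (y *m P ^t*) ^t*).
    rewrite mxE; apply: eq_bigr => j _; rewrite mul_mx_diag !mxE -mulJ_sqr.
    by rewrite [RHS]mulrA (mulrC (D 0 j)).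
  rewrite !trmx_mul !map_mxM trmxCK !mulmxA; congr (_ *m _).
  by rewrite -!mulmxA; congr (_ *m _); rewrite [RHS]mulmxA -PV; exact: HE.
have uni (Q : 'M[C R]_d) y : Q *m Q ^t* = 1%:M -> bn2 (y *m Q) = bn2 y.
  by move=> QQ; apply: rc_inj; rewrite -!hdotvv hdot_mulmxl -mulmxA QQ mulmx1.
have uniP y : bn2 (y *m P) = bn2 y by exact: uni.
have uniPt y : bn2 (y *m P ^t*) = bn2 y by apply: uni; rewrite trmxCK.
(* Row [j] of [P] is a unit eigenvector of [H], so its image under [J] has squared length equal to
   the eigenvalue, which is therefore real and in [[0, 1]]. *)
pose del j : R := bn2 (delta_mx 0 j *m P *m J).
have DE j : D 0 j = rc (del j).
  rewrite /del key -mulmxA PPt mulmx1 (bigD1 j)//= !mxE !eqxx cabs1 expr1n mulr1.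
  rewrite big1 ?addr0// => k kj; rewrite !mxE (negbTE kj) andbF cabs0 expr0n mulr0//.
have bn_delta j : bn2 (delta_mx 0 j) = 1.
  rewrite /bn2 (bigD1 j)//= !mxE !eqxx cabs1 expr1n big1 ?addr0// => k kj.
  by rewrite !mxE (negbTE kj) andbF cabs0 expr0n.
have del0 j : 0 <= del j := bn2_ge0 _.
have del1 j : del j <= 1 by rewrite /del; apply: le_trans (Jle _) _; rewrite uniP bn_delta.
have prodE : \prod_j del j = cabs (\det J) ^+ 2.
  apply: rc_inj; rewrite -mulJ_sqr.
  have -> : \det J * (\det J)^* = \det H by rewrite /H det_mulmx det_map_mx det_tr.
  rewrite HE !det_mulmx det_inv mulrAC mulVr ?mul1r; last first.
    by rewrite -unitmxE; exact: unitarymx_unit.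
  rewrite det_diag [LHS]rmorph_prod; apply: eq_bigr => j _; by rewrite DE.
(* The other factors being at most 1, each one is at least the whole product. *)
have delj j : 1 - e <= del j.
  apply: le_trans detJ _; rewrite -prodE (bigD1 j)//= ler_piMr//.
  by apply: prodr_ile1 => k _; rewrite del0 del1.
have -> : bn2 (v *m J) = \sum_j del j * cabs ((v *m P ^t*) 0 j) ^+ 2.
  apply: rc_inj; rewrite key [RHS]rmorph_sum; apply: eq_bigr => j _.
  by rewrite DE -rcM.
rewrite -(uniPt v) /bn2 mulr_sumr; apply: ler_sum => j _.
by rewrite ler_wpM2r// sqr_ge0.
Qed.

End det.

(** Polarisation: [J] loses at most the fraction [e] of [bn2 (u + v)] and increases no
    [bn2 (u - v)]. A rotation of [u] passes from real parts to moduli. *)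
Lemma near_isometry_hdot (J : 'M[C R]_d) (e : R) : (forall v, bn2 (v *m J) <= bn2 v) ->
  (forall v, (1 - e) * bn2 v <= bn2 (v *m J)) -> forall u v,
  cabs (hdot u v - hdot (u *m J) (v *m J)) <= e * ((bn2 u + bn2 v) / 2).
Proof.
move=> J1 Je.
have key u v : complex.Re (hdot u v - hdot (u *m J) (v *m J)) <= e * ((bn2 u + bn2 v) / 2).
  have pol x y : 4 * complex.Re (hdot x y) = bn2 (x + y) - bn2 (x - y).
    have := bn2_comb 1 1 x y; have := bn2_comb 1 (- 1) x y.
    rewrite !scale1r scaleN1r cabsN cabs1 expr1n rmorph1 rmorphN rmorph1 mulr1 !mul1r mulN1r cReN.
    by lra.
  rewrite cReD cReN; have := pol u v; have := pol (u *m J) (v *m J).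
  rewrite -mulmxDl -mulmxBl.
  have par : bn2 (u + v) + bn2 (u - v) = 2 * bn2 u + 2 * bn2 v.
    have := bn2_comb 1 1 u v; have := bn2_comb 1 (- 1) u v.
    rewrite !scale1r scaleN1r cabsN cabs1 expr1n rmorph1 rmorphN rmorph1 mulr1 !mul1r mulN1r cReN.
    by lra.
  have h1 := J1 (u - v); have h2 := Je (u + v).
  have e0 : 0 <= e * bn2 (u - v) by have := Je (u - v); clear -h1; lra.
  have -> : e * ((bn2 u + bn2 v) / 2) = e * (bn2 (u + v) + bn2 (u - v)) / 4 by rewrite par; field.
  move: h1 h2 e0; clear; move: (bn2 ((u + v) *m J)) (bn2 ((u - v) *m J)) (bn2 (u + v)) (bn2 (u - v)).
  move: (complex.Re (hdot u v)) (complex.Re (hdot (u *m J) (v *m J))) => x1 x2 x3 x4 x5 x6; lra.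
move=> u v; have [k k1 kz] := rotate_abs (hdot u v - hdot (u *m J) (v *m J)).
have := key (k *: u) v; rewrite -scalemxAl !hdotZl -mulrBr kz bn2Z k1 expr1n mul1r.
exact: le_trans.
Qed.

Section self_map.
Variables (F : 'rV[C R]_d -> 'rV[C R]_d).
Hypothesis hF : holo (@unit_ball R d) (@unit_ball R d) F.
Hypothesis F0 : F 0 = 0.
Local Notation A := ('d F 0).

Let dF z : bn2 z < 1 -> differentiable F z. Proof. exact: hF.1. Qed.
Let BF z : bn2 z < 1 -> bn2 (F z) < 1. Proof. exact: hF.2. Qed.
Let B0 : bn2 (0 : 'rV[C R]_d) < 1. Proof. by rewrite bn2_0. Qed.

Let slice_ball (l : C R) u : cabs l < 1 -> bn2 u <= 1 -> bn2 (l *: u) < 1.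
Proof.
move=> l1 u1; rewrite bn2Z; have : cabs l ^+ 2 < 1 by rewrite expr_lt1// cabs_ge0.
by have := exprn_ge0 2 (cabs_ge0 l); have := bn2_ge0 u; nra.
Qed.

(** Restricted to a complex line and tested against a vector, [F] becomes a function of one variable
    to which the Schwarz lemmas apply. *)
Let slice u w (l : C R) : C R := hdot (F (l *: u)) w.

Let slice_diff u w (l : C R) : bn2 u <= 1 -> cabs l < 1 -> differentiable (slice u w) l.
Proof.
move=> u1 l1; apply: differentiable_hdot; apply: differentiable_of_comp; last exact/dF/slice_ball.
exact: differentiableZl.
Qed.

Let slice_le1 u w l : bn2 u <= 1 -> bn2 w <= 1 -> cabs l < 1 -> cabs (slice u w l) <= 1.
Proof.
move=> u1 w1 l1; rewrite -[1]mulr1; apply: hdot_le; rewrite ?ler01 ?expr1n//.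
exact/ltW/BF/slice_ball.
Qed.

Let slice0 u w : slice u w 0 = 0.
Proof. by rewrite /slice scale0r F0 hdot0l. Qed.

Let slice_deriv u w : 'd (slice u w) 0 1 = hdot (A u) w.
Proof.
have d0 : differentiable F (0 + 0 *: u) by rewrite scale0r addr0; exact: dF.
have dh0 : differentiable (fun y => hdot (F y) w) (0 + 0 *: u) by exact: differentiable_hdot.
have c := cderiv_line dh0; rewrite scale0r addr0 in c.
rewrite (_ : (fun m : C R => hdot (F (0 + m *: u)) w) = slice u w) in c; last first.
  by apply/funext => m; rewrite add0r.
have [_ e1] := cderiv_diff c.
exact: etrans e1 (diff_hdot w u (dF B0)).
Qed.

Lemma ball_schwarz u : bn2 u < 1 -> bn2 (F u) <= bn2 u.
Proof.
move=> u1; have [e e1 [ue _]] := direction u; have [w w1 [_ fw]] := direction (F u).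
have r1 := bnorm_lt1 u1.
have := schwarz_le ltr01 (fun l l1 => slice_diff w e1 l1) (fun l l1 => slice_le1 e1 w1 l1) (slice0 e w).
move=> /(_ (rc (bnorm u))); rewrite cabs_real ger0_norm ?bnorm_ge0// => /(_ r1).
rewrite /slice ue fw cabs_real ger0_norm ?bnorm_ge0// divr1 mul1r => H.
by rewrite -!bnorm_sqr ler_pXn2r ?nnegrE ?bnorm_ge0.
Qed.

Lemma ball_schwarz_diff u : bn2 (A u) <= bn2 u.
Proof.
have [e e1 [ue _]] := direction u; have [w w1 [_ fw]] := direction (A e).
have := schwarz_diff ltr01 (fun l l1 => slice_diff w e1 l1) (fun l l1 => slice_le1 e1 w1 l1) (slice0 e w).
rewrite (slice_deriv e w) fw cabs_real ger0_norm ?bnorm_ge0// divr1 => H.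
have -> : A u = rc (bnorm u) *: A e by rewrite -{1}ue linearZ.
rewrite bn2Z cabs_real ger0_norm ?bnorm_ge0// bnorm_sqr -[leRHS]mulr1 ler_wpM2l ?bn2_ge0//.
by rewrite -bnorm_sqr expr_le1// bnorm_ge0.
Qed.

Variable e : R.
Hypothesis e0 : 0 < e.
Hypothesis e2 : e <= 1 / 2.
Hypothesis Ae : forall u, (1 - e) * bn2 u <= bn2 (A u).

(** For [v] the direction of [u] and [w] that of [A v], the slice has derivative [|A v| >= 1 - e] at
    0, so rigidity gives [hdot (F u) w] close to [|u|]. As [F u] is no longer than [u], it must be
    close to [|u| w], hence to [A u]. *)
Lemma self_map_near_linear (r : R) u : 0 <= r -> r < 1 -> bn2 u <= r ^+ 2 ->
  bn2 (F u - A u) <= 35 * e / (1 - r).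
Proof.
move=> r0 r1 ur; have [e0' e2'] := (e0, e2).
have ur1 : bnorm u <= r by exact: bnorm_le.
have u1 : bn2 u < 1 by apply: le_lt_trans ur _; rewrite expr_lt1.
have t0 : 0 <= 35 * e / (1 - r) by rewrite divr_ge0 ?mulr_ge0 ?subr_ge0 ?ltW.
have [un0|un0] := eqVneq u 0; first by rewrite un0 F0 linear0 subr0 bn2_0.
have [v v1 [uv uvd]] := direction u; have [w w1 [wA fw]] := direction (A v).
have bu0 : bnorm u != 0.
  by apply/eqP => bz; move/eqP: un0; apply; apply: bn2_eq0; rewrite -bnorm_sqr bz expr0n.
have v1E : bn2 v = 1.
  have := bnorm_sqr u; rewrite -{2}uv bn2Z cabs_real ger0_norm ?bnorm_ge0// => h.
  by apply: (mulfI (expf_neq0 2 bu0)); rewrite mulr1 -h.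
pose c := bnorm (A v).
have c1 : c <= 1 by apply: bnorm_le; rewrite ?ler01// expr1n -v1E; exact: ball_schwarz_diff.
have ce : 1 - e <= c.
  have := Ae v; rewrite v1E mulr1 -bnorm_sqr -/c expr2; have : 0 <= c := bnorm_ge0 _; nra.
pose l := rc (bnorm u); have lE : cabs l = bnorm u by rewrite cabs_real ger0_norm ?bnorm_ge0.
have := @schwarz_rigidity R (slice v w) c e r (fun l l1 => slice_diff w v1 l1)
  (fun l l1 => slice_le1 v1 w1 l1) (slice0 v w) (etrans (slice_deriv v w) fw) e0 e2 ce r1 l.
rewrite lE => /(_ ur1); set tau := 7 * e / (1 - r); rewrite /slice uv -/l => G.
have tauE : e <= tau / 7.
  have -> : tau / 7 = e / (1 - r) by rewrite /tau; field; rewrite gt_eqF ?subr_gt0.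
  by rewrite ler_pdivlMr ?subr_gt0//; nra.
have Au : A u = l *: A v by rewrite -{1}uv linearZ.
have -> : F u - A u = (F u - l *: w) + (l *: w - A u) by rewrite addrA subrK.
(* At most [2 |u|^2 - 2 |u| Re (hdot (F u) w)], and rigidity puts that real part above
   [|u| - tau]. *)
have B1 : bn2 (F u - l *: w) <= 2 * tau.
  have := bn2_comb 1 (- l) (F u) w; rewrite scale1r scaleNr cabs1 cabsN expr1n mul1r lE => ->.
  have Re1 : complex.Re (1 * (- l)^* * hdot (F u) w) = - bnorm u * complex.Re (hdot (F u) w).
    by rewrite mul1r -rcN (rcJ (- bnorm u)) cReM /= mul0r subr0.
  rewrite Re1; have := le_trans (cabs_Re _) G; rewrite cReD cReN ler_norml /= => /andP[G1 G2].
  have := ball_schwarz u1; rewrite -(bnorm_sqr u).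
  have b0 := bnorm_ge0 u; have := bn2_ge0 w; rewrite expr2; nra.
have B2 : bn2 (l *: w - A u) <= e ^+ 2.
  have -> : l *: w - A u = (l * rc (1 - c)) *: w.
    by rewrite Au -{1}wA -/c -scalerA rcD rcN rc1 -scalerBr scalerBl scale1r.
  rewrite bn2Z cabsM lE cabs_real exprMn.
  have k1 : bnorm u ^+ 2 <= 1 by rewrite expr_le1 ?bnorm_ge0//; lra.
  have k2 : `|1 - c| ^+ 2 <= e ^+ 2.
    by rewrite ger0_norm ?subr_ge0// ler_pXn2r ?nnegrE ?subr_ge0 ?(ltW e0)//; lra.
  have k3 : bnorm u ^+ 2 * `|1 - c| ^+ 2 <= 1 * e ^+ 2 by apply: ler_pM => //; exact: sqr_ge0.
  rewrite -[leRHS]mul1r -[leRHS]mulr1; apply: ler_pM => //; last exact: bn2_ge0.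
  by rewrite mulr_ge0// sqr_ge0.
apply: le_trans (bn2D_le _ _) _.
have -> : 35 * e / (1 - r) = 5 * tau by rewrite /tau; field; rewrite gt_eqF// subr_gt0.
rewrite expr2 in B2; nra.
Qed.

Lemma self_map_hdot (r : R) (u v : 'rV[C R]_d) (rho : R) : 0 <= r -> r < 1 -> 0 <= rho ->
  35 * e / (1 - r) <= rho ^+ 2 -> bn2 u <= r ^+ 2 -> bn2 v <= r ^+ 2 ->
  cabs (hdot (F u) (F v) - hdot u v) <= e + 2 * rho.
Proof.
move=> r0 r1 rho0 hr ur vr.
have r21 : r ^+ 2 < 1 by rewrite expr_lt1.
have Fu := le_trans (self_map_near_linear r0 r1 ur) hr.
have Fv := le_trans (self_map_near_linear r0 r1 vr) hr.
have AE x : A x = x *m 'J F 0 by rewrite /jacobian mul_rV_lin1.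
have := @near_isometry_hdot ('J F 0) e _ _ u v; rewrite -!AE => H.
have {}H : cabs (hdot u v - hdot (A u) (A v)) <= e * ((bn2 u + bn2 v) / 2).
  by apply: H => x; rewrite -AE; [exact: ball_schwarz_diff|exact: Ae].
have -> : hdot (F u) (F v) - hdot u v = hdot (F u - A u) (F v) + hdot (A u) (F v - A v)
   - (hdot u v - hdot (A u) (A v)) by rewrite hdotBl hdotBr; ring.
have h1 : cabs (hdot (F u - A u) (F v)) <= rho * 1.
  apply: hdot_le => //; rewrite expr1n; apply: ltW; apply: BF; exact: le_lt_trans vr r21.
have h2 : cabs (hdot (A u) (F v - A v)) <= 1 * rho.
  apply: hdot_le => //; rewrite expr1n; apply: le_trans (ball_schwarz_diff _) _; lra.
apply: le_trans (cabsD _ _) _; rewrite cabsN; have := cabsD (hdot (F u - A u) (F v)) (hdot (A u) (F v - A v)).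
have := e0; nra.
Qed.

(** A Cauchy estimate for [F - A], which is at most [rho] on the ball of radius [r]. If ['d F u]
    killed [v], then [|A v| <= |v| / 2], too short for a near isometry. *)
Lemma self_map_diff_inj (r s : R) (u v : 'rV[C R]_d) (rho : R) : 0 <= s -> s < r -> r < 1 -> 0 <= rho ->
  35 * e / (1 - r) <= rho ^+ 2 -> 4 * rho <= r - s -> bn2 u <= s ^+ 2 ->
  'd F u v = 0 -> v = 0.
Proof.
move=> s0 sr r1 rho0 hr rs us dv0; apply: contrapT => /eqP vn0.
have bv : 0 < bnorm v.
  rewrite lt_neqAle bnorm_ge0 andbT eq_sym; apply/eqP => bz; move/eqP: vn0; apply.
  by apply: bn2_eq0; rewrite -bnorm_sqr bz expr0n.
have s1 : s < 1 := lt_trans sr r1.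
have u1 : bn2 u < 1 by apply: le_lt_trans us _; rewrite expr_lt1.
have XE : 'd F u v - A v = - A v := etrans (congr1 (fun x => x - A v) dv0) (sub0r _).
have [w w1 [_ ww]] := direction (- A v).
have XW : hdot ('d F u v) w - hdot (A v) w = rc (bnorm (- A v)) :=
  etrans (esym (hdotBl _ _ _)) (etrans (congr1 (fun x => hdot x w) XE) ww).
pose t := (r - s) / bnorm v; have t0 : 0 < t by rewrite divr_gt0// subr_gt0.
have inr l : cabs l < t -> bn2 (u + l *: v) <= r ^+ 2.
  rewrite /t ltr_pdivlMr// => lt; have := bn2_comb 1 l u v; rewrite scale1r cabs1 expr1n mul1r => ->.
  have := le_trans (ler_norm _) (cabs_Re (1 * l^* * hdot u v)).
  rewrite cabsM cabsM cabs1 mul1r cabsJ.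
  have := @hdot_le u v s (bnorm v) s0 (bnorm_ge0 _) us; rewrite -bnorm_sqr lexx => /(_ isT) hd.
  have l0 := cabs_ge0 l; have b0 := bnorm_ge0 v => Hre.
  have h1 : cabs l * cabs (hdot u v) <= cabs l * (s * bnorm v) by rewrite ler_wpM2l.
  rewrite -exprMn; set a := cabs l * bnorm v in lt *.
  have h2 : cabs l * (s * bnorm v) = s * a by rewrite /a; ring.
  have a0 : 0 <= a by rewrite mulr_ge0.
  have h3 : (s + a) ^+ 2 <= r ^+ 2 by rewrite ler_pXn2r ?nnegrE//; lra.
  rewrite !expr2 in us h3 *; lra.
have r0 : 0 <= r by lra.
have inB l : cabs l < t -> bn2 (u + l *: v) < 1.
  by move=> /inr h; apply: le_lt_trans h _; rewrite expr_lt1.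
pose g (l : C R) := hdot (F (u + l *: v)) w - hdot (A (u + l *: v)) w.
have dA z : differentiable (A : 'rV[C R]_d -> 'rV[C R]_d) z.
  by apply: linear_differentiable; exact: diff_continuous (dF B0).
have cg l : cabs l < t -> cderiv g l (hdot ('d F (u + l *: v) v) w - hdot (A v) w).
  move=> lt; have d1 := dF (inB _ lt).
  have c1 := cderiv_line (differentiable_hdot w d1).
  have c2 := cderiv_line (differentiable_hdot w (dA (u + l *: v))).
  have c3 := cderivB c1 c2.
  have dlin : 'd A (u + l *: v) v = A v.
    exact: (congr1 (fun k => k v) (diff_lin (u + l *: v) (diff_continuous (dF B0)))).
  have E1 := diff_hdot w v d1.
  have E2 := etrans (diff_hdot w v (dA (u + l *: v))) (congr1 (fun x => hdot x w) dlin).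
  exact: (eq_ind _ (cderiv g l) c3 _ (congr2 (fun a b => a - b) E1 E2)).
have t0' : cabs (0 : C R) < t by rewrite cabs0.
have := @schwarz_diff R (fun l => g l - g 0) t (2 * rho) t0.
have gle l : cabs l < t -> cabs (g l) <= rho.
  move=> lt; rewrite /g -hdotBl -[rho]mulr1; apply: hdot_le; rewrite ?expr1n//.
  by apply: le_trans hr; apply: self_map_near_linear => //; exact: inr.
move=> H; have {}H : cabs ('d (fun l => g l - g 0) 0 1) <= 2 * rho / t.
  apply: H; last by rewrite subrr.
    move=> l lt; have [dg _] := cderiv_diff (cg _ lt); exact: diffB_ dg (@diff_cst_ R (C R) (g 0) l).
  move=> l lt; apply: le_trans (cabsD _ _) _; rewrite cabsN.
  by rewrite mulr_natl mulr2n; exact: lerD (gle _ lt) (gle _ t0').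
have [_ dE] := cderiv_diff (cderivB (cg _ t0') (cderiv_cst (g 0) 0)).
rewrite scale0r addr0 subr0 in dE.
have {}H : bnorm (- A v) <= 2 * rho / t.
  have E := etrans (congr1 (@cabs R) (etrans dE XW)) (cabs_real (bnorm (- A v))).
  rewrite ger0_norm ?bnorm_ge0// in E.
  exact: (eq_ind _ (fun k => k <= 2 * rho / t) H _ E).
have nA : bnorm (- A v) ^+ 2 = bn2 (A v) by rewrite bnorm_sqr -scaleN1r bn2Z cabsN cabs1 expr1n mul1r.
have := Ae v; rewrite -nA -bnorm_sqr.
have Hb : bnorm (- A v) <= 1 / 2 * bnorm v.
  apply: le_trans H _; rewrite ler_pdivrMr//.
  have -> : 1 / 2 * bnorm v * t = (r - s) / 2 by rewrite /t; field; rewrite gt_eqF.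
  lra.
have := bnorm_ge0 (- A v); have := e2; rewrite !expr2; nra.
Qed.

End self_map.

End near_isometry.

(** * Lifting points through maps from the ball *)

Section lifting.
Context {R : realType} {d : nat}.
Implicit Types (u v w x y : 'rV[C R]_d).

Lemma continuous_bn2 : continuous (@bn2 R d).
Proof.
move=> u; have : {for u, continuous (\sum_j (fun v : 'rV[C R]_d => cabs (v 0 j) ^+ 2))}.
  elim/big_ind: _ => [|f g cf cg|j _]; [exact: cst_continuous|exact: continuousD cf cg|].
  have c1 : {for u, continuous (fun v : 'rV[C R]_d => v 0 j)} by exact: coord_continuous.
  have c2 := @continuous_comp _ _ _ (fun v : 'rV[C R]_d => v 0 j) (@cabs R) u c1 (@continuous_cabs R _).
  exact: (@continuous_comp _ _ _ (fun v : 'rV[C R]_d => cabs (v 0 j)) (fun t : R => t ^+ 2) u c2 (@exprn_continuous R 2 _)).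
rewrite (_ : \sum_j _ = @bn2 R d)//.
by apply/funext => v; rewrite fct_sumE.
Qed.

Lemma compact_cball (s : R) : 0 <= s -> compact [set u : 'rV[C R]_d | bn2 u <= s ^+ 2].
Proof.
move=> s0; apply: (@subclosed_compact _ _ [set u : 'rV[C R]_d | forall j, cabs (u ord0 j) <= s]).
- have -> : [set u : 'rV[C R]_d | bn2 u <= s ^+ 2] = @bn2 R d @^-1` [set t | t <= s ^+ 2] by [].
  by apply: closed_comp => [u _|]; [exact: continuous_bn2|exact: closed_le].
- exact: (@rV_compact (C R) d (fun _ => [set z : C R | cabs z <= s]) (fun _ => @compact_cdisc R s)).
- move=> u /= us j; rewrite -(@ler_pXn2r _ 2)// ?nnegrE ?cabs_ge0//.
  apply: le_trans us; rewrite /bn2 (bigD1 j)//= lerDl; apply: sumr_ge0 => i _; exact: sqr_ge0.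
Qed.

Lemma joins_continuous (D : set 'rV[C R]_d) x y c (t : R) : joins D x y c -> t \in `[0, 1] ->
  forall e : R, 0 < e -> exists2 r : R, 0 < r &
    forall s, s \in `[0, 1] -> `|s - t| < r -> nrm (c s - c t) < e.
Proof.
move=> [[n [p [p0 pn pP]]] _ _ _].
suff key m : (m <= n)%N -> forall t, p 0%N <= t <= p m -> forall e : R, 0 < e -> exists2 r : R, 0 < r &
    forall s, p 0%N <= s <= p m -> `|s - t| < r -> nrm (c s - c t) < e.
  rewrite in_itv /= => t01 e e0; have tt : p 0%N <= t <= p n by rewrite p0 pn.
  have [r r0 hr] := key n (leqnn _) t tt e e0.
  by exists r => // s; rewrite in_itv /= => s01; apply: hr; rewrite p0 pn.
elim: m => [_|m IH mn] {}t /andP[t0 tm] e e0.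
  exists 1 => // s /andP[s0 s1] _; have -> : s = t by lra.
  by rewrite subrr nrm0.
have [pm [h hC ch]] := pP m mn.
have [r1 r10 h1] : exists2 r : R, 0 < r & forall s, p 0%N <= s <= p m -> `|s - t| < r -> nrm (c s - c t) < e.
  have [tpm|pmt] := leP t (p m); first by apply: (IH (ltnW mn)); rewrite ?t0.
  exists (t - p m); first by rewrite subr_gt0.
  by move=> s /andP[_ sm]; rewrite ltr_norml => /andP[]; lra.
have [r2 r20 h2] : exists2 r : R, 0 < r & forall s, p m <= s <= p m.+1 -> `|s - t| < r -> nrm (c s - c t) < e.
  have [pmt|tpm] := leP (p m) t; last first.
    exists (p m - t); first by rewrite subr_gt0.
    by move=> s /andP[sm _]; rewrite ltr_norml => /andP[]; lra.
  have hcont := rder_continuous (C1_rder t hC).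
  have : nbhs (h t) [set z | nrm (z - h t) < e] by apply/nbhs_nrmP; exists e.
  move=> /hcont /nbhs_ballP[r /= r0 hr]; exists r => // s ss st.
  rewrite !ch ?in_itv /= ?pmt//; apply: hr; by rewrite /ball /= distrC.
exists (Num.min r1 r2); first by rewrite lt_min r10.
move=> s /andP[s0 sm]; rewrite lt_min => /andP[st1 st2].
have [spm|pms] := leP s (p m); first by apply: h1; rewrite ?s0.
by apply: h2; rewrite ?sm ?(ltW pms).
Qed.

(** Takes the place of the inverse function theorem: at an interior minimiser of the distance to
    [y], a small Newton step would decrease a positive distance. *)
Lemma min_dist_local_inverse (phi : 'rV[C R]_d -> 'rV[C R]_d) (s : R) u y : 
  differentiable phi u -> bn2 u < s ^+ 2 -> (forall v, 'd phi u v = 0 -> v = 0) ->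
  (forall w, bn2 w <= s ^+ 2 -> nrm (phi u - y) <= nrm (phi w - y)) -> phi u = y.
Proof.
move=> dphi us inj umin; apply: contrapT => uy.
have m0 : 0 < nrm (phi u - y) by rewrite nrm_gt0 subr_eq0; apply/eqP.
set m := nrm _ in m0 umin.
have dE v : 'd phi u v = v *m 'J phi u by rewrite /jacobian mul_rV_lin1.
have Ju : 'J phi u \in unitmx.
  by rewrite -row_free_unit; apply: inj_row_free => v; rewrite -dE; exact: inj.
pose X := (y - phi u) *m invmx ('J phi u).
have dX : 'd phi u X = y - phi u by rewrite dE /X mulmxKV.
have X1 : 0 < nrm X + 1 by rewrite ltr_wpDl// nrm_ge0.
(* With this tolerance the error of a step [e *: X] is below [e * m], the first-order gain. *)
have e0 : 0 < m / (nrm X + 1) by rewrite divr_gt0.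
have [r r0 hr] := diff_nrm dphi e0.
have [r2 r20 hr2] : exists2 r : R, 0 < r & forall w, nrm (w - u) < r -> bn2 w < s ^+ 2.
  have e1 : 0 < s ^+ 2 - bn2 u by rewrite subr_gt0.
  have /real_continuousP/(_ _ e1)[r2 r20 h2] := @continuous_bn2 u.
  by exists r2 => // w /h2; rewrite ltr_norml => /andP[_]; lra.
pose e := Num.min 1 (Num.min (r / (nrm X + 1)) (r2 / (nrm X + 1))) / 2.
have M0 : 0 < Num.min 1 (Num.min (r / (nrm X + 1)) (r2 / (nrm X + 1))) by rewrite !lt_min ltr01 !divr_gt0.
have [M1 M2 M3] : [/\ Num.min 1 (Num.min (r / (nrm X + 1)) (r2 / (nrm X + 1))) <= 1,
  Num.min 1 (Num.min (r / (nrm X + 1)) (r2 / (nrm X + 1))) <= r / (nrm X + 1) &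
  Num.min 1 (Num.min (r / (nrm X + 1)) (r2 / (nrm X + 1))) <= r2 / (nrm X + 1)].
  by split; rewrite !ge_min lexx ?orbT.
have [ep e1 er er2] : [/\ 0 < e, e < 1, e < r / (nrm X + 1) & e < r2 / (nrm X + 1)] by rewrite /e; clear -M0 M1 M2 M3; split; lra.
clear M0 M1 M2 M3.
rewrite ltr_pdivlMr// in er; rewrite ltr_pdivlMr// in er2.
have eX1 : e * nrm X <= e * (nrm X + 1) by rewrite ler_wpM2l ?lerDl// ltW.
have X0 := nrm_ge0 X.
have eX : nrm (rc e *: X) = e * nrm X by rewrite nrmZ cabs_real gtr0_norm.
have := hr (u + rc e *: X); rewrite addrC addKr eX.
have er' : e * nrm X < r := le_lt_trans eX1 er.
move=> /(_ er'); have -> : 'd phi u (rc e *: X) = rc e *: (y - phi u).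
  by rewrite linearZ; congr (_ *: _); exact: dX.
move=> H; have := umin (u + rc e *: X).
have b2 : bn2 (u + rc e *: X) < s ^+ 2 by apply: hr2; rewrite addrC addKr eX; exact: le_lt_trans eX1 er2.
move=> /(_ (ltW b2)); apply/negP; rewrite -ltNge.
have -> : phi (u + rc e *: X) - y = (phi (u + rc e *: X) - phi u - rc e *: (y - phi u))
   + rc (1 - e) *: (phi u - y).
  by rewrite rcD rc1 rcN; apply/rowP => j; rewrite !mxE; ring.
apply: le_lt_trans (nrmD _ _) _; rewrite nrmZ cabs_real ger0_norm ?subr_ge0 ?(ltW e1)//.
rewrite -/m; apply: (@le_lt_trans _ _ (m / (nrm X + 1) * (e * nrm X) + (1 - e) * m)).
  by rewrite lerD2r.
have -> : m / (nrm X + 1) * (e * nrm X) = e * m * (nrm X / (nrm X + 1)).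
  by field; rewrite gt_eqF.
have : nrm X / (nrm X + 1) < 1 by rewrite ltr_pdivrMr// mul1r ltrDl.
have em0 : 0 < e * m by rewrite mulr_gt0.
rewrite -(ltr_pM2l em0) mulrBl mul1r => h; clear -h; lra.
Qed.

(** Connectedness of [[0, 1]]: the times at which the curve lies in the [phi]-image of the closed
    ball of radius [s] form an open and closed set. No continuous lift is built. *)
Lemma lifting (D : set 'rV[C R]_d) (phi psi : 'rV[C R]_d -> 'rV[C R]_d) x y c (K s q : R) :
  open D -> holo (@unit_ball R d) D phi -> holo D (@unit_ball R d) psi ->
  phi 0 = x -> psi x = 0 -> joins D x y c ->
  (\int[@lebesgue_measure R]_(t in `[0%R, 1%R]) kobayashi_royden D (c t) (velocity c t) <= K%:E)%E ->
  0 < s -> s < 1 -> th K ^+ 2 < q -> (forall u, bn2 u = s ^+ 2 -> q <= bn2 (psi (phi u))) ->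
  (forall u v, bn2 u <= s ^+ 2 -> 'd (fun w => psi (phi w)) u v = 0 -> v = 0) ->
  exists2 u, bn2 u <= s ^+ 2 & phi u = y.
Proof.
move=> oD hphi hpsi phi0 psix jc intK s0 s1 Kq bdry injF.
have [_ Dc c0 c1] := jc.
have sB u : bn2 u <= s ^+ 2 -> bn2 u < 1.
  by move=> us; apply: le_lt_trans us _; rewrite expr_lt1// ltW.
have psiK t : t \in `[0, 1] -> bn2 (psi (c t)) <= th K ^+ 2.
  move=> t01; have := ball_lower_curve oD hpsi jc t01 intK.
  rewrite psix -(hdotC 0) hdot0l rmorph0 subr0 cabs1 expr1n bn2_0 subr0 mulr1.
  have c20 : 0 < ch K ^+ 2 by rewrite exprn_gt0// ch_gt0.
  by rewrite -ler_pdivrMl// mulr1 -onem_th2; lra.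
have inj u : bn2 u <= s ^+ 2 -> forall v, 'd phi u v = 0 -> v = 0.
  move=> us v dv; apply: (injF u v us).
  have d1 : differentiable phi u by apply: hphi.1; exact: sB.
  have d2 : differentiable psi (phi u) by apply: hpsi.1; apply: hphi.2; exact: sB.
  apply: etrans (diff_of_comp v d1 d2) _; apply: etrans (congr1 ('d psi (phi u)) dv) _.
  exact: linear0.
have minP z : exists2 u, bn2 u <= s ^+ 2 & forall w, bn2 w <= s ^+ 2 -> nrm (phi u - z) <= nrm (phi w - z).
  have [] := @compact_EVT_min 'rV[C R]_d R (fun u => nrm (phi u - z)) [set u : 'rV[C R]_d | bn2 u <= s ^+ 2].
  - by exists 0; rewrite /= bn2_0 exprn_ge0// ltW.
  - exact: compact_cball (ltW s0).
  - apply: continuous_in_subspaceT => u; rewrite inE /= => us.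
    apply/real_continuousP => e e0.
    have : {for u, continuous phi} by apply: differentiable_continuous; apply: hphi.1; exact: sB.
    move=> /continuous_nrmP/(_ _ e0)[r r0 hr]; exists r => // w /hr.
    apply: le_lt_trans; apply: le_trans (ler_dist_nrm _ _) _.
    by rewrite opprB addrA subrK.
  by move=> u; rewrite inE => us hu; exists u => // w ws; apply: hu; rewrite inE.
pose B := [set t : R | `[0, 1]%classic t /\ exists2 u, bn2 u <= s ^+ 2 & phi u = c t].
have Bopen t : B t -> exists2 r : R, 0 < r & forall t', t' \in `[0, 1] -> `|t' - t| < r -> B t'.
  move=> [t01 [u0 u0s u0t]].
  have Dct : D (c t) by exact: Dc.
  pose q1 := (q + th K ^+ 2) / 2.
  have q1q : q1 < q by rewrite /q1; lra.
  have [r1 r10 h1] : exists2 r : R, 0 < r & forall z, nrm (z - c t) < r -> bn2 (psi z) < q1.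
    have c1' : {for c t, continuous psi} by apply: differentiable_continuous; exact: hpsi.1.
    have c2' := @continuous_comp _ _ _ psi (@bn2 R d) (c t) c1' (@continuous_bn2 _).
    have e1 : 0 < q1 - bn2 (psi (c t)) by have := psiK _ t01; rewrite /q1; lra.
    have /real_continuousP/(_ _ e1)[r1 r10 h1] := c2'.
    by exists r1 => // z /h1 /=; rewrite ltr_norml => /andP[_]; lra.
  have r12 : 0 < r1 / 2 by rewrite divr_gt0.
  have [r r0 hr] := joins_continuous jc t01 r12.
  exists r => // t' t'01 /(hr _ t'01) ct'; split=> //.
  have [u1 u1s u1min] := minP (c t'); exists u1 => //.
  have u1t : nrm (phi u1 - c t) < r1.
    have := nrm_tri (c t') (phi u1) (c t); have := u1min _ u0s; rewrite u0t (nrmB (c t) (c t')); clear -ct'; lra.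
  (* On the bounding sphere [bn2 (psi (phi u))] is at least [q], while near the curve it stays below
     [q1 < q]; so the minimiser is interior. *)
  have u1lt : bn2 u1 < s ^+ 2.
    rewrite lt_neqAle u1s andbT; apply/eqP => /bdry; have := h1 _ u1t; lra.
  apply: (@min_dist_local_inverse phi s) => //; first by apply: hphi.1; exact: sB.
  exact: inj.
have : B = `[0, 1]%classic.
  apply: (@segment_connected R 0 1).
  - exists 0; split; first by rewrite /= in_itv /= lexx ler01.
    by exists 0; rewrite ?bn2_0 ?exprn_ge0 ?ltW// phi0 c0.
  (* Relative openness needs an open set of the line: the exterior of the segment is added so that
     its end points cause no trouble. *)
  - exists (B `|` ~` `[0, 1]%classic)^°; first exact: open_interior.
    apply/seteqP; split=> t.
      move=> Bt; split; first exact: Bt.1.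
      have [r r0 hr] := Bopen _ Bt; apply/nbhs_ballP; exists r => // t'.
      rewrite /ball /= distrC => t't; have [t'01|t'n] := boolP (t' \in `[0, 1]).
        by left; exact: hr.
      by right => /=; exact/negP.
    by move=> [t01 /interior_subset[//|/(_ t01)]].
  - exists (closure B); first exact: closed_closure.
    apply/seteqP; split=> t; first by move=> Bt; split; [exact: Bt.1|exact: subset_closure].
    (* If the image missed [c t], its distance to [c t] would be a positive minimum, contradicted by
       lifted points [c t'] nearby. *)
    move=> [t01 cBt]; split=> //; have [u us umin] := minP (c t); exists u => //.
    apply: contrapT => ut.
    have m0 : 0 < nrm (phi u - c t) by rewrite nrm_gt0 subr_eq0; apply/eqP.
    have [r r0 hr] := joins_continuous jc t01 m0.
    have [t' [[t'01 [u' u's u't']] t't]] := cBt _ (nbhsx_ballx t r r0).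
    have := umin _ u's; rewrite u't'; apply/negP; rewrite -ltNge; apply: hr => //.
    by move: t't; rewrite /ball /= distrC.
move=> B01; have : B 1 by rewrite B01 /= in_itv /= lexx ler01.
by move=> [_ [u us uc]]; exists u => //; rewrite uc.
Qed.

End lifting.

(** * The limiting configuration in the ball *)

Section limit_geometry.
Context {R : realType} {d : nat}.
Implicit Types (U V : 'rV[C R]_d).

Lemma cabs_one_sub_sqr (z : C R) : cabs (1 - z) ^+ 2 = 1 - 2 * complex.Re z + cabs z ^+ 2.
Proof. by rewrite !cabs_sqr !(cReD, cImD, cReN, cImN) /=; ring. Qed.

Lemma bn2_add U V : bn2 (U + V) = bn2 U + bn2 V + 2 * complex.Re (hdot U V).
Proof. by have := bn2_comb 1 1 U V; rewrite !scale1r cabs1 expr1n rmorph1 !mul1r. Qed.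

Lemma bn2_sub U V : bn2 (U - V) = bn2 U + bn2 V - 2 * complex.Re (hdot U V).
Proof.
have := bn2_comb 1 (- 1) U V.
by rewrite scale1r scaleN1r cabsN cabs1 expr1n rmorphN rmorph1 !mul1r mulN1r cReN mulrN.
Qed.

Lemma hdot_le1 U V : bn2 U < 1 -> bn2 V < 1 -> cabs (hdot U V) <= 1.
Proof. by move=> U1 V1; rewrite -[1]mulr1; apply: hdot_le; rewrite ?expr1n ?ltW. Qed.

Lemma cabs_one_sub_le2 U V : bn2 U < 1 -> bn2 V < 1 -> cabs (1 - hdot U V) <= 2.
Proof. by move=> U1 V1; have := cabsD 1 (- hdot U V); rewrite cabs1 cabsN; have := hdot_le1 U1 V1; lra. Qed.

(* [Up], [Um] are almost antipodal and [Vp], [Vm] are close to them; the last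
   hypotheses say that [V] lies almost on the geodesic from [Vm] to [Vp] and is
   almost at the level of its midpoint. *)
Lemma near_midpoint (Up Um V Vp Vm : 'rV[C R]_d) (t q mu : R) :
  bn2 Up < 1 -> bn2 Um < 1 -> bn2 V < 1 -> bn2 Vp < 1 -> bn2 Vm < 1 ->
  0 < t -> 0 < q -> q <= 1 -> 100 * t <= q ^+ 2 -> 0 < mu ->
  2 - 6 * t <= cabs (1 - hdot Up Um) ->
  cabs (1 - hdot Vp Up) <= t -> cabs (1 - hdot Vm Um) <= t ->
  cabs (1 - hdot V Vp) * cabs (1 - hdot V Vm) <= 1 - bn2 V + 20 * t ->
  1 - bn2 V - 7 * t <= cabs (1 - hdot V Up) ^+ 2 ->
  1 - bn2 V - 7 * t <= cabs (1 - hdot V Um) ^+ 2 ->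
  mu <= 1 - bn2 V -> bn2 V * mu <= 20 * q.
Proof.
move=> Up1 Um1 V1 Vp1 Vm1 t0 q0 q1 tq mu0 H2 H3p H3m H4 H5p H5m H6.
have q2q : q ^+ 2 <= q by rewrite expr2; nra.
have V0 := bn2_ge0 V.
(* For [|z| <= 1], a value of [|1 - z|] near 2 forces [Re z] near -1. *)
have b1 : bn2 (Um + Up) <= 24 * t.
  have k := cabs_one_sub_sqr (hdot Up Um); have k1 := hdot_le1 Up1 Um1; have k0 := cabs_ge0 (hdot Up Um).
  have k2 : (2 - 6 * t) ^+ 2 <= cabs (1 - hdot Up Um) ^+ 2.
    have t1 : 0 <= 2 - 6 * t by lra.
    by rewrite ler_pXn2r ?nnegrE ?cabs_ge0.
  rewrite addrC bn2_add; rewrite !expr2 in k k2; nra.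
have close (x y : 'rV[C R]_d) : bn2 x < 1 -> bn2 y < 1 -> cabs (1 - hdot x y) <= t -> bn2 (x - y) <= 2 * t.
  move=> x1 y1 xy; rewrite bn2_sub; have := le_trans (ler_norm _) (le_trans (cabs_Re _) xy).
  by rewrite cReD cReN /=; lra.
have b2 := close _ _ Vp1 Up1 H3p; have b3 := close _ _ Vm1 Um1 H3m.
(* Passing from squared norms to scalar products takes a square root, which is why the hypothesis is
   [100 * t <= q ^+ 2]. *)
have hV (x : 'rV[C R]_d) : bn2 x <= 24 * t -> cabs (hdot V x) <= q / 2.
  move=> xt; rewrite -[q / 2]mul1r; apply: hdot_le; rewrite ?ler01 ?divr_ge0 ?expr1n ?(ltW q0) ?(ltW V1)//.
  by apply: le_trans xt _; rewrite expr_div_n; lra.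
set w := hdot V Up in H5p.
have e1 : cabs (hdot V Vp - w) <= q / 2 by rewrite /w -hdotBr; apply: hV; lra.
have e2 : cabs (hdot V Um + w) <= q / 2 by rewrite /w -hdotDr; exact: hV.
have e3 : cabs (hdot V Vm + w) <= q.
  have -> : hdot V Vm + w = hdot V (Vm - Um) + (hdot V Um + w) by rewrite hdotBr; ring.
  have h1 : cabs (hdot V (Vm - Um)) <= q / 2 by apply: hV; lra.
  by apply: le_trans (cabsD _ _) _; lra.
set a := cabs (1 - w) in H5p; set b := cabs (1 + w).
have a0 : 0 <= a := cabs_ge0 _. have b0 : 0 <= b := cabs_ge0 _.
set P := cabs (1 - hdot V Vp) in H4; set Q := cabs (1 - hdot V Vm) in H4.
have P0 : 0 <= P := cabs_ge0 _. have Q0 : 0 <= Q := cabs_ge0 _.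
have P2 : P <= 2 by exact: cabs_one_sub_le2. have Q2 : Q <= 2 by exact: cabs_one_sub_le2.
have aP : a <= P + q / 2.
  have -> : a = cabs ((1 - hdot V Vp) + (hdot V Vp - w)) by rewrite /a; congr cabs; ring.
  by apply: le_trans (cabsD _ _) _; rewrite lerD2l.
have bQ : b <= Q + q.
  have -> : b = cabs ((1 - hdot V Vm) + (hdot V Vm + w)) by rewrite /b; congr cabs; ring.
  by apply: le_trans (cabsD _ _) _; rewrite lerD2l.
have w1 : cabs w <= 1 by exact: hdot_le1.
have b2' : b <= 2 by apply: le_trans (cabsD _ _) _; rewrite cabs1; lra.
have ab : a * b <= 1 - bn2 V + 4 * q.
  have : a * b <= (P + q / 2) * (Q + q) by apply: ler_pM.
  have h1 : P * q <= 2 * q by rewrite ler_pM2r.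
  have h2 : q * Q <= q * 2 by rewrite ler_pM2l.
  by rewrite expr2 in q2q tq; lra.
have a2 : 1 - bn2 V - 4 * q <= a ^+ 2 by clear -H5p tq q0 q2q; lra.
have b2b : 1 - bn2 V - 4 * q <= b ^+ 2.
  set N := cabs (1 - hdot V Um) in H5m.
  have Nb : N <= b + q / 2.
    have -> : N = cabs ((1 + w) - (hdot V Um + w)) by rewrite /N; congr cabs; ring.
    by apply: le_trans (cabsD _ _) _; rewrite cabsN lerD2l.
  have : N ^+ 2 <= (b + q / 2) ^+ 2 by rewrite ler_pXn2r ?nnegrE ?cabs_ge0 ?addr_ge0 ?divr_ge0 ?(ltW q0).
  have h1 : b * q <= 2 * q by rewrite ler_pM2r.
  by rewrite !expr2 in q2q tq H5m *; lra.
have ab2 : 2 <= a ^+ 2 + b ^+ 2.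
  have h1 := cabs_one_sub_sqr w; have h2 := cabs_one_sub_sqr (- w).
  rewrite opprK cReN cabsN -/b in h2; rewrite -/a in h1.
  by rewrite h1 h2; have := sqr_ge0 (cabs w); lra.
set be := 1 - bn2 V in ab a2 b2b H6 *.
have be1 : be <= 1 by rewrite gerBl.
have be0 : 0 < be := lt_le_trans mu0 H6.
have -> : bn2 V = 1 - be by rewrite /be; ring.
have abe : a ^+ 2 * b ^+ 2 <= (be + 4 * q) ^+ 2.
  by rewrite -exprMn ler_pXn2r ?nnegrE ?mulr_ge0//; clear -be0 q0 ab; lra.
(* If [be < 4 * q], then [mu <= be] is already small and [bn2 V <= 1] finishes. *)
have [x0|x0] := leP 0 (be - 4 * q); last first.
  apply: le_trans (_ : be <= _); last by clear -x0 q0; lra.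
  by apply: le_trans H6; rewrite ler_piMl ?gerBl ?(ltW mu0) ?(ltW be0).
(* At [q = 0] the bounds on [a * b] and [a ^+ 2 + b ^+ 2] turn this into [be <= be ^+ 2], so [be] is
   0 or 1; the lower bound [mu] excludes the point at the sphere. *)
have h : (be - 4 * q) * (a ^+ 2 + b ^+ 2) <= a ^+ 2 * b ^+ 2 + (be - 4 * q) ^+ 2.
  have : 0 <= (a ^+ 2 - (be - 4 * q)) * (b ^+ 2 - (be - 4 * q)) by rewrite mulr_ge0 ?subr_ge0.
  by rewrite !expr2 => p; clear -p; lra.
have h' : (be - 4 * q) * 2 <= (be + 4 * q) ^+ 2 + (be - 4 * q) ^+ 2.
  apply: le_trans (_ : (be - 4 * q) * (a ^+ 2 + b ^+ 2) <= _); first by rewrite ler_wpM2l.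
  by apply: le_trans h _; rewrite lerD2r.
have h2 : be * (1 - be) <= 20 * q by clear -h' q2q; rewrite !expr2 in h' q2q *; lra.
apply: le_trans h2; by rewrite mulrC ler_wpM2r// subr_ge0.
Qed.

End limit_geometry.

(** * Charts provided by the quotient invariant *)

Section quotient_invariant.
Context {R : realType} {d : nat}.
Implicit Types (D : set 'rV[C R]_d) (z : 'rV[C R]_d).

(** Extracts one map for the supremum and one for the infimum from a lower bound on their ratio in
    the extended reals. *)
Lemma ereal_ratio_gt (A B : Type) (S : set A) (J : set B) (f : A -> R) (g : B -> R) (a : R) :
  0 < a -> (forall j, 0 <= g j) ->
  (a%:E < ereal_sup [set (f s)%:E | s in S] / ereal_inf [set ((g j)%:E)^-1 | j in J])%E ->
  exists s j, [/\ S s, J j & a < f s * g j].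
Proof.
move=> a0 J0; set c := ereal_sup _; set k := ereal_inf _ => ack.
have k0 : (0 <= k)%E.
  by apply: le_ereal_inf_tmp => _ [j Jj <-]; rewrite inve_ge0 lee_fin.
have [s [Ss s0 ks]] : exists s, [/\ S s, 0 < f s & (k < (f s / a)%:E)%E].
  (* An infinite infimum would make the ratio 0. A zero one has inverse [+oo], and then any [s] with
     [f s > 0] serves. *)
  move: k k0 ack => [r|//|//]; last by rewrite invey mule0 lte_fin ltNge (ltW a0).
  rewrite lee_fin le_eqVlt => /predU1P[<-|r0] ack.
    rewrite inve0 in ack.
    have c0 : (0 < c)%E.
      rewrite ltNge; apply/negP => c0; have := lt_le_trans ack (mule_le0_ge0 c0 le0y).
      by rewrite lte_fin ltNge (ltW a0).
    have [_ [s Ss <-] s0] := ereal_sup_gt c0; rewrite lte_fin in s0.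
    by exists s; split=> //; rewrite lte_fin divr_gt0.
  have : ((a * r)%:E < c)%E.
    move: c ack => [c|_|]; rewrite ?ltry//; rewrite inver gt_eqF//.
      by rewrite -EFinM !lte_fin ltr_pdivlMr.
    by rewrite mulNyr gtr0_sg ?invr_gt0// mul1e.
  move=> /ereal_sup_gt[_ [s Ss <-]]; rewrite lte_fin => ars.
  have s0 : 0 < f s by apply: lt_trans ars; rewrite mulr_gt0.
  by exists s; split=> //; rewrite lte_fin ltr_pdivlMr// mulrC.
have [_ [j Jj <-]] := ereal_inf_lt ks.
rewrite inver; case: eqP => // j0; rewrite lte_fin => h; exists s, j; split=> //.
have jp : 0 < g j by rewrite lt_neqAle eq_sym J0// andbT; apply/eqP.
by rewrite ltr_pdivlMr// mulrC ltr_pdivrMr in h.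
Qed.

Lemma eq_mulmx (A B : 'M[C R]_d) : (forall v : 'rV[C R]_d, v *m A = v *m B) -> A = B.
Proof. by move=> AB; apply/row_matrixP => i; rewrite !rowE. Qed.

Lemma mul_jacobian (f : 'rV[C R]_d -> 'rV[C R]_d) w v : v *m 'J f w = 'd f w v.
Proof. by rewrite /jacobian mul_rV_lin1. Qed.

Lemma quotient_invariant_gt D z (a : R) : D z -> 0 < a -> (a%:E < quotient_invariant D z)%E ->
  exists phi psi : 'rV[C R]_d -> 'rV[C R]_d,
    [/\ holo (@unit_ball R d) D phi, phi 0 = z, holo D (@unit_ball R d) psi, psi z = 0 &
        a < cabs (\det ('J (fun u => psi (phi u)) 0)) ^+ 2].
Proof.
move=> Dz a0; rewrite /quotient_invariant /caratheodory_volume /kobayashi_volume.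
move=> /(ereal_ratio_gt a0 (fun phi : 'rV[C R]_d -> 'rV[C R]_d => sqr_ge0 (cabs (\det ('J phi 0))))).
move=> [psi [phi [[hpsi psiz] [hphi phi0]]]]; rewrite -exprMn -cabsM mulrC -det_mulmx.
move=> h; exists phi, psi; split=> //; suff <- : 'J phi 0 *m 'J psi z = 'J (fun u => psi (phi u)) 0 by exact: h.
have b0 : @unit_ball R d 0 by rewrite unit_ballE bn2_0.
have d1 := hphi.1 _ b0; have d2 : differentiable psi (phi 0) by rewrite phi0; exact: hpsi.1.
apply: eq_mulmx => v; rewrite mulmxA -phi0.
apply: etrans (congr1 (fun w => w *m _) (mul_jacobian _ _ _)) _.
apply: etrans (mul_jacobian _ _ _) _.
apply: esym; apply: etrans (mul_jacobian _ _ _) _.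
exact: (diff_of_comp _ d1 d2).
Qed.
End quotient_invariant.

Section approximate_chart.
Context {R : realType} {d : nat}.
Implicit Types (D : set 'rV[C R]_d) (a x y : 'rV[C R]_d).

Lemma ball_lower D (psi : 'rV[C R]_d -> 'rV[C R]_d) x y (k : R) :
  open D -> holo D (@unit_ball R d) psi -> (kobayashi D x y < k%:E)%E ->
  cabs (1 - hdot (psi y) (psi x)) ^+ 2 <= ch k ^+ 2 * (1 - bn2 (psi x)) * (1 - bn2 (psi y)).
Proof.
move=> Do hpsi /ereal_inf_lt[_ [c jc <-] ck].
have i1 : (1 : R) \in `[0, 1] by rewrite in_itv /= ler01 lexx.
have := ball_lower_curve Do hpsi jc i1 (ltW ck).
by case: jc => _ _ _ ->.
Qed.

Lemma bn2_hdot_close (u v : 'rV[C R]_d) : `|bn2 u - bn2 v| <= cabs (hdot u u - hdot v v).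
Proof. by rewrite !hdotvv -rcN -rcD cabs_real. Qed.

(* [g] is a map from the domain to the ball and [f] a right inverse, defined near
   [a], of a map from the ball to the domain; both send [a] to the origin. *)
Definition approximate_chart D a (K delta : R) (f g : 'rV[C R]_d -> 'rV[C R]_d) : Prop :=
  let A := [set x | D x /\ (kobayashi D a x < K%:E)%E] in
  [/\ f a = 0 /\ g a = 0,
      forall x, A x -> bn2 (f x) < 1 /\ bn2 (g x) <= bn2 (f x),
      forall x y, A x -> A y -> cabs (hdot (g x) (g y) - hdot (f x) (f y)) <= delta,
      forall x y (k : R), A x -> A y -> 0 <= k -> (k%:E <= kobayashi D x y)%E ->
        ch k ^+ 2 * (1 - bn2 (f x)) * (1 - bn2 (f y)) <= cabs (1 - hdot (f y) (f x)) ^+ 2 &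
      forall x y (k : R), (kobayashi D x y < k%:E)%E ->
        cabs (1 - hdot (g y) (g x)) ^+ 2 <= ch k ^+ 2 * (1 - bn2 (g x)) * (1 - bn2 (g y))].

(** [e] depends on [K] and [delta] only, not on the centre [a], so one tolerance serves all points
    of a ray. *)
Lemma approximate_chart_exists D (K delta : R) : open D -> bounded_set D -> 0 < K -> 0 < delta ->
  exists2 e, 0 < e & forall a, D a -> ((1 - e)%:E < quotient_invariant D a)%E ->
    exists f g, approximate_chart D a K delta f g.
Proof.
move=> Do Db K0 delta0.
have t0 := sqr_ge0 (th K).
have t1 := th2_lt1 K.
(* [s ^+ 2] lies half-way between [th K ^+ 2], which bounds [bn2] of [psi] within distance [K] of
   [a], and 1. *)
pose s := Num.sqrt ((1 + th K ^+ 2) / 2).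
have s2 : s ^+ 2 = (1 + th K ^+ 2) / 2 by rewrite sqr_sqrtr//; lra.
have s0 : 0 < s by rewrite sqrtr_gt0; lra.
have s1 : s < 1 by rewrite -(@ltr_pXn2r _ 2)// ?nnegrE ?ltW// expr1n s2; lra.
pose r := (1 + s) / 2.
have sr : s < r by rewrite /r; lra.
have r1 : r < 1 by rewrite /r; lra.
have r0 : 0 < r by lra.
(* The second bound keeps [s ^+ 2 - del], the level [q] given to [lifting], above [th K ^+ 2]. *)
pose del := Num.min delta ((1 - th K ^+ 2) / 4).
have del0 : 0 < del by rewrite lt_min delta0/=; lra.
have del1 : del <= delta by rewrite ge_min lexx.
have del2 : del <= (1 - th K ^+ 2) / 4 by rewrite ge_min lexx orbT.
(* Serves twice: [e + 2 * rho <= del] for scalar products and [4 * rho <= r - s] for injectivity of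
   the differential. *)
pose rho := Num.min (del / 4) ((r - s) / 4).
have rho0 : 0 < rho by rewrite lt_min; apply/andP; split; lra.
have rho1 : rho <= del / 4 by rewrite ge_min lexx.
have rho2 : rho <= (r - s) / 4 by rewrite ge_min lexx orbT.
pose e := Num.min (Num.min (1 / 2) (del / 2)) (rho ^+ 2 * (1 - r) / 35).
have m0 : 0 < rho ^+ 2 * (1 - r) by rewrite mulr_gt0 ?exprn_gt0// subr_gt0.
have e0 : 0 < e by rewrite !lt_min; repeat (apply/andP; split); lra.
have e1 : e <= 1 / 2 by rewrite !ge_min lexx.
have e2 : e <= del / 2 by rewrite !ge_min lexx orbT.
have e3 : 35 * e / (1 - r) <= rho ^+ 2.
  rewrite ler_pdivrMr ?subr_gt0//.
  have : e <= rho ^+ 2 * (1 - r) / 35 by rewrite !ge_min lexx orbT.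
  lra.
exists e => // a Da qa.
have [|phi [psi [hphi phi0 hpsi psia Fe]]] := quotient_invariant_gt Da _ qa; first by lra.
pose F := fun u => psi (phi u).
have hF : holo (@unit_ball R d) (@unit_ball R d) F.
  split=> u bu; last exact: hpsi.2 _ (hphi.2 _ bu).
  exact: (differentiable_of_comp (hphi.1 _ bu) (hpsi.1 _ (hphi.2 _ bu))).
have F0 : F 0 = 0 by rewrite /F phi0.
have Ae u : (1 - e) * bn2 u <= bn2 ('d F 0 u).
  rewrite -(mul_jacobian F); apply: det_near_isometry => [v|]; last exact: ltW.
  by rewrite (mul_jacobian F); exact: ball_schwarz_diff.
have lift x : D x -> (kobayashi D a x < K%:E)%E -> exists2 u, bn2 u <= s ^+ 2 & phi u = x.
  move=> Dx /ereal_inf_lt[_ [c jc <-] ck].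
  apply: (lifting (q := s ^+ 2 - del) Do hphi hpsi phi0 psia jc (ltW ck) s0 s1); first by lra.
  - move=> u us.
    have := self_map_hdot (u := u) (v := u) hF F0 e0 e1 Ae (ltW r0) r1 (ltW rho0) e3.
    have us2 : bn2 u <= r ^+ 2 by rewrite us ler_pXn2r ?nnegrE ?ltW.
    move=> /(_ us2 us2) /(le_trans (bn2_hdot_close _ _)); rewrite ler_norml /F us => /andP[h _]; lra.
  - move=> u v us; apply: (self_map_diff_inj hF F0 e0 e1 Ae (ltW s0) sr r1 (ltW rho0) e3 _ us); lra.
(* Preimages under [phi] need not be unique, so the choice of 0 over [a] is imposed. *)
have /choice[f fP] x : exists u, (D x -> (kobayashi D a x < K%:E)%E -> bn2 u <= s ^+ 2 /\ phi u = x) /\ (x = a -> u = 0).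
  have [->|xa] := eqVneq x a; first by exists 0; split=> // _ _; rewrite bn2_0 sqr_ge0.
  have [[Dx dx]|n] := pselect (D x /\ (kobayashi D a x < K%:E)%E).
    by have [u us ux] := lift _ Dx dx; exists u; split=> // xa'; rewrite xa' eqxx in xa.
  by exists 0; split=> [Dx dx|//]; case: n.
have fs x : D x /\ (kobayashi D a x < K%:E)%E -> [/\ bn2 (f x) < 1, bn2 (f x) <= r ^+ 2 & phi (f x) = x].
  move=> [Dx dx]; have [h ->] := (fP x).1 Dx dx; split=> //.
    by apply: le_lt_trans h _; rewrite s2; lra.
  by apply: le_trans h _; rewrite ler_pXn2r ?nnegrE ?ltW.
exists f, psi; split.
- by split=> //; exact: (fP a).2.
- by move=> x /fs[h1 h2 h3]; split=> //; have := ball_schwarz hF F0 h1; rewrite /F h3.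
- move=> x y /fs[x1 x2 x3] /fs[y1 y2 y3].
  have := self_map_hdot hF F0 e0 e1 Ae (ltW r0) r1 (ltW rho0) e3 x2 y2.
  by rewrite /F x3 y3 => h; apply: le_trans h _; lra.
- move=> x y k /fs[x1 x2 x3] /fs[y1 y2 y3] k0 kxy.
  by apply: (ball_upper Db hphi x1 y1 k0); rewrite x3 y3.
- by move=> x y k; exact: ball_lower.
Qed.
End approximate_chart.

(** * Geodesic configurations read in a chart *)

Section chart_midpoint.
Context {R : realType} {d : nat}.
Implicit Types (D : set 'rV[C R]_d) (x y : 'rV[C R]_d).

Lemma ch_double (x : R) : ch (2 * x) = 2 * ch x ^+ 2 - 1.
Proof.
have e : expR x * expR (- x) = 1 by rewrite -expRD subrr expR0.
have -> : ch (2 * x) = (expR x ^+ 2 + expR (- x) ^+ 2) / 2.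
  by rewrite /ch !expr2 -!expRD; congr ((expR _ + expR _) / 2); ring.
have -> : 2 * ch x ^+ 2 - 1 = (expR x ^+ 2 + expR (- x) ^+ 2) / 2 + (expR x * expR (- x) - 1).
  by rewrite /ch; field.
by rewrite e subrr addr0.
Qed.

Lemma hdot0r (u : 'rV[C R]_d) : hdot u 0 = 0.
Proof. by rewrite -hdotC hdot0l rmorph0. Qed.

Lemma ler_sqr_r (x y : R) : 0 <= y -> x ^+ 2 <= y ^+ 2 -> x <= y.
Proof.
move=> y0 xy; have [x0|x0] := leP 0 x; last by rewrite (le_trans (ltW x0)).
by rewrite -(@ler_pXn2r _ 2)// nnegrE.
Qed.

(** Near equality in the triangle inequality. [P] and [Q] belong to the two halves, of length [S],
    of a segment of length [2 * S]. As [ch (2 * S)] is about [2 * ch S ^+ 2] and [n <= 2], the end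
    points satisfy [C0 ^+ 2 * Bp * Bm <= 1] approximately, which cancels the factors other than [B]
    in the bound for [P * Q]. *)
Lemma cosh_product_bound (P Q B Bp Bm bp bm c2 C0 C' tau n : R) :
  0 <= P -> P <= 2 -> 0 <= Q -> Q <= 2 -> 0 <= B -> 0 <= Bp -> 0 <= Bm -> 0 < tau -> 100 * tau <= 1 ->
  0 < C0 -> 0 <= C' -> (1 - tau) * C' <= C0 -> (2 - tau) * C0 <= c2 ->
  P ^+ 2 <= C' * Bp * B -> Q ^+ 2 <= C' * Bm * B -> (1 - tau) * Bp <= bp -> (1 - tau) * Bm <= bm ->
  c2 ^+ 2 * bm * bp <= n ^+ 2 -> n ^+ 2 <= 4 -> P * Q <= B + 20 * tau.
Proof.
move=> P0 P2 Q0 Q2 B0 Bp0 Bm0 t0 t1 C00 C'0 CC' Cc HP HQ Hp Hm Hn n4.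
have u0 : 0 <= 1 - tau by lra. have v0 : 0 <= 2 - tau by lra.
have w0 : 0 <= (2 - tau) * C0 by rewrite mulr_ge0// ltW.
have X : ((2 - tau) * C0) ^+ 2 * ((1 - tau) * Bm) * ((1 - tau) * Bp) <= 4.
  have p1 : 0 <= (1 - tau) * Bm by rewrite mulr_ge0.
  have p2 : 0 <= (1 - tau) * Bp by rewrite mulr_ge0.
  have p3 : ((2 - tau) * C0) ^+ 2 <= c2 ^+ 2 by rewrite ler_pXn2r ?nnegrE// (le_trans w0).
  have p4 : 0 <= ((2 - tau) * C0) ^+ 2 by exact: sqr_ge0.
  apply: le_trans n4; apply: le_trans Hn; apply: ler_pM => //; first by rewrite mulr_ge0.
  by apply: ler_pM.
have Y : P ^+ 2 * Q ^+ 2 <= (C' * Bp * B) * (C' * Bm * B) by apply: ler_pM; rewrite // sqr_ge0.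
have CC2 : ((1 - tau) * C') ^+ 2 <= C0 ^+ 2 by rewrite ler_pXn2r ?nnegrE ?(ltW C00)// mulr_ge0.
have Z : (2 - tau) * (1 - tau) ^+ 2 * (P * Q) <= 2 * B.
  apply: ler_sqr_r; first by rewrite mulr_ge0.
  have -> : ((2 - tau) * (1 - tau) ^+ 2 * (P * Q)) ^+ 2 =
    (2 - tau) ^+ 2 * (1 - tau) ^+ 4 * (P ^+ 2 * Q ^+ 2) by ring.
  apply: le_trans (_ : (2 - tau) ^+ 2 * (1 - tau) ^+ 4 * (C' * Bp * B * (C' * Bm * B)) <= _).
    by rewrite ler_wpM2l// mulr_ge0 ?exprn_ge0.
  have -> : (2 - tau) ^+ 2 * (1 - tau) ^+ 4 * (C' * Bp * B * (C' * Bm * B)) =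
    ((1 - tau) * C') ^+ 2 * ((2 - tau) ^+ 2 * (1 - tau) ^+ 2 * (Bp * Bm * B ^+ 2)) by ring.
  apply: le_trans (_ : C0 ^+ 2 * ((2 - tau) ^+ 2 * (1 - tau) ^+ 2 * (Bp * Bm * B ^+ 2)) <= _).
    by rewrite ler_wpM2r// !mulr_ge0// sqr_ge0.
  have -> : C0 ^+ 2 * ((2 - tau) ^+ 2 * (1 - tau) ^+ 2 * (Bp * Bm * B ^+ 2)) =
    ((2 - tau) * C0) ^+ 2 * ((1 - tau) * Bm) * ((1 - tau) * Bp) * B ^+ 2 by ring.
  have -> : (2 * B) ^+ 2 = 4 * B ^+ 2 by ring.
  by rewrite ler_wpM2r// sqr_ge0.
have PQ4 : P * Q <= 2 * 2 by apply: ler_pM.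
have PQ0 : 0 <= P * Q by rewrite mulr_ge0.
have tp : (2 - 5 * tau) * (P * Q) <= 2 * B.
  apply: le_trans Z; rewrite ler_wpM2r//.
  have -> : (2 - tau) * (1 - tau) ^+ 2 = 2 - 5 * tau + tau ^+ 2 * (4 - tau) by ring.
  by rewrite lerDl; apply: mulr_ge0; [exact: sqr_ge0|lra].
have : tau * (P * Q) <= tau * (2 * 2) by rewrite ler_pM2l.
lra.
Qed.

(** Lower bounds on distances pass through [lo] and concern [f], upper bounds pass through [up] and
    concern [g]; once transferred to [g] they are the hypotheses of [near_midpoint]. *)
Lemma chart_midpoint D (a b ap am bp bm : 'rV[C R]_d) (K delta S e0 M tau theta : R) f g :
  approximate_chart D a K delta f g -> D a -> D b -> D ap -> D am -> D bp -> D bm ->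
  0 <= S -> S < K -> 0 < e0 -> 0 < delta -> 0 < tau -> 0 < theta -> theta <= 1 -> 100 * tau <= theta ^+ 2 ->
  2 * delta <= tau -> delta * ch K ^+ 2 <= tau -> (1 - tau) * ch (S + e0) ^+ 2 <= ch S ^+ 2 ->
  1 <= tau * ch S ^+ 2 -> 2 * ch (M + 1) ^+ 2 <= tau ^+ 2 * ch S ^+ 2 ->
  (kobayashi D a a < K%:E)%E -> kobayashi D a ap = S%:E -> kobayashi D a am = S%:E -> kobayashi D am ap = (2 * S)%:E ->
  kobayashi D bp b = S%:E -> kobayashi D bm b = S%:E -> kobayashi D bm bp = (2 * S)%:E ->
  (kobayashi D ap bp < (M + 1)%:E)%E -> (kobayashi D am bm < (M + 1)%:E)%E ->
  (kobayashi D a b < (M + 1)%:E)%E -> (kobayashi D a b < K%:E)%E ->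
  (kobayashi D a bp < K%:E)%E -> (kobayashi D a bm < K%:E)%E ->
  (S%:E <= kobayashi D ap b)%E -> (S%:E <= kobayashi D am b)%E ->
  bn2 (g b) * (ch (M + 1) ^+ 2)^-1 <= 20 * theta.
Proof.
move=> [[fa ga] fg tr lo up] Da Db Dap Dam Dbp Dbm S0 SK e00 de0 tau0 th0 th1 tauth dtau dK CC' tauC MC.
move=> aa aap aam amap bpb bmb bmbp apbp ambm ab abK abp abm apb amb.
set C0 := ch S ^+ 2 in CC' tauC MC; set C' := ch (S + e0) ^+ 2 in CC'; set CM := ch (M + 1) ^+ 2 in MC *.
set CK := ch K ^+ 2 in dK.
have C00 : 0 < C0 by rewrite exprn_gt0// ch_gt0.
have C'0 : 0 < C' by rewrite exprn_gt0// ch_gt0.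
have CM0 : 0 < CM by rewrite exprn_gt0// ch_gt0.
have CK0 : 0 < CK by rewrite exprn_gt0// ch_gt0.
have tau1 : 100 * tau <= 1 by apply: le_trans tauth _; rewrite expr_le1// ltW.
have [u1 u2 u3] : [/\ 0 <= 1 - tau, 0 <= 1 - 2 * tau & 0 <= 2 - tau] by clear -tau0 tau1; split; lra.
have de1 : delta <= 1 by clear -dtau tau0 tau1; lra.
have S2 : 0 <= 2 * S by rewrite mulr_ge0.
have dC : delta * C0 <= tau.
  by apply: le_trans dK; rewrite ler_pM2l// ler_pXn2r ?nnegrE ?(ltW (ch_gt0 _))// ch_le// ltW.
have C2 : (2 - tau) * C0 <= ch (2 * S) by rewrite ch_double -/C0; clear -tauC; lra.
(* [up] asks for a strict bound on the distance; [CC'] absorbs the enlargement of [S]. *)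
have Se : (S%:E < (S + e0)%:E)%E by rewrite lte_fin ltrDl.
pose A x := D x /\ (kobayashi D a x < K%:E)%E.
have Aa : A a by []. have Ab : A b by []. have Abp : A bp by []. have Abm : A bm by [].
have Aap : A ap by rewrite /A aap lte_fin.
have Aam : A am by rewrite /A aam lte_fin.
have fg1 x : A x -> [/\ bn2 (f x) < 1, bn2 (g x) < 1, bn2 (g x) <= bn2 (f x) & bn2 (f x) <= bn2 (g x) + delta].
  move=> Ax; have [x1 x2] := fg _ Ax; split=> //; first exact: le_lt_trans x2 x1.
  by have := le_trans (bn2_hdot_close _ _) (tr _ _ Ax Ax); rewrite ler_norml => /andP[h _]; clear -h; lra.
have close x y : A x -> A y -> cabs (1 - hdot (f x) (f y)) <= cabs (1 - hdot (g x) (g y)) + delta.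
  move=> Ax Ay; have -> : 1 - hdot (f x) (f y) = (1 - hdot (g x) (g y)) + (hdot (g x) (g y) - hdot (f x) (f y)) by ring.
  by apply: le_trans (cabsD _ _) _; rewrite lerD2l tr.
(* At distance [S] from the centre, [1 - |.|^2] is about [1 / ch S ^+ 2]. *)
have radial x : A x -> kobayashi D a x = S%:E -> 1 - 2 * tau <= C0 * (1 - bn2 (f x)) /\ C0 * (1 - bn2 (g x)) <= 2.
  move=> Ax ax; have [f1 g1 gf fgd] := fg1 _ Ax.
  have := lo a x S Aa Ax S0; rewrite ax lexx => /(_ isT).
  have := up a x (S + e0); rewrite ax => /(_ Se).
  rewrite fa ga bn2_0 !hdot0r !subr0 cabs1 expr1n mulr1 -/C' -/C0 => u l.
  have h1 : (1 - tau) * 1 <= (1 - tau) * (C' * (1 - bn2 (g x))) by rewrite ler_wpM2l.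
  have h2 : (1 - tau) * C' * (1 - bn2 (g x)) <= C0 * (1 - bn2 (g x)) by rewrite ler_wpM2r// subr_ge0 ltW.
  have h3 : C0 * (bn2 (f x) - bn2 (g x)) <= C0 * delta by rewrite ler_wpM2l ?(ltW C00)// lerBlDl.
  by clear -h1 h2 h3 l dC tau1; split; lra.
have [rp1 rp2] := radial _ Aap aap; have [rm1 rm2] := radial _ Aam aam.
have [fap gap gfap fgap] := fg1 _ Aap; have [fam gam gfam fgam] := fg1 _ Aam.
have [fb gb gfb fgb] := fg1 _ Ab.
have [fbp gbp gfbp fgbp] := fg1 _ Abp; have [fbm gbm gfbm fgbm] := fg1 _ Abm.
(* Near the sphere, bounded hyperbolic distance means small Euclidean distance; [MC] makes [S] large
   enough against [M]. *)
have near x y : A x -> A y -> C0 * (1 - bn2 (g x)) <= 2 -> (kobayashi D x y < (M + 1)%:E)%E ->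
    cabs (1 - hdot (g y) (g x)) <= tau.
  move=> Ax Ay rx /up xy; have [_ x1 _ _] := fg1 _ Ax; have [_ y1 _ _] := fg1 _ Ay.
  apply: ler_sqr_r; first exact: ltW.
  apply: le_trans xy _; rewrite -/CM.
  have yb := bn2_ge0 (g y).
  apply: le_trans (_ : CM * (1 - bn2 (g x)) * 1 <= _).
    by rewrite ler_wpM2l ?gerBl// mulr_ge0 ?(ltW CM0)// subr_ge0 ltW.
  have h1 : 2 * CM * (1 - bn2 (g x)) <= tau ^+ 2 * C0 * (1 - bn2 (g x)) by rewrite ler_wpM2r// subr_ge0 ltW.
  have h2 : tau ^+ 2 * (C0 * (1 - bn2 (g x))) <= tau ^+ 2 * 2 by rewrite ler_wpM2l// sqr_ge0.
  clear -h1 h2; lra.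
have far x : A x -> 1 - 2 * tau <= C0 * (1 - bn2 (f x)) -> (S%:E <= kobayashi D x b)%E ->
    1 - bn2 (g b) - 7 * tau <= cabs (1 - hdot (g b) (g x)) ^+ 2.
  move=> Ax rx xb; have := lo x b S Ax Ab S0 xb; rewrite -/C0 => l.
  have [x1 gx1 _ _] := fg1 _ Ax.
  have h1 : (1 - 2 * tau) * (1 - bn2 (f b)) <= C0 * (1 - bn2 (f x)) * (1 - bn2 (f b)).
    by rewrite ler_wpM2r// subr_ge0 ltW.
  have bb := bn2_ge0 (f b).
  have h2 : tau * bn2 (f b) >= 0 by rewrite mulr_ge0 ?(ltW tau0).
  have cl := close _ _ Ab Ax; have N0 := cabs_ge0 (1 - hdot (g b) (g x)).
  have N2 := cabs_one_sub_le2 gb gx1.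
  set N := cabs (1 - hdot (g b) (g x)) in cl N0 N2 *.
  have h3 : cabs (1 - hdot (f b) (f x)) ^+ 2 <= (N + delta) ^+ 2.
    by rewrite ler_pXn2r ?nnegrE ?cabs_ge0// addr_ge0// ltW.
  have h4 : N * delta <= 2 * delta by rewrite ler_wpM2r// ltW.
  have h5 : delta * delta <= delta * 1 by rewrite ler_wpM2l// ltW.
  clear -h1 h2 h3 h4 h5 l fgb dtau tau0 de0; rewrite !expr2 in h3 *; rewrite expr2 in l; lra.
(* Within distance [K] of [a], [1 - bn2 (g x)] is at least [1 / ch K ^+ 2], so the additive error
   [delta] is a relative error [tau]; hence the hypothesis [dK]. *)
have trans x : A x -> (1 - tau) * (1 - bn2 (g x)) <= 1 - bn2 (f x).
  move=> Ax; have [x1 gx1 _ fgx] := fg1 _ Ax.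
  have := up a x K Ax.2; rewrite ga bn2_0 hdot0r !subr0 cabs1 expr1n mulr1 -/CK => u.
  have h1 : delta * 1 <= delta * (CK * (1 - bn2 (g x))) by rewrite ler_wpM2l// ltW.
  have h2 : delta * CK * (1 - bn2 (g x)) <= tau * (1 - bn2 (g x)) by rewrite ler_wpM2r// subr_ge0 ltW.
  clear -h1 h2 fgx; lra.
(* [ch (2 * S) ^+ 2] is about [4 * C0 ^+ 2], and by [radial] the two factors [1 - |.|^2] use up
   [C0 ^+ 2]. *)
have opp : 2 - 6 * tau <= cabs (1 - hdot (g ap) (g am)).
  have := lo am ap (2 * S) Aam Aap; rewrite amap lexx => /(_ _ isT) l.
  have cl := close _ _ Aap Aam.
  suff h : 2 - 5 * tau <= cabs (1 - hdot (f ap) (f am)) by clear -h cl dtau tau0; lra.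
  apply: ler_sqr_r; first exact: cabs_ge0.
  apply: le_trans (l S2).
  apply: le_trans (_ : ((2 - tau) * (1 - 2 * tau)) ^+ 2 <= _).
    have h : 2 - 5 * tau <= (2 - tau) * (1 - 2 * tau) by clear -tau0; rewrite mulrBl !mulrBr; have := mulr_ge0 (ltW tau0) (ltW tau0); lra.
    have h' : 0 <= 2 - 5 * tau by clear -tau1; lra.
    by rewrite ler_pXn2r ?nnegrE// (le_trans h').
  have h1 : ((2 - tau) * C0) ^+ 2 <= ch (2 * S) ^+ 2.
    by rewrite ler_pXn2r ?nnegrE ?(ltW (ch_gt0 _))// mulr_ge0 ?(ltW C00).
  have h2 : (1 - 2 * tau) * (1 - 2 * tau) <= (C0 * (1 - bn2 (f am))) * (C0 * (1 - bn2 (f ap))).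
    by apply: ler_pM.
  apply: le_trans (_ : ((2 - tau) * C0) ^+ 2 * ((1 - bn2 (f am)) * (1 - bn2 (f ap))) <= _); last first.
    by rewrite -mulrA ler_wpM2r// mulr_ge0// subr_ge0 ltW.
  have := ler_wpM2l (sqr_ge0 (2 - tau)) h2; clear; rewrite !expr2; lra.
apply: (@near_midpoint R d (g ap) (g am) (g b) (g bp) (g bm) tau theta) => //.
- by rewrite invr_gt0.
- exact: near.
- exact: near.
- have v1 := up bp b (S + e0); have v2 := up bm b (S + e0); rewrite bpb in v1; rewrite bmb in v2.
  have := lo bm bp (2 * S) Abm Abp; rewrite bmbp lexx => /(_ _ isT) l.
  apply: (@cosh_product_bound _ _ _ (1 - bn2 (g bp)) (1 - bn2 (g bm)) (1 - bn2 (f bp)) (1 - bn2 (f bm))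
    (ch (2 * S)) C0 C' tau (cabs (1 - hdot (f bp) (f bm)))); rewrite ?cabs_ge0 ?subr_ge0 ?cabs_one_sub_le2 ?(ltW C'0) ?(ltW fbp) ?(ltW gb) ?(ltW gbp) ?(ltW gbm)//.
  + exact: v1.
  + exact: v2.
  + exact: trans.
  + exact: trans.
  + exact: l.
  + have := cabs_one_sub_le2 fbp fbm; have := cabs_ge0 (1 - hdot (f bp) (f bm)) => h0 h.
    have -> : (4 : R) = 2 ^+ 2 by ring.
    by rewrite ler_pXn2r ?nnegrE.
- exact: far.
- exact: far.
- have := up a b (M + 1) ab; rewrite ga bn2_0 hdot0r !subr0 cabs1 expr1n mulr1 -/CM => u.
  by rewrite -[_^-1]mul1r ler_pdivrMr// mulrC.
Qed.
End chart_midpoint.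

Section midpoint_estimate.
Context {R : realType} {d : nat}.
Implicit Types (D : set 'rV[C R]_d).

Lemma ch2_ge1 (x : R) : 1 <= ch x ^+ 2.
Proof. by have := ch2_sh2 x; have := sqr_ge0 (sh x); lra. Qed.

Lemma ch2_unbounded (X : R) : exists2 S, 0 <= S & X <= ch S ^+ 2.
Proof.
exists (2 * `|X| + 1); first by rewrite addr_ge0// mulr_ge0.
set S := _ + 1.
have h := expR_ge1Dx S; have hn := expR_ge0 (- S).
have h1 : `|X| + 1 <= ch S by rewrite /ch ler_pdivlMr//; rewrite /S in h *; lra.
have hX := ler_norm X; have hX0 := normr_ge0 X.
have : ch S * 1 <= ch S * ch S by rewrite ler_pM2l ?ch_gt0//; lra.
rewrite expr2; lra.
Qed.

(** The relative loss is uniform in [S], so [tau] can be fixed before [S]. *)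
Lemma chD_le (S t : R) : 0 <= t -> (1 - 2 * t) * ch (S + t) ^+ 2 <= ch S ^+ 2.
Proof.
move=> t0.
have h1 : ch (S + t) <= expR t * ch S.
  have h : expR (- S - t) <= expR (t - S) by rewrite ler_expR; lra.
  by rewrite /ch mulrA mulrDr -!expRD opprD [t + S]addrC ler_pM2r// lerD2l.
have h2 : 1 - 2 * t <= expR (- (2 * t)) by have := expR_ge1Dx (- (2 * t)).
have h3 : ch (S + t) ^+ 2 <= expR (2 * t) * ch S ^+ 2.
  have -> : expR (2 * t) = expR t ^+ 2 by rewrite expr2 -expRD; congr expR; ring.
  by rewrite -exprMn ler_pXn2r ?nnegrE ?mulr_ge0 ?expR_ge0 ?(ltW (ch_gt0 _)).
apply: le_trans (_ : expR (- (2 * t)) * ch (S + t) ^+ 2 <= _); first by rewrite ler_wpM2r// sqr_ge0.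
apply: le_trans (_ : expR (- (2 * t)) * (expR (2 * t) * ch S ^+ 2) <= _); first by rewrite ler_wpM2l// expR_ge0.
by rewrite mulrA -expRD addNr expR0 mul1r.
Qed.

Lemma th2_gt0 (x : R) : 0 < x -> 0 < th x ^+ 2.
Proof.
move=> x0; rewrite exprn_even_gt0//=; apply/eqP => h.
by have := thK x; rewrite h -th0 thK => xx; rewrite -xx ltxx in x0.
Qed.

(** Order of choice: [theta] and [tau] from [M] and [eta], then [S] large for [tau], [K] from [S]
    and [M], [delta] from [K], and last [e] from the existence of charts. *)
Lemma midpoint_estimate D (M eta : R) : open D -> bounded_set D -> 0 <= M -> 0 < eta ->
  exists S e : R, [/\ 0 <= S, 0 < e & forall a b ap am bp bm : 'rV[C R]_d,
  ((1 - e)%:E < quotient_invariant D a)%E ->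
  D a -> D b -> D ap -> D am -> D bp -> D bm -> kobayashi D a a = 0%E ->
  kobayashi D a ap = S%:E -> kobayashi D a am = S%:E -> kobayashi D am ap = (2 * S)%:E ->
  kobayashi D bp b = S%:E -> kobayashi D bm b = S%:E -> kobayashi D bm bp = (2 * S)%:E ->
  (kobayashi D ap bp <= M%:E)%E -> (kobayashi D am bm <= M%:E)%E -> (kobayashi D a b <= M%:E)%E ->
  (kobayashi D a bp <= (S + M)%:E)%E -> (kobayashi D a bm <= (S + M)%:E)%E ->
  (S%:E <= kobayashi D ap b)%E -> (S%:E <= kobayashi D am b)%E ->
  (kobayashi D a b < eta%:E)%E].
Proof.
move=> Do Db M0 eta0.
have b0 := th2_gt0 eta0; set b := th eta ^+ 2 in b0.
have b1 : b < 1 := th2_lt1 eta.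
have CM1 := ch2_ge1 (M + 1); set CM := ch (M + 1) ^+ 2 in CM1.
have CM0 : 0 < CM by lra.
have mu0 : 0 < CM^-1 by rewrite invr_gt0.
have mu1 : CM^-1 <= 1 by rewrite invf_le1.
(* Makes the bound [20 * theta] of [chart_midpoint] equal to [CM^-1 * b / 2], whence
   [bn2 (g b') <= b / 2]. *)
pose theta := CM^-1 * b / 40.
have th0 : 0 < theta by rewrite !divr_gt0// mulr_gt0.
have thb : theta <= b / 40 by rewrite /theta ler_pM2r// ler_piMl// ltW.
have th1 : theta <= 1 by lra.
pose tau := theta ^+ 2 / 100.
have tau0 : 0 < tau by rewrite divr_gt0// exprn_gt0.
have tau1 : 100 * tau <= theta by rewrite /tau expr2; have : theta * theta <= theta * 1 by [rewrite ler_pM2l]; lra.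
have w1 : 0 < 2 * CM / tau ^+ 2 by apply: divr_gt0; [rewrite mulr_gt0|rewrite exprn_gt0].
have [S S0 HS] := ch2_unbounded (tau^-1 + 2 * CM / tau ^+ 2).
have tS : 1 <= tau * ch S ^+ 2.
  apply: le_trans (_ : tau * (tau^-1 + 2 * CM / tau ^+ 2) <= _); last by rewrite ler_pM2l.
  by rewrite mulrDr divff ?gt_eqF// lerDl; apply: mulr_ge0; rewrite (ltW tau0, ltW w1).
have MS : 2 * CM <= tau ^+ 2 * ch S ^+ 2.
  apply: le_trans (_ : tau ^+ 2 * (tau^-1 + 2 * CM / tau ^+ 2) <= _); last first.
    by rewrite ler_pM2l// exprn_gt0.
  rewrite mulrDr [X in _ <= _ + X]mulrC divfK ?expf_neq0 ?gt_eqF// lerDr mulr_ge0 ?sqr_ge0//.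
  by rewrite invr_ge0 ltW.
(* All the points whose chart images are used lie within [S + M] of [a], except [ap] and [am], which
   lie at [S]. *)
pose K := S + M + 1.
have CK1 := ch2_ge1 K.
have CK0 : 0 < ch K ^+ 2 by lra.
pose delta := tau / 2 / ch K ^+ 2.
have de0 : 0 < delta by rewrite divr_gt0// divr_gt0.
have de1 : delta * ch K ^+ 2 <= tau by rewrite /delta divfK ?gt_eqF//; lra.
have de2 : 2 * delta <= tau.
  have : delta * 1 <= delta * ch K ^+ 2 by rewrite ler_pM2l.
  by rewrite {2}/delta divfK ?gt_eqF//; lra.
have K0 : 0 < K by rewrite /K; lra.
have [e e0 He] := approximate_chart_exists Do Db K0 de0.
exists S, e; split=> // a b' ap am bp bm qa Da Db' Dap Dam Dbp Dbm aa aap aam amap bpb bmb bmbp apbp ambm ab abp abm apb amb.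
have [f [g fg]] := He a Da qa.
have lt (u v : R) x : u < v -> (x <= u%:E)%E -> (x < v%:E)%E.
  by move=> uv xu; apply: le_lt_trans xu _; rewrite lte_fin.
rewrite ltNge; apply/negP => eab.
have CC : (1 - tau) * ch (S + tau / 2) ^+ 2 <= ch S ^+ 2.
  by have := @chD_le S (tau / 2); rewrite [2 * _]mulrC divfK//; apply; lra.
have SK : S < K by rewrite /K; lra.
have aaK : (kobayashi D a a < K%:E)%E by rewrite aa lte_fin.
have t2 : 0 < tau / 2 by lra.
have t100 : 100 * tau <= theta ^+ 2 by rewrite /tau mulrC divfK.
have M1 : M < M + 1 by rewrite ltrDl.
have MK : M < K by rewrite /K; lra.
have SMK : S + M < K by rewrite /K; lra.
have := @chart_midpoint R d D a b' ap am bp bm K delta S (tau / 2) M tau theta f g fg Da Db' Dap Dam Dbp Dbm S0 SK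
  t2 de0 tau0 th0 th1 t100 de2 de1 CC tS MS aaK aap aam amap bpb bmb bmbp
  (lt _ _ _ M1 apbp) (lt _ _ _ M1 ambm) (lt _ _ _ M1 ab) (lt _ _ _ MK ab)
  (lt _ _ _ SMK abp) (lt _ _ _ SMK abm) apb amb.
rewrite -/CM => h.
have h1 : bn2 (g b') * CM^-1 <= b / 2 * CM^-1 by apply: le_trans h _; rewrite /theta; lra.
rewrite ler_pM2r// in h1.
case: fg => [[fa ga] fg1 tr lo _].
have Ab : D b' /\ (kobayashi D a b' < K%:E)%E by split=> //; exact: lt MK ab.
have Aa : D a /\ (kobayashi D a a < K%:E)%E by [].
have h2 := le_trans (bn2_hdot_close _ _) (tr _ _ Ab Ab).
have := lo _ _ eta Aa Ab (ltW eta0) eab; rewrite fa bn2_0 hdot0r !subr0 cabs1 expr1n mulr1 => h3.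
(* A distance of at least [eta] would give [b <= bn2 (f b')], whereas [bn2 (g b') <= b / 2] and the
   two differ by at most [delta], far below [b / 2]. *)
have h4 : 1 - bn2 (f b') <= 1 - b.
  by rewrite /b onem_th2 -[X in _ <= X]mul1r ler_pdivlMr ?exprn_gt0 ?ch_gt0// mulrC.
rewrite ler_norml in h2; case/andP: h2 => h2 h2'.
lra.
Qed.
End midpoint_estimate.

(** * Horofunctions along geodesic rays *)

Section horofunctions_along_rays.
Context {R : realType} {X : metricType R}.
Implicit Types (p x y : X) (gamma : R -> X) (zeta : cts_space X).

Definition horo_value zeta x : R := (zeta : continuousType X R) x.

Lemma ends_at_pointwise p gamma zeta x : ends_at p gamma zeta ->
  (mdist x (gamma t) - mdist p (gamma t)) @[t --> +oo] --> horo_value zeta x.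
Proof.
move=> gz.
have c := @initial_continuous (continuousType X R) {family compact, X -> R} (fun f => f) zeta.
have h := cvg_comp _ _ gz c.
have FF : Filter ((horo_embed p (gamma t) : X -> R) @[t --> +oo]) by exact: fmap_filter.
have h' := pointwise_cvg_compact_family FF h.
exact: ((pointwise_cvgP _ FF).1 h' x).
Qed.

(** In the difference of the defining limits the base point cancels, and the difference is the
    constant [- s] as soon as [t >= s]. *)
Lemma horo_value_ray p gamma zeta (s : R) : geodesic_ray gamma -> ends_at p gamma zeta -> 0 <= s ->
  horo_value zeta (gamma s) = horo_value zeta (gamma 0) - s.
Proof.
move=> gg gz s0; have h1 := ends_at_pointwise (x := gamma s) gz; have h0 := ends_at_pointwise (x := gamma 0) gz.
have {h0 h1} /(_ _) h := cvgB h1 h0.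
suff : horo_value zeta (gamma s) - horo_value zeta (gamma 0) = - s by lra.
apply: (norm_cvg_unique h); apply: cvg_near_cst; near=> t.
have ts : s <= t by near: t; apply: nbhs_pinfty_ge; rewrite num_real.
have i0 (u : R) : 0 <= u -> u \in `[0, +oo[ by move=> u0; rewrite in_itv /= u0.
have t0 := le_trans s0 ts.
rewrite !fctE !gg ?i0// sub0r normrN (ger0_norm t0) ler0_norm; lra.
Unshelve. all: by end_near. Qed.

Lemma horo_value_lipschitz p gamma zeta x y : ends_at p gamma zeta ->
  horo_value zeta x - horo_value zeta y <= mdist x y.
Proof.
move=> gz; have /(_ _) h := cvgB (ends_at_pointwise (x := x) gz) (ends_at_pointwise (x := y) gz).
apply: (cvgr_to_le h); apply: nearW => t; rewrite !fctE.
by have := metric_triangle x y (gamma t); lra.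
Qed.

End horofunctions_along_rays.

Lemma kobayashi_mdist (R : realType) (d : nat) (D : set 'rV[C R]_d) (D_hyp : hyperbolic D)
    (x y : kobayashi_space D_hyp) :
  kobayashi D (kobayashi_point x) (kobayashi_point y) = (mdist x y)%:E.
Proof. by apply/esym; apply: fineK; apply: kobayashi_fin => //; exact: set_valP. Qed.

Theorem theorem1p6 (R : realType) (d : nat) (d_gt0 : (0 < d)%N)
  (D : set 'rV[C R]_d) (D_domain : domain D) (D_bounded : bounded_set D)
  (D_hyp : hyperbolic D) (D_complete : complete_metric (kobayashi_space D_hyp))
  (p : kobayashi_space D_hyp) (zeta : cts_space (kobayashi_space D_hyp))
  (zeta_boundary : horo_boundary p zeta)
  (q_to_1 : quotient_invariant D (kobayashi_point z)
              @[z --> horo_nbhs p zeta] --> 1%E) :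
  approaching_geodesics p zeta.
Proof.
move=> gamma sigma gg gs asym gz sz.
pose T := horo_value zeta (sigma 0) - horo_value zeta (gamma 0).
exists T.
have i0 (u : R) : 0 <= u -> u \in `[0, +oo[ by move=> u0; rewrite in_itv /= u0.
have [M0 M00 HM0] : exists2 M0 : R, 0 <= M0 & forall t : R, 0 <= t -> mdist (gamma t) (sigma t) <= M0.
  move: asym; rewrite /asymptotic; set s := ereal_sup _ => sfin.
  have ub (t : R) : 0 <= t -> ((mdist (gamma t) (sigma t))%:E <= s)%E.
    by move=> t0; apply: ereal_sup_ubound; exists t => //; exact: i0.
  have s0 : (0 <= s)%E by apply: le_trans (ub 0 _); rewrite ?lee_fin ?mdist_ge0.
  have fs : s \is a fin_num by rewrite ge0_fin_numE.
  exists (fine s); first by rewrite fine_ge0.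
  by move=> t t0; rewrite -lee_fin (fineK fs); exact: ub.
(* Asymptoticity compares the rays at equal times; moving along [sigma] by [T] costs [|T|]. *)
pose M := M0 + `|T|.
have M1 : 0 <= M by rewrite addr_ge0.
have HM (t : R) : 0 <= t -> 0 <= t + T -> mdist (gamma t) (sigma (t + T)) <= M.
  move=> t0 tT; apply: le_trans (metric_triangle _ (sigma t) _) _.
  apply: lerD; first exact: HM0.
  by rewrite gs ?i0// opprD addNKr normrN.
apply/cvgrPdist_lt => eta eta0.
have [oD _ _] := D_domain.
have [S [e [S0 e0 mid]]] := midpoint_estimate oD D_bounded M1 eta0.
(* By [gz] the ray eventually enters the trace of every neighbourhood of [zeta], so the limit along
   [horo_nbhs] applies to [gamma t]. *)
have qn : \forall t \near +oo, ((1 - e)%:E < quotient_invariant D (kobayashi_point (gamma t)))%E.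
  have /q_to_1 [U Uz UV] : nbhs 1%E [set x : \bar R | ((1 - e)%:E < x)%E].
    by apply: open_nbhs_nbhs; split; [exact: open_ereal_gt_ereal|rewrite /= lte_fin; lra].
  near=> t; apply: UV; near: t; exact: gz.
near=> t.
have qt : ((1 - e)%:E < quotient_invariant D (kobayashi_point (gamma t)))%E by near: t.
(* Keeps [t - S] and [t + T - S] in the domain [[0, +oo[] of the rays. *)
have tS : S + `|T| <= t by near: t; apply: nbhs_pinfty_ge; rewrite num_real.
have nT := ler_norm T; have nT' := ler_norm (- T); rewrite normrN in nT'; have nT0 := normr_ge0 T.
have mv (rho : R -> kobayashi_space D_hyp) : geodesic_ray rho -> forall u v w : R, 0 <= u -> 0 <= v ->
    0 <= w -> u - v = w \/ v - u = w -> mdist (rho u) (rho v) = w.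
  move=> h u v w u0 v0 w0 uvw; rewrite h ?i0//.
  by case: uvw w0 => <- w0; [rewrite ger0_norm|rewrite distrC ger0_norm].
have zg (u : R) : 0 <= u -> horo_value zeta (gamma u) = horo_value zeta (gamma 0) - u by exact: horo_value_ray gz.
have zs (u : R) : 0 <= u -> horo_value zeta (sigma u) = horo_value zeta (sigma 0) - u by exact: horo_value_ray sz.
have TE : T = horo_value zeta (sigma 0) - horo_value zeta (gamma 0) by [].
have lip x y := @horo_value_lipschitz R _ p gamma zeta x y gz.
rewrite sub0r normrN ger0_norm ?mdist_ge0// -lte_fin -kobayashi_mdist.
have HMt : mdist (gamma t) (sigma (t + T)) <= M by apply: HM; lra.
apply: (mid _ _ (kobayashi_point (gamma (t + S))) (kobayashi_point (gamma (t - S)))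
  (kobayashi_point (sigma (t + T + S))) (kobayashi_point (sigma (t + T - S)))) => //;
  try exact: set_valP; rewrite kobayashi_mdist ?lee_fin//.
- by rewrite mdistxx.
- by rewrite (mv _ gg _ _ S)//; lra.
- by rewrite (mv _ gg _ _ S)//; lra.
- by rewrite (mv _ gg _ _ (2 * S))//; lra.
- by rewrite (mv _ gs _ _ S)//; lra.
- by rewrite (mv _ gs _ _ S)//; lra.
- by rewrite (mv _ gs _ _ (2 * S))//; lra.
- by rewrite addrAC; apply: HM; lra.
- by rewrite addrAC; apply: HM; lra.
- apply: le_trans (metric_triangle _ (sigma (t + T)) _) _.
  by rewrite [mdist (sigma _) _](mv _ gs _ _ S); lra.
- apply: le_trans (metric_triangle _ (sigma (t + T)) _) _.
  by rewrite [mdist (sigma _) _](mv _ gs _ _ S); lra.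
- have := lip (sigma (t + T)) (gamma (t + S)); have := zg (t + S); have := zs (t + T).
  by rewrite (metric_sym (gamma _)) => h1 h2; rewrite h1 ?h2; lra.
- have := lip (gamma (t - S)) (sigma (t + T)); have := zg (t - S); have := zs (t + T).
  by move=> h1 h2; rewrite h2 ?h1; lra.
Unshelve. all: by end_near. Qed.
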